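(* For every $0\le i\le n$, the naive local model $\mathrm M^{\mathrm{naive}}_{\{i\}}$ is topologically flat over $\mathcal O_{F_0}$, and hence the spin local model $\mathrm M^\pm_{\{i\}}$ is topologically flat over $\mathcal O_F$.
   Context: Topologically flat over a discrete valuation ring means the generic fiber is Zariski dense. Setting: $F_0$ complete discretely valued field, ring of integers $\mathcal O_{F_0}$, uniformizer $\pi_0$, residue field $k$ of characteristic $p>2$; $F=F_0(\pi)$, $\pi^2=-\pi_0$; $n\ge 1$; $V$ with basis $e_1,\dots,e_{2n},f_1,f_2$ and symmetric form $\phi(e_a,e_b)=\delta_{a+b,2n+1}$, $\phi(f_1,f_1)=\pi_0$, $\phi(f_2,f_2)=1$, other pairings of basis vectors $0$. $\Lambda_i=\mathcal O_{F_0}\langle\pi_0^{-1}e_1,\dots,\pi_0^{-1}e_i,e_{i+1},\dots,e_{2n},\pi_0^{-1}f_1,f_2\rangle$, $\Lambda_{-i}=\Lambda_i^\vee=\mathcal O_{F_0}\langle e_1,\dots,e_{2n-i},\pi_0e_{2n+1-i},\dots,\pi_0e_{2n},f_1,f_2\rangle$; $\Lambda_{\{i\}}$ is the chain of all $\pi_0^{-d}\Lambda_{\pm i}$. $\mathrm M^{\mathrm{naive}}_{\{i\}}$ is the projective $\mathcal O_{F_0}$-scheme representing $R\mapsto\{(\mathcal F_\Lambda)_{\Lambda\in\Lambda_{\{i\}}}\}$, $\mathcal F_\Lambda\subset\Lambda\otimes R$ Zariski locally a direct summand of rank $n+1$, $\mathcal F_\Lambda\perp\mathcal F_{\Lambda^\vee}$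 under the perfect pairing $\Lambda_R\times\Lambda^\vee_R\to R$ induced by $\phi$, transition maps for inclusions carrying $\mathcal F_\Lambda$ into $\mathcal F_{\Lambda'}$, multiplication by $\pi_0$ identifying $\mathcal F_\Lambda$ with $\mathcal F_{\pi_0\Lambda}$. $\mathrm M^\pm_{\{i\}}$ is the closed subscheme of $\mathrm M^{\mathrm{naive}}_{\{i\}}\otimes\mathcal O_F$ cut out by the spin condition: with $e'_1,\dots,e'_{2n+2}=e_1,\dots,e_n,f_1+\pi f_2,(f_1-\pi f_2)/(2\pi_0),e_{n+1},\dots,e_{2n}$, $e'_S$ the increasing wedge for $|S|=n+1$, $S^\perp=\{1,\dots,2n+2\}\setminus\{2n+3-s:s\in S\}$, $\sigma_S$ the permutation sending $1,\dots,n+1$ increasingly onto $S$ and the rest increasingly onto its complement, $W_\pm$ the $\pm1$-eigenspaces of $a(e'_S)=\mathrm{sgn}(\sigma_S)e'_{S^\perp}$, one requires that for each $\Lambda$, Zariski locally, $\wedge^{n+1}\mathcal F_\Lambda$ lies in the image of $(\wedge^{n+1}_{\mathcal O_F}(\Lambda\otimes\mathcal O_F)\cap W_\pm)\otimes R$ in $\wedge^{n+1}_R(\Lambda\otimes R)$. *)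

(* Defs.v *)
From HB Require Import structures.
From mathcomp Require Import all_boot all_order all_fingroup all_algebra all_field.
From mathcomp Require Import boolp classical_sets zify.

Set Implicit Arguments.
Unset Strict Implicit.
Unset Printing Implicit Defensive.

Import Order.TTheory GRing.Theory Num.Theory.
Local Open Scope ring_scope.
Local Open Scope classical_set_scope.

(* Normalised discrete valuation; the value at 0 is junk (morally +oo), so every
   use below singles out 0. *)
Record dval (K : fieldType) := DVal {
  dval_fun :> K -> int;
  dvalM : forall x y, x != 0 -> y != 0 ->
    dval_fun (x * y) = dval_fun x + dval_fun y;
  dvalD : forall x y, x != 0 -> y != 0 -> x + y != 0 ->
    Num.min (dval_fun x) (dval_fun y) <= dval_fun (x + y);
  dval_surj : exists2 x, x != 0 & dval_fun x = 1 }.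

Definition val_ge (K : fieldType) (v : dval K) (m : int) : pred K :=
  fun x => (x == 0) || (m <= v x).

Definition dval_complete (K : fieldType) (v : dval K) : Prop :=
  forall u : nat -> K,
    (forall m : int, exists N : nat, forall i j : nat,
       (N <= i)%N -> (N <= j)%N -> val_ge v m (u i - u j)) ->
    exists l : K, forall m : int, exists N : nat, forall i : nat,
      (N <= i)%N -> val_ge v m (u i - l).

Definition uniformizer (K : fieldType) (v : dval K) (x : K) : Prop :=
  x != 0 /\ v x = 1.

(* [p \in [pchar k]] for the residue field k = {v >= 0} / {v >= 1}. *)
Definition residue_pchar (K : fieldType) (v : dval K) (p : nat) : Prop :=
  prime p /\ val_ge v 1 p%:R.

Section ValRing.
Variables (K : fieldType) (v : dval K).

Definition in_valring : {pred K} := val_ge v 0.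

Lemma dval1 : v 1 = 0.
Proof.
have := dvalM v (oner_neq0 K) (oner_neq0 K); rewrite mulr1 => h.
by apply: (addrI (v 1)); rewrite -h addr0.
Qed.

Lemma dvalN x : x != 0 -> v (- x) = v x.
Proof.
move=> x0; have N1 : (-1 : K) != 0 by rewrite oppr_eq0 oner_eq0.
have := dvalM v N1 N1; rewrite mulrNN mulr1 dval1 => /esym/eqP.
rewrite -mulr2n mulrn_eq0 /= => /eqP vN1.
by rewrite -mulN1r dvalM // vN1 add0r.
Qed.

Fact in_valring_subring : subring_closed in_valring.
Proof.
split=> [|x y|x y]; rewrite !unfold_in /val_ge.
- by rewrite dval1 lexx orbT.
- case: (eqVneq x 0) => [->|x0] /=.
    case: (eqVneq y 0) => [->|y0] /=; first by rewrite subr0 eqxx.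
    by rewrite sub0r dvalN // => _ ->; rewrite orbT.
  case: (eqVneq y 0) => [->|y0] /=; first by rewrite subr0 => ->; rewrite orbT.
  move=> vx vy; case: (eqVneq (x - y) 0) => //= xy.
  have yN : - y != 0 by rewrite oppr_eq0.
  apply: le_trans (dvalD v x0 yN xy).
  by rewrite le_min dvalN // vx.
- case: (eqVneq x 0) => [->|x0] /=; first by rewrite mul0r eqxx.
  case: (eqVneq y 0) => [->|y0] /=; first by rewrite mulr0 eqxx.
  by move=> vx vy; rewrite dvalM // addr_ge0 // orbT.
Qed.

HB.instance Definition _ := GRing.isSubringClosed.Build K in_valring
  in_valring_subring.

Record valring := ValRing { valring_val : K; _ : valring_val \in in_valring }.

HB.instance Definition _ := [isSub for valring_val].
HB.instance Definition _ := [Choice of valring by <:].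
HB.instance Definition _ := [SubChoice_isSubComNzRing of valring by <:].

End ValRing.

(* The valuation of F restricts to (twice) that of F0: F / F0 is ramified
   quadratic and both valuations are normalised. *)
Definition dval_extends2 (F0 : fieldType) (v : dval F0)
    (F : fieldExtType F0) (w : dval F) : Prop :=
  forall x : F0, x != 0 -> w (x%:A) = v x *+ 2.

Section Inclusion.
Variables (F0 : fieldType) (v : dval F0) (F : fieldExtType F0) (w : dval F).
Hypothesis ext : dval_extends2 v w.

Fact valring_incl_subproof (a : valring v) :
  ((\val a)%:A : F) \in in_valring w.
Proof.
case: a => a /=; rewrite !unfold_in /val_ge; case: (eqVneq a 0) => [->|a0] /=.
  by rewrite scale0r eqxx.
by move=> va; rewrite ext // mulrn_wge0 // orbT.
Qed.

Definition valring_incl (a : valring v) : valring w :=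
  ValRing (valring_incl_subproof a).

Fact valring_incl_zmod : zmod_morphism valring_incl.
Proof. by move=> a b; apply: val_inj; rewrite rmorphB /= -scalerBl. Qed.

Fact valring_incl_monoid : monoid_morphism valring_incl.
Proof.
split; first by apply: val_inj; rewrite /= scale1r.
by move=> a b; apply: val_inj; rewrite /= -scalerAl mul1r scalerA.
Qed.

HB.instance Definition _ :=
  GRing.isZmodMorphism.Build (valring v) (valring w) valring_incl
    valring_incl_zmod.
HB.instance Definition _ :=
  GRing.isMonoidMorphism.Build (valring v) (valring w) valring_incl
    valring_incl_monoid.

End Inclusion.

Section Submodules.
Variables (R : comPzRingType) (m : nat).

Definition is_submodule (F : set 'rV[R]_m) : Prop :=
  F 0 /\ forall (a : R) x y, F x -> F y -> F (a *: x + y).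

Definition lin_span (G : set 'rV[R]_m) : set 'rV[R]_m :=
  [set x | exists k (g : 'M[R]_(k, m)) (a : 'rV[R]_k),
     (forall i, G (row i g)) /\ x = a *m g].

(* F is a direct summand of R^m which is free of rank r. *)
Definition free_summand (r : nat) (F : set 'rV[R]_m) : Prop :=
  (exists G : set 'rV[R]_m, [/\ is_submodule G,
     forall x, exists y z, [/\ F y, G z & x = y + z] &
     forall x, F x -> G x -> x = 0]) /\
  (exists A : 'M[R]_(r, m),
     (forall u : 'rV[R]_r, u *m A = 0 -> u = 0) /\
     (forall x, F x <-> exists u : 'rV[R]_r, x = u *m A)).

End Submodules.

(* Image of F (x)_R R' in R'^m; for F a local direct summand this is the pullback
   of F along R -> R'. *)
Definition base_change (R R' : comPzRingType) (phi : {rmorphism R -> R'}) m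
    (F : set 'rV[R]_m) : set 'rV[R']_m :=
  lin_span [set map_mx phi x | x in F].

(* phi exhibits R' as the localization R[1/f]. *)
Definition is_localization (R R' : comPzRingType) (phi : {rmorphism R -> R'})
    (f : R) : Prop :=
  [/\ exists g : R', phi f * g = 1,
      forall y : R', exists (a : R) (k : nat), y * phi f ^+ k = phi a &
      forall a : R, phi a = 0 -> exists k : nat, f ^+ k * a = 0].

(* P holds on every member of some cover of Spec R by principal opens. *)
Definition zariski_locally (R : comPzRingType)
    (P : forall R' : comPzRingType, {rmorphism R -> R'} -> Prop) : Prop :=
  exists (k : nat) (f : 'I_k -> R),
    (exists c : 'I_k -> R, \sum_j c j * f j = 1) /\
    forall j, exists (R' : comPzRingType) (phi : {rmorphism R -> R'}),
      is_localization phi (f j) /\ P R' phi.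

(* A functor on O-algebras, as a subfunctor of an ambient functor of data which
   does not involve the structure map O -> R. *)
Record moduli (O : comPzRingType) := Moduli {
  datum : comPzRingType -> Type;
  pull : forall R R' : comPzRingType,
    {rmorphism R -> R'} -> datum R -> datum R';
  point : forall R : comPzRingType, {rmorphism O -> R} -> datum R -> Prop }.

Section TopologicalFlatness.
Variables (O : comPzRingType) (X : moduli O).

(* The underlying space |X| of a scheme X is the set of field-valued points
   modulo field extension.  A subset of |X| is thus a predicate on field-valued
   points that is invariant under field extension; it is open iff its preimage
   in Spec R is open for every x : Spec R -> X, where a point of Spec R is given
   by a morphism from R to a field. *)
Definition is_subset
    (U : forall K : fieldType, {rmorphism O -> K} -> datum X K -> Prop) : Prop :=
  forall (K : fieldType) (s : {rmorphism O -> K}) (x : datum X K),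
    point s x ->
    forall (L : fieldType) (j : {rmorphism K -> L}),
      U K s x <-> U L (j \o s) (pull j x).

Definition is_open
    (U : forall K : fieldType, {rmorphism O -> K} -> datum X K -> Prop) : Prop :=
  forall (R : comPzRingType) (s : {rmorphism O -> R}) (x : datum X R),
    point s x ->
    forall (K : fieldType) (phi : {rmorphism R -> K}),
      U K (phi \o s) (pull phi x) ->
      exists f : R, phi f != 0 /\
        forall (L : fieldType) (psi : {rmorphism R -> L}),
          psi f != 0 -> U L (psi \o s) (pull psi x).

(* The points of the generic fibre are those over which O acts through its
   fraction field, i.e. those with injective structure map. *)
Definition topologically_flat : Prop :=
  forall U : forall K : fieldType, {rmorphism O -> K} -> datum X K -> Prop,
    is_subset U -> is_open U ->
    (exists (K : fieldType) (s : {rmorphism O -> K}) (x : datum X K),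
       point s x /\ U K s x) ->
    exists (K : fieldType) (s : {rmorphism O -> K}) (x : datum X K),
      [/\ point s x, U K s x & injective s].

End TopologicalFlatness.

Notation dimV n := (2 * n + 2)%N.

(* Coordinates 0, ..., 2n-1 are e_1, ..., e_2n; 2n and 2n+1 are f_1, f_2. *)
Definition gram (K : fieldType) (pi0 : K) (n : nat) : 'M[K]_(dimV n) :=
  \matrix_(a, b)
    if (a < 2 * n)%N && (b < 2 * n)%N then (a + b == 2 * n - 1)%N%:R
    else if a == b then (if (a == 2 * n :> nat)%N then pi0 else 1) else 0.

(* (d, true) stands for pi0^-d Lambda_i and (d, false) for pi0^-d Lambda_-i.
   These lattices are pairwise distinct (also for i = 0, where Lambda_-0 means
   the dual of Lambda_0), so this indexes the chain. *)
Definition chain := (int * bool)%type.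

Definition chain_dual (L : chain) : chain := (- L.1, ~~ L.2).
Definition chain_pi (L : chain) : chain := (L.1 - 1, L.2).

(* The basis vectors of a member of the chain are pi0 ^ lat_exp times those
   of V. *)
Definition lat_exp (n i : nat) (L : chain) (a : nat) : int :=
  - L.1 + (if L.2 then - (((a < i) || (a == 2 * n))%N : nat)%:Z
           else ((2 * n - i <= a < 2 * n)%N : nat)%:Z).

Definition lat_basis (K : fieldType) (pi0 : K) (n i : nat) (L : chain) :
    'M[K]_(dimV n) :=
  diag_mx (\row_a pi0 ^ lat_exp n i L a).

Section Lattices.
Variables (K : fieldType) (v : dval K) (pi0 : K) (n i : nat).

Definition lattice (L : chain) : set 'rV[K]_(dimV n) :=
  [set x | exists c : 'rV[valring v]_(dimV n),
     x = map_mx val c *m lat_basis pi0 n i L].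

(* A is the matrix, in the given bases, of multiplication by c : L -> L'; it
   exists iff c L is contained in L'. *)
Definition mult_matrix (c : K) (L L' : chain) (A : 'M[valring v]_(dimV n)) :
    Prop :=
  map_mx val A *m lat_basis pi0 n i L' = c *: lat_basis pi0 n i L.

Definition pairing_matrix (L : chain) (P : 'M[valring v]_(dimV n)) : Prop :=
  map_mx val P =
  lat_basis pi0 n i L *m gram pi0 n *m (lat_basis pi0 n i (chain_dual L))^T.

End Lattices.

(* Consistency of the above with the lattice-theoretic description: maps induced
   by L -> L', the dual lattice and its perfect pairing, and pi0 L. *)

Section LatticeTheory.
Variables (K : fieldType) (v : dval K) (pi0 : K) (n i : nat).

Lemma lattice_row L a : lattice v pi0 i L (row a (lat_basis pi0 n i L)).
Proof.
exists (delta_mx 0 a); rewrite rowE; congr (_ *m _).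
by apply/matrixP=> j k; rewrite !mxE /=; case: (_ && _); rewrite ?rmorph1 ?rmorph0.
Qed.

Lemma mult_matrixP c L L' :
  (exists A : 'M[valring v]_(dimV n), mult_matrix pi0 i c L L' A) <->
  (forall x : 'rV_(dimV n), lattice v pi0 i L x -> lattice v pi0 i L' (c *: x)).
Proof.
split=> [[A hA] x [u ->]|h].
  exists (u *m A); rewrite map_mxM -mulmxA hA scalemxAr //.
have /choice[u hu] : forall a, exists u : 'rV[valring v]_(dimV n),
    c *: row a (lat_basis pi0 n i L) = map_mx val u *m lat_basis pi0 n i L'.
  by move=> a; apply: h (lattice_row L a).
exists (\matrix_a u a); apply/row_matrixP=> a.
by rewrite row_mul -map_row rowK -hu; apply/rowP=> b; rewrite !mxE.
Qed.

(* Position of the nonzero entries of the pairing between the given bases of L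
   and of its dual: e_a against e_(2n+1-a), f_1 and f_2 against themselves. *)
Definition pair_idx (a b : nat) : bool :=
  ((a < 2 * n) && (b < 2 * n) && (a + b == 2 * n - 1) ||
   (a == b) && (2 * n <= a))%N.

Lemma perfect_pairing (pi0_neq0 : pi0 != 0) (i_le_n : (i <= n)%N) L :
  lat_basis pi0 n i L *m gram pi0 n *m (lat_basis pi0 n i (chain_dual L))^T =
  \matrix_(a, b) (pair_idx a b)%:R.
Proof.
apply/matrixP=> a b; rewrite /lat_basis tr_diag_mx mul_mx_diag mul_diag_mx !mxE.
case: L => d s; rewrite /lat_exp /pair_idx -val_eqE /=.
have := ltn_ord a; have := ltn_ord b; move: (val a) (val b) => {}a {}b hb ha.
have X m1 m2 : m1 + m2 = 0 :> int -> pi0 ^ m1 * pi0 ^ m2 = 1.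
  by move=> h; rewrite -expfzDr // h.
have X1 m1 m2 : m1 + m2 = -1 :> int -> pi0 ^ m1 * pi0 * pi0 ^ m2 = 1.
  by move=> h; rewrite mulrAC -expfzDr // h exprN1 mulVf.
case: (ltnP a (2 * n)) => a2; case: (ltnP b (2 * n)) => b2 /=.
- have [ab|ab] := eqVneq (a + b)%N (2 * n - 1)%N.
    by rewrite mulr1; apply: X; case: s => /=; lia.
  by rewrite andbF mulr0n mulr0 mul0r.
- have /negPf-> : (a != b)%N by lia.
  by rewrite mulr0 mul0r.
- have /negPf-> : (a != b)%N by lia.
  by rewrite mulr0 mul0r.
- have [<-|_] := eqVneq a b; last by rewrite mulr0 mul0r.
  have [a2n|a2n] := eqVneq a (2 * n)%N.
    by apply: X1; case: s => /=; lia.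
  by rewrite mulr1; apply: X; case: s => /=; lia.
Qed.

End LatticeTheory.

Section LatticeDual.
Variables (K : fieldType) (v : dval K) (pi0 : K) (n i : nat).
Hypotheses (pi0_neq0 : pi0 != 0) (i_le_n : (i <= n)%N).

Fact pair_subproof (a : 'I_(dimV n)) :
  ((if a < 2 * n then 2 * n - 1 - a else a) < dimV n)%N.
Proof. by have := ltn_ord a; case: (ltnP a (2 * n)) => h; lia. Qed.
Definition pair_ord a := Ordinal (pair_subproof a).
Lemma pair_pair_ord (a b : 'I_(dimV n)) : pair_idx n a b = (b == pair_ord a).
Proof.
rewrite /pair_idx -val_eqE /=.
by have := ltn_ord a; have := ltn_ord b; case: (ltnP a (2 * n)) => h; lia.
Qed.
Lemma pair_ordK : involutive pair_ord.
Proof.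
move=> a; apply: val_inj => /=; have := ltn_ord a.
case: (ltnP a (2 * n)) => h ha; last by rewrite ltnNge h.
have -> : (2 * n - 1 - a < 2 * n)%N by lia.
lia.
Qed.

Lemma lattice_dualP L (y : 'rV[K]_(dimV n)) :
  lattice v pi0 i (chain_dual L) y <->
  forall x : 'rV_(dimV n), lattice v pi0 i L x ->
    (x *m gram pi0 n *m y^T) 0 0 \in in_valring v.
Proof.
have PE (x z : 'rV[K]_(dimV n)) :
  ((x *m lat_basis pi0 n i L) *m gram pi0 n *m (z *m lat_basis pi0 n i (chain_dual L))^T) 0 0
  = \sum_a x 0 a * z 0 (pair_ord a).
  have -> : x *m lat_basis pi0 n i L *m gram pi0 n *m
      (z *m lat_basis pi0 n i (chain_dual L))^T =
    x *m (lat_basis pi0 n i L *m gram pi0 n *m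
      (lat_basis pi0 n i (chain_dual L))^T) *m z^T by rewrite trmx_mul !mulmxA.
  rewrite perfect_pairing //.
  rewrite -mulmxA !mxE; apply: eq_bigr => a _; rewrite !mxE (bigD1 (pair_ord a)) //= !mxE.
  rewrite pair_pair_ord eqxx mul1r big1 ?addr0 // => b bt.
  by rewrite !mxE pair_pair_ord (negPf bt) mul0r.
split.
  case=> z -> x [u ->]; rewrite PE rpred_sum // => a _.
  by rewrite !mxE rpredM //; [exact: (valP (u 0 a)) | exact: (valP (z 0 (pair_ord a)))].
move=> h.
pose B := lat_basis pi0 n i (chain_dual L).
have Bu : B \in unitmx.
  rewrite unitmxE det_diag unitfE prodf_seq_neq0; apply/allP => a _ /=.
  by rewrite mxE expfz_neq0.
pose z := y *m invmx B.
have yz : y = z *m B by rewrite mulmxKV.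
have hz a : z 0 a \in in_valring v.
  have := h _ (lattice_row v pi0 i L (pair_ord a)).
  rewrite rowE yz PE (bigD1 (pair_ord a)) //= mxE !eqxx mul1r pair_ordK big1 ?addr0 //.
  by move=> b bt; rewrite mxE (negPf bt) mul0r.
exists (\row_a ValRing (hz a)); rewrite [LHS]yz; congr (_ *m _).
by apply/rowP=> a; rewrite [RHS]mxE [in RHS]mxE.
Qed.

Lemma lattice_piP L (x : 'rV[K]_(dimV n)) :
  lattice v pi0 i (chain_pi L) x <->
  exists2 y : 'rV_(dimV n), lattice v pi0 i L y & x = pi0 *: y.
Proof.
have E : lat_basis pi0 n i (chain_pi L) = pi0 *: lat_basis pi0 n i L.
  rewrite -linearZ; congr diag_mx; apply/rowP=> a; rewrite !mxE.
  rewrite -{2}(expr1z pi0) -expfzDr //; congr (_ ^ _).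
  by rewrite /lat_exp /= opprB addrA.
split=> [[u ->]|[y [u ->] ->]]; last by exists u; rewrite E scalemxAr.
by exists (map_mx val u *m lat_basis pi0 n i L); [exists u | rewrite E scalemxAr].
Qed.

End LatticeDual.

(* L (x) R is identified with R^(2n+2) through the given basis of L. *)
Definition family (n : nat) (R : comPzRingType) : Type :=
  chain -> set 'rV[R]_(dimV n).

Definition family_pull (n : nat) (R R' : comPzRingType)
    (phi : {rmorphism R -> R'}) (F : family n R) : family n R' :=
  fun L => base_change phi (F L).

Section Naive.
Variables (F0 : fieldType) (v : dval F0) (pi0 : F0) (n i : nat).

Definition naive_point (R : comPzRingType) (s : {rmorphism valring v -> R})
    (F : family n R) : Prop :=
  [/\ forall L, is_submodule (F L) /\
        zariski_locally (fun R' (phi : {rmorphism R -> R'}) =>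
          free_summand n.+1 (base_change phi (F L))),
      forall L P, pairing_matrix pi0 i L P ->
        forall x y, F L x -> F (chain_dual L) y ->
          x *m map_mx s P *m y^T = 0,
      forall L L' A, mult_matrix pi0 i 1 L L' A ->
        forall x, F L x -> F L' (x *m map_mx s A) &
      forall L A, mult_matrix pi0 i pi0 L (chain_pi L) A ->
        [set x *m map_mx s A | x in F L] = F (chain_pi L)].

Definition naive_local_model : moduli (valring v) :=
  Moduli (@family_pull n) naive_point.

End Naive.

(* Subsets of cardinality r, indexing the basis e_S of the r-th exterior power
   of a free module of rank N. *)
Notation rsub N r := {S : {set 'I_N} | #|S| == r}.

Definition incr_enum N r (S : rsub N r) (j : 'I_r) : 'I_N :=
  enum_val (cast_ord (esym (eqP (valP S))) j).

Notation extdim N r := #|{: rsub N r}|.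

(* Coordinates on the basis e_S of the wedge of the rows of A. *)
Definition wedge (R : comPzRingType) N r (A : 'M[R]_(r, N)) :
    'rV[R]_(extdim N r) :=
  \row_k \det (colsub (incr_enum (enum_val k)) A).

(* Matrix of the r-th exterior power of x |-> x *m B. *)
Definition ext_mx (R : comPzRingType) N N' r (B : 'M[R]_(N, N')) :
    'M[R]_(extdim N r, extdim N' r) :=
  \matrix_k wedge (rowsub (incr_enum (enum_val k)) B).

Section SpinCombinatorics.
Variable n : nat.

Fact perp_subproof (S : rsub (dimV n) n.+1) :
  #|~: (@rev_ord (dimV n) @: \val S)%SET| == n.+1.
Proof.
rewrite cardsCs finset.setCK card_imset; last exact: rev_ord_inj.
by rewrite (eqP (valP S)) card_ord; apply/eqP; lia.
Qed.

(* s |-> 2n+3-s is rev_ord on zero-based indices. *)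
Definition perp (S : rsub (dimV n) n.+1) : rsub (dimV n) n.+1 :=
  @exist {set _} (fun T => #|T| == n.+1) _ (perp_subproof S).

Fact sigma_subproof (S : {set 'I_(dimV n)}) :
  injective (fun a : 'I_(dimV n) => nth a (enum S ++ enum (~: S)%SET) a).
Proof.
have sz : size (enum S ++ enum (~: S)%SET) = dimV n.
  by rewrite size_cat -!cardE cardsC card_ord.
move=> a b; rewrite (set_nth_default b) ?sz // => /eqP.
rewrite nth_uniq ?sz //; first by move/eqP/val_inj.
rewrite cat_uniq !enum_uniq andbT /=; apply/hasPn => x.
by rewrite !mem_enum inE.
Qed.

(* sigma_S sends 1, ..., #|S| increasingly onto S and the rest increasingly onto
   its complement. *)
Definition sigma (S : {set 'I_(dimV n)}) : 'S_(dimV n) :=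
  perm (@sigma_subproof S).

End SpinCombinatorics.

Section Spin.
Variables (F0 : fieldType) (v : dval F0) (pi0 : F0).
Variables (F : fieldExtType F0) (w : dval F) (pi : F).
Hypothesis ext : dval_extends2 v w.
Variables (n i : nat).

Definition e_vec (a : nat) : 'rV[F]_(dimV n) := \row_b (b == a :> nat)%:R.
Definition f1_vec := e_vec (2 * n).
Definition f2_vec := e_vec (2 * n).+1.

(* Row k is e'_(k+1). *)
Definition split_basis : 'M[F]_(dimV n) :=
  \matrix_(k < dimV n)
    if (k < n)%N then e_vec k
    else if (k == n :> nat)%N then f1_vec + pi *: f2_vec
    else if (k == n.+1 :> nat)%N then
      ((pi0%:A : F) *+ 2)^-1 *: (f1_vec - pi *: f2_vec)
    else e_vec (k - 2).

Definition split_wedge (S : rsub (dimV n) n.+1) :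
    'rV[F]_(extdim (dimV n) n.+1) :=
  wedge (rowsub (incr_enum S) split_basis).

Definition sgn_bool (eps : bool) : F := if eps then 1 else -1.

(* W_+ (eps = true) and W_- (eps = false): the vectors z = \sum_S c_S e'_S with
   a(z) = +z, resp. -z. *)
Definition W_spin (eps : bool) : set 'rV[F]_(extdim (dimV n) n.+1) :=
  [set z | exists c : rsub (dimV n) n.+1 -> F,
     z = \sum_S c S *: split_wedge S /\
     \sum_S c S *: ((-1) ^+ sigma (\val S) *: split_wedge (perp S)) =
       sgn_bool eps *: z].

(* Intersection of W with the exterior power of L (x) O_F, in the coordinates
   given by the basis of L. *)
Definition lattice_W (eps : bool) (L : chain) :
    set 'rV[valring w]_(extdim (dimV n) n.+1) :=
  [set c | W_spin eps (map_mx val c *m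
     ext_mx n.+1 (map_mx (in_alg F) (lat_basis pi0 n i L)))].

Definition spin_point (eps : bool) (R : comPzRingType)
    (s : {rmorphism valring w -> R}) (G : family n R) : Prop :=
  naive_point pi0 i (s \o valring_incl ext) G /\
  forall L, zariski_locally (fun R' (phi : {rmorphism R -> R'}) =>
    forall A : 'M[R']_(n.+1, dimV n),
      (forall j, base_change phi (G L) (row j A)) ->
      base_change (phi \o s) (lattice_W eps L) (wedge A)).

Definition spin_local_model (eps : bool) : moduli (valring w) :=
  Moduli (@family_pull n) (spin_point eps).

End Spin.

(* Main.v *)
(* Idea.  In the given bases Lambda_i (x) R = P + Q with P, Q split quadratic
   spaces of dimensions 2i+1 and 2(n-i)+1, and the transition maps to and from
   pi0^-1 Lambda_-i become 1_P + pi0 1_Q and pi0 1_P + 1_Q.  A point over a field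
   with pi0 = 0 is a subspace F of dimension n+1 such that the projection of F to
   P and that of F^perp to Q are isotropic, of dimensions r = i - t and
   s = n - i - t for one and the same t.  A Witt-type theorem moves both to
   coordinate subspaces by orthogonal maps of P and Q, and F becomes the span of
   (x, phi(x)), x in X, of Y, and of a coordinate subspace C of Q.  Over a ring
   containing pi with pi^2 = - pi0 this has the explicit lift spanned by
   (x, phi(x)), (pi^2 phi^T(y), y) and (pi c, c), where C is identified with the
   isometric coordinate subspace of P.  The orthogonal maps are products of swaps
   and Eichler transvections, so everything lifts to a polynomial ring over O_F
   mapping onto a ring that contains the finitely many coordinates involved.

   Composing the lift with the reflection in the middle coordinate of P changes
   the component of the generic fibre but not the special point, so both signs of
   the spin condition are attained.  The sign is read off from Jacobi's identity
   for complementary minors of an orthogonal matrix, and the condition descends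
   from the generic fibre to the polynomial ring coefficientwise. *)

(* Density is tested one point at a time: a special point over K has to come from a point over a
   domain R with maps to K and into a field L where the uniformizer survives. An open set containing
   the special point contains a principal open of Spec R, hence also the generic point. K is an
   arbitrary field, so the ring R depends on the point, and an isometry over K can be lifted only if
   it is written by formulas in finitely many coordinates and 1/2. This is why Witt's theorem is
   proved with a record of how its isometries are built. The square root of - pi0 enters through the
   part C common to P and Q: its lift (pi c, c) is orthogonal to (c, - pi c), and multiplying the
   Q-component by pi0 = - pi^2 turns the first into pi times the second. The naive model lives over
   a base without pi, but F / F0 is totally ramified, so a residue map of the small ring extends to
   the large one and a single lift serves both statements. The spin condition asks for membership in
   the image of a lattice over R, not just over L. That lattice is the kernel of a matrix over the
   valuation ring, so flatness of R over it passes from L to R. *)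
From HB Require Import structures.
Require Import Defs.
From mathcomp Require Import all_boot all_order all_fingroup all_algebra all_field.
From mathcomp Require Import boolp classical_sets zify.

Set Implicit Arguments.
Unset Strict Implicit.
Unset Printing Implicit Defensive.

Import Order.TTheory GRing.Theory Num.Theory.
Local Open Scope ring_scope.

Lemma natr_false (R : pzSemiRingType) (b : bool) : ~~ b -> b%:R = 0 :> R.
Proof. by case: b. Qed.

Lemma natr_bool (R : pzSemiRingType) (b c : bool) : b = c -> b%:R = c%:R :> R.
Proof. by move=> ->. Qed.

(** * Exterior powers and the Cauchy-Binet formula *)

Section Wedge.
Variable R : comPzRingType.

Lemma incr_enum_inj N r (S : rsub N r) : injective (incr_enum S).
Proof. by move=> a b /enum_val_inj /cast_ord_inj. Qed.

Lemma mem_incr_enum N r (S : rsub N r) j : incr_enum S j \in val S.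
Proof. exact: enum_valP. Qed.

Lemma incr_enum_onto N r (S : rsub N r) x :
  x \in val S -> exists j, incr_enum S j = x.
Proof.
move=> xS; exists (cast_ord (eqP (valP S)) (enum_rank_in xS x)).
by rewrite /incr_enum cast_ordK enum_rankK_in.
Qed.

(** Multilinearity in the rows of the product: each row is a combination of rows of [B], and [f]
    records which one is taken. *)
Lemma det_mulmx_ffun N r (A : 'M[R]_(r, N)) (B : 'M[R]_(N, r)) :
  \det (A *m B) =
  \sum_(f : {ffun 'I_r -> 'I_N}) (\prod_i A i (f i)) * \det (rowsub f B).
Proof.
rewrite /determinant.
under eq_bigr => s _.
  under eq_bigr => i _ do rewrite mxE.
  rewrite bigA_distr_bigA big_distrr /=.
  over.
rewrite exchange_big /=; apply: eq_bigr => f _.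
rewrite big_distrr /=; apply: eq_bigr => s _.
rewrite big_split /= mulrCA; congr (_ * (_ * _)).
by apply: eq_bigr => i _; rewrite mxE.
Qed.

Lemma det_rowsub_perm N r (f : 'I_r -> 'I_N) (s : 'S_r) (B : 'M[R]_(N, r)) :
  \det (rowsub (f \o s) B) = (-1) ^+ s * \det (rowsub f B).
Proof.
by rewrite rowsub_comp -row_permEsub row_permE det_mulmx det_perm.
Qed.

(** In the multilinear expansion a non-injective choice repeats a row and contributes 0. An
    injective one is, uniquely, an increasing enumeration composed with a permutation, and the signs
    of the permutations rebuild the minor of [A]. *)
Lemma cauchy_binet N r (A : 'M[R]_(r, N)) (B : 'M[R]_(N, r)) :
  \det (A *m B) =
  \sum_(S : rsub N r)
    \det (colsub (incr_enum S) A) * \det (rowsub (incr_enum S) B).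
Proof.
pose G (f : {ffun 'I_r -> 'I_N}) := (\prod_i A i (f i)) * \det (rowsub f B).
pose h (p : rsub N r * 'S_r) := [ffun i => incr_enum p.1 (p.2 i)].
have hE S s i : h (S, s) i = incr_enum S (s i) by rewrite ffunE.
have him S s : (h (S, s) @: finset.setTfor 'I_r)%SET = val S.
  apply/setP => x; apply/imsetP/idP => [[i _ ->]|].
    by rewrite hE mem_incr_enum.
  case/incr_enum_onto => j <-; exists ((s^-1)%g j) => //.
  by rewrite hE permKV.
have hinj : injective h.
  move=> [S s] [S' s'] e.
  have eS : S = S' by apply: val_inj; rewrite -(him S s) -(him S' s') e.
  subst S'; congr (_, _); apply/permP => i.
  by move/ffunP/(_ i): e; rewrite !hE => /incr_enum_inj.
transitivity (\sum_p G (h p)); last first.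
  rewrite -(pair_big xpredT xpredT (fun S s => G (h (S, s)))) /=.
  apply: eq_bigr => S _; rewrite {1}/determinant big_distrl /=.
  apply: eq_bigr => s _.
  rewrite /G (_ : rowsub _ B = rowsub (incr_enum S \o s) B); last first.
    by apply/matrixP => i j; rewrite !mxE hE.
  rewrite det_rowsub_perm mulrA; congr (_ * _).
  rewrite mulrC; congr (_ * _); apply: eq_bigr => i _.
  by rewrite hE mxE.
rewrite det_mulmx_ffun -/G.
rewrite (bigID (mem (h @: finset.setTfor _)%SET)) /= [X in _ + X]big1 ?addr0; last first.
  move=> f hf; suff /injectivePn[i [j ij fij]] : ~~ injectiveb f.
    rewrite (determinant_alternate ij) ?mulr0 // => k.
    by rewrite !mxE fij.
  apply: contra hf => /injectiveP fi.
  have hS : #|(f @: finset.setTfor 'I_r)%SET| == r.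
    by rewrite card_imset // cardsT card_ord.
  pose S : rsub N r := @exist {set _} (fun T => #|T| == r) _ hS.
  have hk i : exists k, incr_enum S k = f i.
    by apply: incr_enum_onto; rewrite /= imset_f.
  have [s hs] := fin_all_exists hk.
  have si : injective s by move=> i j e; apply: fi; rewrite -!hs e.
  apply/imsetP; exists (S, perm si) => //.
  by apply/ffunP => i; rewrite hE permE hs.
rewrite big_imset //=; last by move=> p q _ _; apply: hinj.
by apply: eq_bigl => p; rewrite inE.
Qed.

Lemma wedge_mul N N' r (A : 'M[R]_(r, N)) (B : 'M[R]_(N, N')) :
  wedge (A *m B) = wedge A *m ext_mx r B.
Proof.
apply/rowP => k; rewrite !mxE -mulmx_colsub cauchy_binet.
rewrite (reindex (enum_val : 'I_(extdim N r) -> rsub N r)) /=; last first.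
  exact/onW_bij/enum_val_bij.
apply: eq_bigr => l _; rewrite !mxE; congr (_ * _).
by congr (\det _); apply/matrixP => a b; rewrite !mxE.
Qed.

Lemma wedge_mull N r (u : 'M[R]_r) (A : 'M[R]_(r, N)) :
  wedge (u *m A) = \det u *: wedge A.
Proof. by apply/rowP => k; rewrite !mxE -mulmx_colsub det_mulmx. Qed.

Lemma ext_mx_mul N N' N'' r (A : 'M[R]_(N, N')) (B : 'M[R]_(N', N'')) :
  ext_mx r (A *m B) = ext_mx r A *m ext_mx r B.
Proof.
by apply/row_matrixP => k; rewrite row_mul !rowK -mul_rowsub_mx wedge_mul.
Qed.

Lemma ext_mx1 N r : ext_mx r (1%:M : 'M[R]_N) = 1%:M.
Proof.
apply/matrixP => k l; rewrite !mxE.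
have [<-|kl] := eqVneq k l.
  rewrite -[RHS](det1 _ r); congr (\det _); apply/matrixP => a b.
  by rewrite !mxE (inj_eq (@incr_enum_inj _ _ _)).
(* Different sets of equal size are incomparable; an index of one that the other misses produces a
   zero row in the minor. *)
have [x xk xl] : exists2 x, x \in val (enum_val k) & x \notin val (enum_val l).
  apply/subsetPn; apply: contra kl => /subset_leqif_cards.
  rewrite (eqP (valP (enum_val k))) (eqP (valP (enum_val l))) => /leqif_refl/eqP.
  by move/val_inj/enum_val_inj => ->.
have [j xE] := incr_enum_onto xk.
rewrite (expand_det_row _ j) big1 // => b _; rewrite !mxE xE.
case: eqP => [xb|_]; last by rewrite mul0r.
by case/negP: xl; rewrite xb mem_incr_enum.
Qed.

End Wedge.

Lemma map_wedge (R R' : comPzRingType) (f : {rmorphism R -> R'}) N r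
    (A : 'M[R]_(r, N)) : map_mx f (wedge A) = wedge (map_mx f A).
Proof.
apply/rowP => k; rewrite !mxE -det_map_mx; congr (\det _).
by apply/matrixP => a b; rewrite !mxE.
Qed.

Lemma map_ext_mx (R R' : comPzRingType) (f : {rmorphism R -> R'}) N N' r
    (A : 'M[R]_(N, N')) : map_mx f (ext_mx r A) = ext_mx r (map_mx f A).
Proof.
apply/row_matrixP => k; rewrite -map_row !rowK map_wedge; congr wedge.
by apply/matrixP => a b; rewrite !mxE.
Qed.

(** * Complementary minors of orthogonal matrices *)

Section Jacobi.

Lemma sorted_enum_ord N (T : {set 'I_N}) :
  sorted (fun a b : 'I_N => a < b)%N (enum T).
Proof.
have tr : transitive (fun a b : 'I_N => a < b)%N.
  by move=> b a c; apply: ltn_trans.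
rewrite /enum_mem; apply: (sorted_filter tr); rewrite -enumT.
by have := iota_ltn_sorted 0 N; rewrite -val_enum_ord sorted_map.
Qed.

Lemma enum_rev_ord N (T : {set 'I_N}) :
  enum (@rev_ord N @: T)%SET = rev (map (@rev_ord N) (enum T)).
Proof.
apply: (@irr_sorted_eq _ (fun a b : 'I_N => a < b)%N).
- by move=> b a c; apply: ltn_trans.
- by move=> a; rewrite /= ltnn.
- exact: sorted_enum_ord.
- rewrite rev_sorted sorted_map.
  apply: sub_sorted (sorted_enum_ord T) => a b /=.
  by have := ltn_ord b; lia.
- move=> x; rewrite mem_enum mem_rev; apply/imsetP/mapP => -[y yT ->];
  by exists y; rewrite // ?mem_enum // -mem_enum.
Qed.

Lemma mxsub_mulmx (R : pzSemiRingType) m n p m' n' (k : 'I_n' -> 'I_n)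
    (f : 'I_m' -> 'I_m) p' (h : 'I_p' -> 'I_p)
    (A : 'M[R]_(m, n)) (B : 'M[R]_(n, p)) :
  bijective k -> mxsub f k A *m mxsub k h B = mxsub f h (A *m B).
Proof.
move=> kb; apply/matrixP => a b; rewrite !mxE (reindex k); last exact: onW_bij.
by apply: eq_bigr => c _; rewrite !mxE.
Qed.

Lemma det_mxsub_cast (R : comPzRingType) m N (e : m = N) (A : 'M[R]_N) :
  \det (mxsub (cast_ord e) (cast_ord e) A) = \det A.
Proof.
case: _ / e in A *; congr (\det _); apply/matrixP => a b.
by rewrite mxE !cast_ord_id.
Qed.

Lemma det_mxsub_rev (R : comPzRingType) N (A : 'M[R]_N) :
  \det (mxsub (@rev_ord N) (@rev_ord N) A) = \det A.
Proof.
pose s := perm (@rev_ord_inj N).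
have -> : mxsub (@rev_ord N) (@rev_ord N) A = row_perm s (col_perm s A).
  by apply/matrixP => a b; rewrite !mxE !permE.
rewrite row_permE det_mulmx col_permE det_mulmx !det_perm.
by rewrite odd_permV mulrC -mulrA -expr2 sqrr_sign mulr1.
Qed.

Lemma det_complement (R : comPzRingType) k (G H : 'M[R]_(k + k)) :
  G *m H = 1%:M -> \det (ulsubmx G) = \det G * \det (drsubmx H).
Proof.
move=> GH.
(* The left block column of [H] is replaced by that of the identity, so the product keeps the left
   columns of [G] and has the right columns of the identity. *)
have GH' : G *m block_mx 1%:M (ursubmx H) 0 (drsubmx H) =
    block_mx (ulsubmx G) 0 (dlsubmx G) 1%:M.
  move: GH; rewrite -{1 2}[G]submxK -[H in LHS]submxK !mulmx_block.
  rewrite scalar_mx_block => /eq_block_mx[_ e1 _ e2].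
  by rewrite !mulmx1 !mulmx0 !addr0 e1 e2.
by have := congr1 determinant GH'; rewrite det_mulmx det_ublock det_lblock !det1 mulr1 mul1r.
Qed.

Lemma sigmaE n (S : {set 'I_(dimV n)}) a :
  sigma S a = nth a (enum S ++ enum (~: S)%SET) a.
Proof. by rewrite permE. Qed.

Definition antidiag (R : pzSemiRingType) N : 'M[R]_N :=
  \matrix_(a, b) (b == rev_ord a)%:R.

Lemma mul_antidiag (R : pzSemiRingType) m N (A : 'M[R]_(m, N)) :
  A *m antidiag R N = colsub (@rev_ord N) A.
Proof.
apply/matrixP => a b; rewrite !mxE (bigD1 (rev_ord b)) //= mxE rev_ordK eqxx.
rewrite mulr1 big1 ?addr0 // => c cb; rewrite mxE.
case: eqP => [e|_]; last by rewrite mulr0.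
by case/eqP: cb; rewrite e rev_ordK.
Qed.

Lemma antidiag_mul (R : pzSemiRingType) m N (A : 'M[R]_(N, m)) :
  antidiag R N *m A = rowsub (@rev_ord N) A.
Proof.
apply/matrixP => a b; rewrite !mxE (bigD1 (rev_ord a)) //= mxE eqxx.
by rewrite mul1r big1 ?addr0 // => c /negPf cb; rewrite mxE cb mul0r.
Qed.

(** Matrix, on row vectors of coordinates along the e'_S, of the operator whose eigenspaces are W_+
    and W_-. *)
Definition spin_mx (R : pzRingType) n : 'M[R]_(extdim (dimV n) n.+1) :=
  \matrix_(k, l) ((-1) ^+ sigma (val (enum_val k)) *
                   (perp (enum_val k) == enum_val l)%:R).

Fact dimV_split n : (n.+1 + n.+1 = dimV n)%N. Proof. lia. Qed.

Definition first_rows (T : Type) n (g : 'M[T]_(dimV n)) : 'M[T]_(n.+1, dimV n) :=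
  rowsub (fun i => cast_ord (dimV_split n) (lshift n.+1 i)) g.

(** A minor of [g] is, up to sign and [\det g], the complementary minor of the inverse. For an
    orthogonal matrix the inverse is the transpose conjugated by the antidiagonal, and this reversal
    of indices turns the complement of S into [perp S]. *)
Lemma jacobi_minor (R : comPzRingType) n (g : 'M[R]_(dimV n)) S :
  g *m antidiag R _ *m g^T = antidiag R _ ->
  \det (colsub (incr_enum S) (first_rows g)) =
  \det g * (-1) ^+ sigma (val S) *
  \det (colsub (incr_enum (perp S)) (first_rows g)).
Proof.
move=> gJ; pose th := cast_ord (dimV_split n).
pose gi : 'M[R]_(dimV n) := \matrix_(a, b) g (rev_ord b) (rev_ord a).
have ggi : g *m gi = 1%:M.
  have -> : gi = antidiag R _ *m g^T *m antidiag R _.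
    by rewrite mul_antidiag antidiag_mul; apply/matrixP => a b; rewrite !mxE.
  rewrite !mulmxA gJ mul_antidiag; apply/matrixP => a b; rewrite !mxE.
  by rewrite (inj_eq (@rev_ord_inj _)) eq_sym.
(* The columns are reordered by [sigma], so that the minor on S becomes the upper left block; the
   cost is the sign of [sigma]. *)
pose G := mxsub th (sigma (val S) \o th) g.
pose H := mxsub (sigma (val S) \o th) th gi.
have bij : bijective (sigma (val S) \o th).
  by apply: bij_comp; [exact: injF_bij (@perm_inj _ _) | exists (cast_ord (esym (dimV_split n)));
     [exact: cast_ordK | exact: cast_ordKV]].
have GH : G *m H = 1%:M.
  rewrite mxsub_mulmx // ggi; apply/matrixP => a b; rewrite !mxE.
  by rewrite (inj_eq (@cast_ord_inj _ _ _)).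
have cS : size (enum (val S)) = n.+1 by rewrite -cardE (eqP (valP S)).
have cSC : size (enum (~: val S)%SET) = n.+1.
  by rewrite -cardE cardsCs finset.setCK (eqP (valP S)) card_ord; lia.
have sl j : sigma (val S) (th (lshift n.+1 j)) = incr_enum S j.
  rewrite sigmaE nth_cat /= cS ltn_ord /incr_enum /enum_val /=.
  by apply: set_nth_default; rewrite cS ltn_ord.
have sr (x0 : 'I_(dimV n)) j : sigma (val S) (th (rshift n.+1 j)) = nth x0 (enum (~: val S)%SET) j.
  rewrite sigmaE nth_cat /= cS ltnNge leq_addr /= addKn.
  by apply: set_nth_default; rewrite cSC ltn_ord.
have perpE (x0 : 'I_(dimV n)) j : incr_enum (perp S) j =
    rev_ord (nth x0 (enum (~: val S)%SET) (rev_ord j)).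
  rewrite /incr_enum /enum_val (set_nth_default x0); last first.
    by rewrite -cardE /= (eqP (valP (perp S))) ltn_ord.
  have -> : enum (val (perp S)) = rev (map (@rev_ord _) (enum (~: val S)%SET)).
    rewrite -enum_rev_ord; suff -> : val (perp S) = (@rev_ord _ @: ~: val S)%SET by [].
    apply/setP => x; rewrite inE.
    apply/idP/imsetP => [xS|[y yS ->]].
      exists (rev_ord x); rewrite ?rev_ordK // inE; apply: contra xS => xS.
      by apply/imsetP; exists (rev_ord x); rewrite ?rev_ordK.
    apply: contraL yS; rewrite inE negbK => /imsetP[z zS /rev_ord_inj ->] //.
  rewrite nth_rev size_map cSC //= (nth_map x0) ?cSC //.
  by have := ltn_ord j; lia.
have := det_complement GH.
have -> : ulsubmx G = colsub (incr_enum S) (first_rows g).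
  by apply/matrixP => a b; rewrite !mxE -sl.
have -> : \det G = \det g * (-1) ^+ sigma (val S).
  have -> : G = mxsub th th (col_perm (sigma (val S)) g).
    by apply/matrixP => a b; rewrite !mxE.
  by rewrite det_mxsub_cast col_permE det_mulmx det_perm odd_permV.
move=> ->; congr (_ * _).
(* Reversing rows and columns matches the last rows with the first ones, and the decreasing
   enumeration of [perp S] with the increasing one. *)
rewrite -[RHS]det_tr -[RHS]det_mxsub_rev; congr (\det _).
apply/matrixP => a b; rewrite !mxE; congr (g _ _).
  by apply: val_inj => /=; have := ltn_ord b; lia.
rewrite /= (sr (th (lshift n.+1 ord0))) (perpE (th (lshift n.+1 ord0))).
by rewrite rev_ordK.
Qed.

(** The first n+1 rows of an orthogonal matrix span a maximal isotropic space, and the determinant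
    tells which of the two families it belongs to. *)
Lemma wedge_spin_mx (R : comPzRingType) n (g : 'M[R]_(dimV n)) :
  g *m antidiag R _ *m g^T = antidiag R _ ->
  wedge (first_rows g) *m spin_mx R n = \det g *: wedge (first_rows g).
Proof.
move=> gJ; apply/rowP => l; rewrite !mxE.
have perpK : involutive (@perp n).
  move=> S; apply: val_inj => /=; apply/setP => x.
  rewrite inE -{1}[x]rev_ordK !(mem_imset _ _ (@rev_ord_inj _)) inE.
  by rewrite (mem_imset _ _ (@rev_ord_inj _)) negbK.
rewrite (bigD1 (enum_rank (perp (enum_val l)))) //= !mxE enum_rankK perpK eqxx mulr1.
rewrite big1 ?addr0 => [|k kl]; last first.
  rewrite !mxE; case: eqP => [e|_]; last by rewrite !mulr0.
  by case/eqP: kl; rewrite -e perpK enum_valK.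
rewrite (jacobi_minor _ gJ) perpK mulrAC; congr (_ * _).
by rewrite -mulrA -expr2 sqrr_sign mulr1.
Qed.

End Jacobi.

(** * Orthogonal matrices of the antidiagonal form *)

Section Orthogonal.
Variable R : comPzRingType.

Definition orth N (U : 'M[R]_N) := U *m antidiag R N *m U^T = antidiag R N.

Lemma antidiagK N : antidiag R N *m antidiag R N = 1%:M.
Proof.
rewrite mul_antidiag; apply/matrixP => a b; rewrite !mxE.
by rewrite (inj_eq (@rev_ord_inj _)) eq_sym.
Qed.

Lemma tr_antidiag N : (antidiag R N)^T = antidiag R N.
Proof.
apply/matrixP => a b; rewrite !mxE -(inj_eq (@rev_ord_inj _)) rev_ordK.
by rewrite eq_sym.
Qed.

Lemma orth1 N : orth (1%:M : 'M_N).
Proof. by rewrite /orth mul1mx trmx1 mulmx1. Qed.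

Lemma orthM N (U V : 'M_N) : orth U -> orth V -> orth (U *m V).
Proof.
rewrite /orth trmx_mul => hU hV.
by rewrite -{2}hU -{2}hV !mulmxA.
Qed.

(** Written without division, so that it makes sense over any commutative ring and commutes with
    ring morphisms. *)
Definition orth_inv N (U : 'M[R]_N) := antidiag R N *m U^T *m antidiag R N.

Lemma orth_mulVR N (U : 'M_N) : orth U -> U *m orth_inv U = 1%:M.
Proof. by move=> hU; rewrite /orth_inv !mulmxA hU antidiagK. Qed.

Lemma orth_mulVL N (U : 'M_N) : orth U -> orth_inv U *m U = 1%:M.
Proof. by move/orth_mulVR/mulmx1C. Qed.

Lemma orthV N (U : 'M_N) : orth U -> orth (orth_inv U).
Proof.
move=> hU; rewrite /orth {2}/orth_inv !trmx_mul trmxK !tr_antidiag !mulmxA.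
rewrite -(mulmxA _ (antidiag R N) (antidiag R N)) antidiagK mulmx1.
by rewrite (orth_mulVL hU) mul1mx.
Qed.

Lemma antidiag_block N : antidiag R (1 + (N + 1)) =
  block_mx 0 (row_mx 0 1%:M) (col_mx 0 1%:M) (block_mx (antidiag R N) 0 0 0).
Proof.
apply/matrixP => a b; rewrite !mxE -val_eqE /=.
case: splitP => a' ea; rewrite !mxE; case: splitP => b' eb; rewrite !mxE.
- by apply: natr_false; rewrite ea eb; have := ltn_ord a'; have := ltn_ord b'; lia.
- case: splitP => c ec; rewrite !mxE -?val_eqE /= ea eb ec;
    have := ltn_ord a'; have := ltn_ord b'; have := ltn_ord c => hc hb ha;
  by [apply: natr_false; lia | apply: natr_bool; lia].
- case: splitP => c ec; rewrite !mxE -?val_eqE /= ea eb ec;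
    have := ltn_ord a'; have := ltn_ord b'; have := ltn_ord c => hc hb ha;
  by [apply: natr_false; lia | apply: natr_bool; lia].
- case: splitP => c ec; rewrite !mxE; case: splitP => d ed;
    rewrite !mxE -?val_eqE /= ea eb ec ed;
    have := ltn_ord a'; have := ltn_ord b'; have := ltn_ord c;
    have := ltn_ord d => hd hc hb ha;
  by [apply: natr_false; lia | apply: natr_bool; lia].
Qed.

Definition swap_mx N : 'M[R]_(1 + (N + 1)) :=
  block_mx 0 (row_mx 0 1%:M) (col_mx 0 1%:M) (block_mx 1%:M 0 0 0).

Lemma orth_swap N : orth (swap_mx N).
Proof.
rewrite /orth antidiag_block /swap_mx tr_block_mx tr_row_mx tr_col_mx.
rewrite tr_block_mx !trmx0 !trmx1 !mulmx_block !mul_row_block.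
rewrite !(mul_row_block, mul_row_col, mul_col_row, mul_block_col, mulmx_block,
  mul_mx_row, mul_col_mx, mulmx0, mul0mx, mulmx1, mul1mx, addr0, add0r, col_mx0,
  row_mx0, block_mx0, add_block_mx).
by congr block_mx; rewrite block_mxEv row_mx0.
Qed.

Definition orth_ext N (U : 'M[R]_N) : 'M[R]_(1 + (N + 1)) :=
  block_mx 1%:M 0 0 (block_mx U 0 0 1%:M).

Lemma orth_extP N (U : 'M_N) : orth U -> orth (orth_ext U).
Proof.
move=> hU; rewrite /orth antidiag_block /orth_ext !tr_block_mx !trmx0 !trmx1.
rewrite !(mul_row_block, mul_row_col, mul_block_col, mulmx_block, mul_mx_row,
  mul_col_mx, mulmx0, mul0mx, mulmx1, mul1mx, addr0, add0r, col_mx0, row_mx0,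
  block_mx0) hU.
by congr (col_mx _ (row_mx _ _)); rewrite block_mxEv row_mx0.
Qed.

(* Meant for [half + half = 1]. *)
Definition eichler (half : R) N (y : 'rV[R]_N) : 'M[R]_(1 + (N + 1)) :=
  block_mx 1%:M (row_mx y (- half *: (y *m antidiag R N *m y^T)))
           0 (block_mx 1%:M (- (antidiag R N *m y^T)) 0 1%:M).

Lemma orth_eichler half N (y : 'rV_N) :
  half + half = 1 -> orth (eichler half y).
Proof.
move=> hh; rewrite /orth antidiag_block /eichler.
set q := y *m _ *m _.
have qT : q^T = q by apply/matrixP => a b; rewrite !ord1 mxE.
rewrite !(tr_block_mx, tr_row_mx, trmx0, trmx1, linearN, linearZ) /= qT.
rewrite trmx_mul trmxK tr_antidiag.
rewrite !(mul_row_block, mul_row_col, mul_block_col, mulmx_block, mul_mx_row,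
  mul_col_mx, mulmx0, mul0mx, mulmx1, mul1mx, addr0, add0r, col_mx0, row_mx0,
  block_mx0).
rewrite !(add_row_mx, add_col_mx, mul_row_block, mul_row_col, mul_block_col,
  mulmx_block, mul_mx_row, mul_col_mx, mulmx0, mul0mx, mulmx1, mul1mx, addr0,
  add0r, addNr, mulmxN, subrr) -?/q.
have -> : - half *: q + (q + - half *: q) = 0.
  by rewrite scaleNr addrCA -opprD -scalerDl hh scale1r subrr.
by congr (col_mx _ (row_mx _ _)); rewrite block_mxEv row_mx0.
Qed.

End Orthogonal.

(** * Witt's theorem with liftable isometries *)

Section MapOrth.
Variables (R R' : comPzRingType) (f : {rmorphism R -> R'}).

Lemma map_antidiag N : map_mx f (antidiag R N) = antidiag R' N.
Proof. by apply/matrixP => a b; rewrite !mxE rmorph_nat. Qed.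

Lemma map_orth_inv N (U : 'M_N) : map_mx f (orth_inv U) = orth_inv (map_mx f U).
Proof. by rewrite /orth_inv !map_mxM /= map_antidiag -map_trmx. Qed.

Lemma map_swap_mx N : map_mx f (swap_mx R N) = swap_mx R' N.
Proof.
by rewrite /swap_mx !(map_block_mx, map_row_mx, map_col_mx, map_mx0, map_mx1).
Qed.

Lemma map_orth_ext N (U : 'M_N) : map_mx f (orth_ext U) = orth_ext (map_mx f U).
Proof. by rewrite /orth_ext !(map_block_mx, map_mx0, map_mx1). Qed.

Lemma map_eichler h N (y : 'rV_N) :
  map_mx f (eichler h y) = eichler (f h) (map_mx f y).
Proof.
rewrite /eichler !(map_block_mx, map_row_mx, map_mx0, map_mx1).
by rewrite !(map_mxN, map_mxZ, map_mxM, map_antidiag, rmorphN) -!map_trmx.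
Qed.

End MapOrth.

Section Liftable.
Variable K : fieldType.

Definition hits (R : comPzRingType) (f : {rmorphism R -> K}) (cs : seq K) :=
  forall c, c \in cs -> exists x, f x = c.

(* [cs] is finite, so that [R] can be a polynomial ring although its image need
   not be all of [K]. *)
Definition liftable N (U : 'M[K]_N) := exists cs : seq K,
  forall (R : comPzRingType) (f : {rmorphism R -> K}) (h : R),
    h + h = 1 -> hits f cs -> exists2 V : 'M[R]_N, orth V & map_mx f V = U.

Lemma hits_cat (R : comPzRingType) (f : {rmorphism R -> K}) cs ds :
  hits f (cs ++ ds) -> hits f cs /\ hits f ds.
Proof. by move=> h; split=> c cin; apply: h; rewrite mem_cat cin ?orbT. Qed.

Definition mx_entries m n (A : 'M[K]_(m, n)) : seq K :=
  [seq A p.1 p.2 | p : 'I_m * 'I_n].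

Lemma hits_mx (R : comPzRingType) (f : {rmorphism R -> K}) m n (A : 'M[K]_(m, n)) :
  hits f (mx_entries A) -> exists B, map_mx f B = A.
Proof.
move=> h; have e (p : 'I_m * 'I_n) : exists x, f x = A p.1 p.2.
  by apply: h; apply/mapP; exists p; rewrite ?mem_enum.
have [g hg] := fin_all_exists e.
by exists (\matrix_(i, j) g (i, j)); apply/matrixP => i j; rewrite !mxE hg.
Qed.

Lemma liftable_orth (h : K) N (U : 'M[K]_N) : h + h = 1 -> liftable U -> orth U.
Proof.
move=> hh [cs H]; have [|V oV <-] := H K (@idfun K) h hh; last first.
  by rewrite map_mx_id.
by move=> c _; exists c.
Qed.

Lemma liftable1 N : liftable (1%:M : 'M_N).
Proof. by exists [::] => R f h _ _; exists 1%:M; [exact: orth1 | exact: map_mx1]. Qed.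

Lemma liftableM N (U V : 'M_N) : liftable U -> liftable V -> liftable (U *m V).
Proof.
move=> [cs hU] [ds hV]; exists (cs ++ ds) => R f h hh /hits_cat[hc hd].
have [U' oU <-] := hU R f h hh hc; have [V' oV <-] := hV R f h hh hd.
by exists (U' *m V'); [exact: orthM | exact: map_mxM].
Qed.

Lemma liftableV N (U : 'M_N) : liftable U -> liftable (orth_inv U).
Proof.
move=> [cs hU]; exists cs => R f h hh hc; have [V oV <-] := hU R f h hh hc.
by exists (orth_inv V); [exact: orthV | exact: map_orth_inv].
Qed.

Lemma liftable_swap N : liftable (swap_mx K N).
Proof.
exists [::] => R f h _ _.
by exists (swap_mx R N); [exact: orth_swap | exact: map_swap_mx].
Qed.

Lemma liftable_ext N (U : 'M_N) : liftable U -> liftable (orth_ext U).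
Proof.
move=> [cs hU]; exists cs => R f h hh hc; have [V oV <-] := hU R f h hh hc.
by exists (orth_ext V); [exact: orth_extP | exact: map_orth_ext].
Qed.

Variable half : K.
Hypothesis halfP : half + half = 1.

Lemma liftable_eichler N (y : 'rV_N) : liftable (eichler half y).
Proof.
exists (mx_entries y) => R f h hh /hits_mx[z <-].
exists (eichler h z); first exact: orth_eichler.
rewrite map_eichler; suff -> : f h = half by [].
by rewrite -[f h]mulr1 -halfP mulrDr -mulrDl -rmorphD hh rmorph1 mul1r.
Qed.

(** If the first and last coordinates both vanish, a transvection copies a nonzero middle
    coordinate, up to sign, to the last place, and the swap brings it to the front. *)
Lemma liftable_lead N (x : 'rV[K]_(1 + (N + 1))) : x != 0 ->
  exists2 U, liftable U & (x *m U) 0 0 != 0.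
Proof.
move=> x0; have swapE (z : 'rV[K]_(1 + (N + 1))) :
    (z *m swap_mx K N) 0 0 = z 0 (rshift 1 (rshift N 0)).
  rewrite -[z]hsubmxK -[rsubmx z]hsubmxK /swap_mx.
  rewrite mul_row_block mul_row_col mul_row_block !mulmx0 !add0r mulmx1.
  have -> : 0 = lshift (N + 1) (0 : 'I_1) by apply: val_inj.
  by rewrite !row_mxEl !row_mxEr.
case: (eqVneq (x 0 0) 0) => [e0|h0]; last first.
  by exists 1%:M; [exact: liftable1 | rewrite mulmx1].
case: (eqVneq (x 0 (rshift 1 (rshift N 0))) 0) => [e1|h1]; last first.
  by exists (swap_mx K N); [exact: liftable_swap | rewrite swapE].
have xE : x = row_mx 0 (row_mx (lsubmx (rsubmx x)) 0).
  rewrite -{1}[x]hsubmxK -{1}[rsubmx x]hsubmxK; congr (row_mx _ (row_mx _ _)).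
    by apply/rowP => j; rewrite !mxE (_ : lshift _ j = 0) ?e0 // ord1; apply: val_inj.
  by apply/rowP => j; rewrite !mxE ord1 e1.
have /rV0Pn[j yj] : lsubmx (rsubmx x) != 0.
  by apply: contra x0 => /eqP y0; rewrite xE y0 !row_mx0.
set y := lsubmx _ in xE yj.
exists (eichler half (delta_mx 0 (rev_ord j)) *m swap_mx K N).
  exact: liftableM (liftable_eichler _) (liftable_swap _).
rewrite mulmxA swapE xE /eichler mul_row_block mul_row_block !mul0mx !add0r.
rewrite !row_mxEr addr0 mulmxN mxE oppr_eq0 mulmxA mul_antidiag.
rewrite mxE (bigD1 (rev_ord j)) //= !mxE !eqxx mulr1 rev_ordK.
rewrite big1 ?addr0 => [|k /negPf kj]; last by rewrite !mxE kj mulr0.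
by move: yj; rewrite !mxE.
Qed.

(** This is 2m+1, given by recursion so that the outer hyperbolic plane, spanned by the first and
    last coordinates, splits off by conversion. *)
Fixpoint odim m : nat := if m is m'.+1 then 1 + (odim m' + 1) else 1.

Lemma odimE m : odim m = (2 * m).+1.
Proof. by elim: m => //= m ->; lia. Qed.

Lemma pid_mx_ext r N : (r <= N)%N -> pid_mx r.+1 =
  block_mx 1%:M 0 0 (row_mx (pid_mx r) 0) :> 'M[K]_(1 + r, 1 + (N + 1)).
Proof.
move=> rN.
apply/matrixP => a b; rewrite !mxE.
case: splitP => a' ea; rewrite !mxE; case: splitP => b' eb; rewrite !mxE.
- by apply: natr_bool; rewrite -!val_eqE /= ea eb; have := ltn_ord a'; have := ltn_ord b'; lia.
- by apply: natr_false; rewrite ea eb; have := ltn_ord a'; lia.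
- by apply: natr_false; rewrite ea eb; have := ltn_ord b'; lia.
- case: splitP => c ec; rewrite !mxE ea eb ec;
    have := ltn_ord a'; have := ltn_ord b'; have := ltn_ord c => hc hb ha;
  by [apply: natr_false; lia | apply: natr_bool; lia].
Qed.

Lemma row_free_row r N (X : 'M[K]_(r, N)) i : row_free X -> row i X != 0.
Proof.
case/row_freeP => B XB; apply/eqP => Xi; move/(congr1 (row i)): XB.
rewrite row_mul Xi mul0mx => /rowP/(_ i)/eqP.
by rewrite !mxE eqxx eq_sym oner_eq0.
Qed.

(** Induction on the Witt index. After an isometry and row operations the first row is (1, y, be)
    and the other rows begin with 0. Isotropy then determines the whole last column from the rest,
    exactly as multiplication by the Eichler transvection of y would produce it. Undoing that
    transvection leaves an isotropic matrix in the middle coordinates. *)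
Lemma witt_liftable m r (X : 'M[K]_(r, odim m)) :
  row_free X -> X *m antidiag K _ *m X^T = 0 ->
  (r <= m)%N /\ exists (T : 'M[K]_r) (U : 'M[K]_(odim m)),
    [/\ T \in unitmx, liftable U & X = T *m pid_mx r *m U].
Proof.
elim: m r X => [|m IH] [|r] X fX iX.
- split=> //; exists 1%:M, 1%:M; split; [exact: unitmx1 | exact: liftable1 |].
  by rewrite [LHS]flatmx0 [RHS]flatmx0.
(* In dimension 1 the form is a square, so an isotropic row vanishes. *)
- have X0 : row 0 X = 0.
    apply/rowP => j; rewrite !mxE ord1; apply/eqP; rewrite -sqrf_eq0 expr2.
    move/matrixP/(_ 0 0): iX; rewrite mul_antidiag !mxE big_ord1 !mxE.
    by rewrite (_ : rev_ord 0 = 0) => [->|]; last exact: val_inj.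
  by have := row_free_row 0 fX; rewrite X0 eqxx.
- split=> //; exists 1%:M, 1%:M; split; [exact: unitmx1 | exact: liftable1 |].
  by rewrite [LHS]flatmx0 [RHS]flatmx0.
pose N := odim m.
have x0 := row_free_row 0 fX.
have [U0 lU0 lead] := @liftable_lead N _ x0.
have oU0 := liftable_orth halfP lU0.
have [X1 [a0 iX1 XX1]] : exists X1 : 'M[K]_(1 + r, 1 + (N + 1)),
    [/\ X1 0 0 != 0, X1 *m antidiag K _ *m X1^T = 0 & X = X1 *m orth_inv U0].
  exists (X *m U0); split; first by move: lead; rewrite -row_mul mxE.
    rewrite trmx_mul !mulmxA -(mulmxA X) -(mulmxA X).
    by have := oU0; rewrite /orth => ->.
  by rewrite -mulmxA orth_mulVR // mulmx1.
pose a := X1 0 0.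
pose b := dlsubmx X1.
(* Gaussian elimination of the first column with pivot [a]. *)
pose T0 : 'M[K]_(1 + r) := block_mx (a^-1)%:M 0 (- a^-1 *: b) 1%:M.
have uT0 : T0 \in unitmx.
  by rewrite unitmxE det_lblock det1 mulr1 det_scalar1 unitfE invr_eq0.
pose X2 := T0 *m X1.
have ulX1 : ulsubmx X1 = a%:M.
  apply/matrixP => i j; rewrite !ord1 !mxE /a eqxx mulr1n.
  by congr (fun_of_matrix X1 _ _); apply: val_inj.
have X2E : X2 = block_mx 1%:M (ursubmx X2) 0 (drsubmx X2).
  rewrite -[LHS]submxK; congr block_mx.
    rewrite /X2 -[X1]submxK ulX1 mulmx_block block_mxKul mul0mx addr0.
    by rewrite -scalar_mxM mulVf.
  rewrite /X2 -[X1]submxK ulX1 mulmx_block block_mxKdl mul1mx.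
  by rewrite mul_mx_scalar scalerA mulrN mulfV // scaleN1r addNr.
pose y := lsubmx (ursubmx X2); pose be := rsubmx (ursubmx X2).
pose X' := lsubmx (drsubmx X2); pose b' := rsubmx (drsubmx X2).
have iX2 : X2 *m antidiag K _ *m X2^T = 0.
  by rewrite /X2 trmx_mul !mulmxA -(mulmxA T0) -(mulmxA T0) iX1 mulmx0 mul0mx.
have X1X2 : X1 = invmx T0 *m X2 by rewrite mulKmx.
clearbody X2.
have X2E' : X2 = block_mx 1%:M (row_mx y be) 0 (row_mx X' b').
  by rewrite /y /be /X' /b' !hsubmxK.
(* The isotropy of [X2], block by block: [e1] gives [be] after halving, [e2] gives [b'], and [e3] is
   the induction hypothesis for [X']. *)
have [e1 e2 e3] : [/\ be + y *m antidiag K N *m y^T + be^T = 0,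
    b' + X' *m antidiag K N *m y^T = 0 & X' *m antidiag K N *m X'^T = 0].
  move: iX2; rewrite {1 2}X2E' antidiag_block tr_block_mx !tr_row_mx.
  rewrite !(trmx0, trmx1, mul_row_block, mul_row_col, mul_block_col,
    mulmx_block, mul_mx_row, mul_col_mx, mulmx0, mul0mx, mulmx1, mul1mx,
    addr0, add0r).
  rewrite !(add_row_mx, add0r, addr0, mul_row_block, mul_row_col, mulmx1, mulmx0).
  rewrite ?mul1mx => /eqP; rewrite col_mx_eq0 !row_mx_eq0.
  case/andP => /andP[/eqP e1 _] /andP[/eqP e2 /eqP e3].
  by split; rewrite // -addrA.
have beE : be = - half *: (y *m antidiag K N *m y^T).
  have beT : be^T = be by apply/matrixP => i j; rewrite !ord1 mxE.
  move: e1; rewrite beT addrC addrA -mulr2n => /eqP; rewrite addr_eq0 => /eqP e1.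
  rewrite scaleNr -[LHS]scale1r -halfP scalerDl -!scalerDr -mulr2n.
  by rewrite e1 scalerN.
have b'E : b' = X' *m - (antidiag K N *m y^T).
  by apply/eqP; rewrite mulmxN -addr_eq0 mulmxA e2.
pose Y : 'M[K]_(1 + r, 1 + (N + 1)) := block_mx 1%:M 0 0 (row_mx X' 0).
have X2Y : X2 = Y *m eichler half y.
  rewrite X2E' /Y /eichler mulmx_block !mul1mx !mulmx0 !mul0mx !addr0 !add0r.
  by rewrite mul_row_block mul0mx !addr0 mulmx1 mul0mx addr0 -beE -b'E.
(* Needed for the independence of the rows of [X']: the rank of [X2] is at most 1 plus that of
   [X']. *)
have rX2 : \rank X2 = r.+1.
  have oV : orth_inv U0 \in unitmx.
    by case: (mulmx1_unit (orth_mulVL oU0)).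
  have : \rank X = \rank X2.
    rewrite XX1 X1X2 mxrankMfree ?row_free_unit //.
    by rewrite (eqmxMfull X2) // row_full_unit unitmx_inv.
  by move: fX; rewrite /row_free => /eqP -> /esym.
have fX' : row_free X'.
  rewrite /row_free eqn_leq rank_leq_row -(leq_add2l 1).
  rewrite -[X in (X <= _)%N]rX2 X2Y.
  apply: leq_trans (mxrankM_maxl _ _) _.
  rewrite /Y rank_diag_block_mx mxrank1 leq_add2l.
  have -> : row_mx X' 0 = X' *m row_mx 1%:M (0 : 'M_(_, 1)).
    by rewrite mul_mx_row mulmx1 mulmx0.
  exact: mxrankM_maxl.
have [rm [T' [U' [uT' lU' X'E]]]] := IH _ _ fX' e3.
have YE : Y = (block_mx 1%:M 0 0 T' : 'M_(1 + r)) *m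
    ((block_mx 1%:M 0 0 (row_mx (pid_mx r) 0) : 'M_(1 + r, 1 + (N + 1))) *m
      orth_ext U').
  rewrite /Y /orth_ext X'E !mulmx_block !(mulmx0, mul0mx, mul1mx, addr0, add0r).
  rewrite mul_row_block !(mulmx0, mul0mx, mulmx1, addr0) mul_mx_row mulmx0.
  by rewrite mulmxA.
split=> //; have rN : (r <= odim m)%N by rewrite odimE; lia.
exists (invmx T0 *m (block_mx 1%:M 0 0 T' : 'M_(1 + r))).
exists (orth_ext U' *m eichler half y *m orth_inv U0); split.
- have uB : (block_mx 1%:M 0 0 T' : 'M_(1 + r)) \in unitmx.
    by rewrite unitmxE det_ublock det1 mul1r -unitmxE.
  by rewrite unitmx_mul unitmx_inv uT0; exact: uB.
- apply: liftableM (liftableV lU0).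
  exact: liftableM (liftable_ext lU') (liftable_eichler _).
- rewrite XX1 X1X2 X2Y (mulmxA _ (_ *m _) (orth_inv _)); congr (_ *m _).
  rewrite mulmxA mulmxA; congr (_ *m _); rewrite -!mulmxA; congr (_ *m _).
  rewrite pid_mx_ext; last exact: rN.
  exact: YE.
Qed.

End Liftable.

(** * Explicit isotropic frames *)

Section Frames.
Variable R : comPzRingType.

Definition mid_mx d k N : 'M[R]_(d, N) := \matrix_(a, b) (b == k + a :> nat)%N%:R.

Lemma mul_mid m d k N (kdN : (k + d <= N)%N) (A : 'M[R]_(m, N)) a (b : 'I_d)
    (lt : (k + b < N)%N) :
  (A *m (mid_mx d k N)^T) a b = A a (Ordinal lt).
Proof.
rewrite mxE (bigD1 (Ordinal lt)) //= !mxE eqxx mulr1 big1 ?addr0 // => c.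
by rewrite -val_eqE /= => /negPf cb; rewrite !mxE cb mulr0.
Qed.

Lemma pid_mid k N : pid_mx k = mid_mx k 0 N.
Proof.
apply/matrixP => a b; rewrite !mxE add0n; apply: natr_bool.
by have := ltn_ord a; lia.
Qed.

Lemma mid_tr d k d' k' N (_ : (k + d <= N)%N) (_ : (k' + d' <= N)%N) :
  mid_mx d k N *m (mid_mx d' k' N)^T = \matrix_(a, b) (k + a == k' + b)%N%:R.
Proof.
apply/matrixP => a b; have lt : (k' + b < N)%N by have := ltn_ord b; lia.
by rewrite mul_mid // !mxE; apply: natr_bool; rewrite /= eq_sym.
Qed.

Lemma mid_antidiag d k d' k' N (_ : (k + d <= N)%N) (_ : (k' + d' <= N)%N) :
  mid_mx d k N *m antidiag R N *m (mid_mx d' k' N)^T =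
  \matrix_(a, b) ((k + a) + (k' + b) == N.-1)%N%:R.
Proof.
apply/matrixP => a b; have lt : (k' + b < N)%N by have := ltn_ord b; lia.
rewrite mul_mid // mul_antidiag !mxE; apply: natr_bool => /=.
by have := ltn_ord a; have := ltn_ord b; lia.
Qed.

Variables (r s t p q : nat).
Local Notation d := (odim t).
Local Notation st k N := (pid_mx k : 'M[R]_(k, N)).
Local Notation zt k N := (st k N *m antidiag R N).
Local Notation md k N := (mid_mx d k N).

(** Hyperbolic splitting of the antidiagonal form: the first k coordinates are isotropic, the last k
    (the rows of [zt]) are their duals, and the middle is again an antidiagonal space, whose size
    depends only on [t]. This last fact identifies the middles of P and Q. *)
Lemma frame_relations k N : N = (k + d + k)%N ->
  [/\ st k N *m (st k N)^T = 1%:M, st k N *m antidiag R N *m (st k N)^T = 0,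
      md k N *m (st k N)^T = 0, md k N *m antidiag R N *m (st k N)^T = 0 &
      md k N *m antidiag R N *m (md k N)^T = antidiag R d].
Proof.
move=> ->; rewrite pid_mid !mid_antidiag ?mid_tr ?odimE; try lia.
split; apply/matrixP => a b; rewrite !mxE; have := ltn_ord a; have := ltn_ord b;
  rewrite ?odimE => hb ha; try (apply: natr_false; lia).
- by apply: natr_bool; rewrite -val_eqE.
- by apply: natr_bool; rewrite -val_eqE /= ?odimE; lia.
Qed.

Definition gram_block : 'M[R]_(p + q) := block_mx (antidiag R p) 0 0 (antidiag R q).

Definition scale_block (x y : R) : 'M[R]_(p + q) := block_mx x%:M 0 0 y%:M.

(* Pairs of isotropic-like row spaces in the two coordinate blocks, exchanged by
   the transition maps [Lambda_i -> pi0^-1 Lambda_-i -> pi0^-1 Lambda_i]. *)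
Definition block_pair k (c : R) (E E' : 'M[R]_(k, p + q)) : Prop :=
  [/\ exists W, E *m W = 1%:M, exists W, E' *m W = 1%:M,
      E *m gram_block *m E'^T = 0,
      exists H, E *m scale_block 1 c = H *m E' &
      exists H, E' *m scale_block c 1 = H *m E].

Definition frame_mx (w : R) (phi : 'M[R]_(r, s)) : 'M[R]_(r + (s + d), p + q) :=
  col_mx (row_mx (st r p) (phi *m zt s q))
    (col_mx (row_mx (w ^+ 2 *: (phi^T *m zt r p)) (st s q))
            (row_mx (w *: md r p) (md s q))).

(** The orthogonal complement of [frame_mx]: [phi] cancels against [- phi^T], and on the shared
    middle [w] cancels against [- w]. Scaling one block by [- w ^+ 2] sends each row of one frame to
    a multiple of the corresponding row of the other. *)
Definition dual_frame_mx (w : R) (phi : 'M[R]_(r, s)) :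
    'M[R]_(r + (s + d), p + q) :=
  col_mx (row_mx (st r p) (- w ^+ 2 *: (phi *m zt s q)))
    (col_mx (row_mx (- (phi^T *m zt r p)) (st s q))
            (row_mx (md r p) (- w *: md s q))).

(** The relations in right-associated form, with a trailing factor, packed so that one rewrite
    normalises long products. *)
Lemma frame_rules k N (NE : N = (k + d + k)%N) :
  ((st k N *m (st k N)^T = 1%:M) * (st k N *m (antidiag R N *m (st k N)^T) = 0) *
   (md k N *m (st k N)^T = 0) * (md k N *m (antidiag R N *m (st k N)^T) = 0) *
   (md k N *m (antidiag R N *m (md k N)^T) = antidiag R d) *
   (st k N *m (antidiag R N *m (md k N)^T) = 0) *
   (forall m (X : 'M_(d, m)), md k N *m (antidiag R N *m ((md k N)^T *m X)) =
     antidiag R d *m X) *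
   (forall m (X : 'M_(d, m)), st k N *m (antidiag R N *m ((md k N)^T *m X)) = 0) *
   (forall m (X : 'M_(d, m)), st k N *m ((md k N)^T *m X) = 0) *
   (forall m (X : 'M_(k, m)), st k N *m ((st k N)^T *m X) = X) *
   (forall m (X : 'M_(k, m)), st k N *m (antidiag R N *m ((st k N)^T *m X)) = 0) *
   (forall m (X : 'M_(k, m)), md k N *m ((st k N)^T *m X) = 0) *
   (forall m (X : 'M_(k, m)), md k N *m (antidiag R N *m ((st k N)^T *m X)) = 0) *
   (forall m (X : 'M_(N, m)), antidiag R N *m (antidiag R N *m X) = X) *
   (st k N *m (md k N)^T = 0))%type.
Proof.
have [r1 r2 r3 r4 r5] := frame_relations NE.
have r6 : st k N *m (md k N)^T = 0.
  by rewrite -[st k N]trmxK -trmx_mul r3 trmx0.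
have r7 : st k N *m antidiag R N *m (md k N)^T = 0.
  by have := congr1 trmx r4; rewrite !trmx_mul trmxK tr_antidiag trmx0 mulmxA.
do 14 (split; last by move=> *; rewrite ?mulmxA ?(r1, r2, r3, r4, r5, r6, r7) ?mul0mx ?antidiagK
  ?mul1mx ?mul0mx); exact: r1.
Qed.

Hypotheses (pE : p = (r + odim t + r)%N) (qE : q = (s + odim t + s)%N).

Lemma frame_pair w phi :
  block_pair (- w ^+ 2) (frame_mx w phi) (dual_frame_mx w phi).
Proof.
pose Pr := frame_rules pE; pose Qr := frame_rules qE.
have trN m1 m2 (A : 'M[R]_(m1, m2)) : (- A)^T = - A^T by rewrite linearN.
have trZ m1 m2 a (A : 'M[R]_(m1, m2)) : (a *: A)^T = a *: A^T by rewrite linearZ.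
split.
(* The right inverse pairs each row with its dual vector. The middle rows are tested in Q, where
   their coefficient is 1; for the dual frame they are tested in P for the same reason. *)
- exists (gram_block *m (col_mx (row_mx (zt r p) 0) (col_mx (row_mx 0 (zt s q))
     (row_mx 0 (antidiag R d *m md s q))))^T).
  rewrite mulmxA /frame_mx /gram_block.
  rewrite !(tr_col_mx, tr_row_mx, mul_col_mx, mul_row_block, mul_mx_row, mul_row_col).
  rewrite !(trmx_mul, trmx0, mulmx0, mul0mx, addr0, add0r, tr_antidiag) -?scalemxAl -?mulmxA.
  rewrite !(Pr, Qr) !(mulmx0, scaler0, row_mx0, col_mx0, antidiagK).
  by rewrite -!block_mxEv -block_mxEh -!scalar_mx_block.
- exists (gram_block *m (col_mx (row_mx (zt r p) 0) (col_mx (row_mx 0 (zt s q))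
     (row_mx (antidiag R d *m md r p) 0)))^T).
  rewrite mulmxA /dual_frame_mx /gram_block.
  rewrite !(tr_col_mx, tr_row_mx, mul_col_mx, mul_row_block, mul_mx_row, mul_row_col).
  rewrite !(trmx_mul, trmx0, mulmx0, mul0mx, addr0, add0r, tr_antidiag).
  rewrite -?scalemxAl ?mulNmx -?mulmxA.
  rewrite !(Pr, Qr) !(mulmx0, scaler0, oppr0, row_mx0, col_mx0, antidiagK).
  by rewrite -!block_mxEv -block_mxEh -!scalar_mx_block.
- rewrite /frame_mx /dual_frame_mx /gram_block.
  rewrite !(tr_col_mx, tr_row_mx, mul_col_mx, mul_row_block, mul_mx_row, mul_row_col).
  rewrite !(trN, trZ, trmx_mul, trmxK, trmx0, mulmx0, mul0mx, addr0, add0r, tr_antidiag).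
  rewrite -?scalemxAl -?scalemxAr ?(mulNmx, mulmxN) -?mulmxA.
  rewrite !(Pr, Qr).
  rewrite !(mulmx1, mulmx0, scaler0, oppr0, scaleNr, scalerN, addr0, add0r, subrr, addNr).
  by rewrite !(row_mx0, col_mx0).
- exists (block_mx 1%:M 0 0 (block_mx (- w ^+ 2)%:M 0 0 w%:M)).
  rewrite /frame_mx /dual_frame_mx /scale_block mul_block_col mul_block_col.
  rewrite !(mul_col_mx, mul_row_block, mul_mx_row, mul_row_col, mul_scalar_mx,
    mul_mx_scalar, mulmx0, mul0mx, addr0, add0r, scale1r, row_mx0).
  by rewrite !(scale_row_mx, scale0r, scaler0, scalerN, scaleNr) !scalerA -?expr2 ?opprK.
- exists (block_mx (- w ^+ 2)%:M 0 0 (block_mx 1%:M 0 0 (- w)%:M)).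
  rewrite /frame_mx /dual_frame_mx /scale_block mul_block_col mul_block_col.
  rewrite !(mul_col_mx, mul_row_block, mul_mx_row, mul_row_col, mul_scalar_mx,
    mul_mx_scalar, mulmx0, mul0mx, addr0, add0r, scale1r, row_mx0).
  by rewrite !(scale_row_mx, scale0r, scaler0, scalerN, scaleNr) !scalerA -?expr2 ?opprK.
Qed.

(** Commuting with the scalings expresses that an isometry preserves both blocks, in a form stable
    under products. *)
Definition orth_pair (M : 'M[R]_(p + q)) : Prop :=
  [/\ M *m gram_block *m M^T = gram_block &
      forall x y, M *m scale_block x y = scale_block x y *m M].

Lemma gram_blockK : gram_block *m gram_block = 1%:M.
Proof.
rewrite mulmx_block !mulmx0 !mul0mx !addr0 !add0r !antidiagK.
by rewrite -scalar_mx_block.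
Qed.

Lemma orth_pair_block MP MQ : orth MP -> orth MQ -> orth_pair (block_mx MP 0 0 MQ).
Proof.
rewrite /orth => hP hQ; split=> [|x y].
  rewrite /gram_block tr_block_mx !trmx0 !mulmx_block.
  by rewrite !(mulmx0, mul0mx, addr0, add0r) hP hQ.
rewrite /scale_block !mulmx_block !(mulmx0, mul0mx, addr0, add0r).
by rewrite !mul_scalar_mx !mul_mx_scalar.
Qed.

Lemma orth_pairM M M' : orth_pair M -> orth_pair M' -> orth_pair (M *m M').
Proof.
move=> [g1 s1] [g2 s2]; split=> [|x y].
  by rewrite trmx_mul !mulmxA -(mulmxA M) -(mulmxA M) g2 g1.
by rewrite -mulmxA s2 !mulmxA s1.
Qed.

Lemma orth_pair_inv M : orth_pair M -> M *m (gram_block *m M^T *m gram_block) = 1%:M.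
Proof. by case=> hM _; rewrite !mulmxA hM gram_blockK. Qed.

Lemma block_pairM k c (E E' : 'M_(k, p + q)) M :
  orth_pair M -> block_pair c E E' -> block_pair c (E *m M) (E' *m M).
Proof.
move=> oM [[W hW] [W' hW'] EE [H hH] [H' hH']].
have Mi := orth_pair_inv oM; case: oM => gM sM.
split.
- by exists (gram_block *m M^T *m gram_block *m W); rewrite mulmxA -(mulmxA E) Mi mulmx1.
- by exists (gram_block *m M^T *m gram_block *m W'); rewrite mulmxA -(mulmxA E') Mi mulmx1.
- by rewrite trmx_mul !mulmxA -(mulmxA E) -(mulmxA E) gM.
- by exists H; rewrite -mulmxA sM mulmxA hH mulmxA.
- by exists H'; rewrite -mulmxA sM mulmxA hH' mulmxA.
Qed.

End Frames.

(** * Coordinates of the lattices adapted to the two quadratic blocks *)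

Section Embed.
Variables (n i : nat).
Hypothesis i_le_n : (i <= n)%N.

(* The first [odim i] positions are [e_1, ..., e_i, f_1, e_(2n+1-i), ..., e_2n],
   the others [e_(i+1), ..., e_n, f_2, e_(n+1), ..., e_(2n-i)]. *)
Definition place (k : nat) : nat :=
  if (k < odim i)%N then
    if (k < i)%N then k else if k == i then (2 * n)%N else (2 * n + k - odim i)%N
  else let l := (k - odim i)%N in
    if (l < n - i)%N then (i + l)%N else if l == (n - i)%N then (2 * n).+1
    else (i + l).-1.

Definition in_P (a : nat) : bool := (a < i)%N || (2 * n - i <= a <= 2 * n)%N.

Fact place_lt (k : 'I_(odim i + odim (n - i))) : (place k < dimV n)%N.
Proof.
move: (nat_of_ord k) (ltn_ord k) => l; rewrite /place !odimE => kl.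
repeat (case: ifP => ?).
all: lia.
Qed.

Definition place_ord k : 'I_(dimV n) := Ordinal (place_lt k).

Lemma in_P_place k : (k < odim i + odim (n - i))%N ->
  in_P (place k) = (k < odim i)%N.
Proof.
rewrite /place /in_P !odimE => kl.
repeat (case: ifP => ?).
all: lia.
Qed.

Lemma pair_place k l : (k < odim i + odim (n - i))%N ->
  (l < odim i + odim (n - i))%N ->
  pair_idx n (place k) (place l) =
  if (k < odim i)%N then (k + l == 2 * i)%N
  else (odim i <= l)%N && ((k - odim i) + (l - odim i) == 2 * (n - i))%N.
Proof.
rewrite /place /pair_idx !odimE => kl ll.
case: (ltnP k (2 * i).+1) => h1; case: (ltnP l (2 * i).+1) => h2 /=;
repeat (case: ifP => ?).
all: lia.
Qed.

Lemma place_inj k l : (k < odim i + odim (n - i))%N ->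
  (l < odim i + odim (n - i))%N -> (place k == place l) = (k == l).
Proof.
rewrite /place !odimE => kl ll.
case: (ltnP k (2 * i).+1) => h1; case: (ltnP l (2 * i).+1) => h2 /=;
repeat (case: ifP => ?).
all: lia.
Qed.

Lemma odim_sum : (odim i + odim (n - i))%N = dimV n.
Proof. by rewrite !odimE; lia. Qed.

Variable R : comPzRingType.

Definition embed_mx : 'M[R]_(odim i + odim (n - i), dimV n) :=
  rowsub place_ord 1%:M.

Definition pairing : 'M[R]_(dimV n) := \matrix_(a, b) (pair_idx n a b)%:R.

(** With c the image of pi0, [scale_V 1 c] is the inclusion of Lambda_i in pi0^-1 Lambda_-i, and
    [scale_V c 1] that of Lambda_-i in Lambda_i, in the given bases. *)
Definition scale_V (x y : R) : 'M[R]_(dimV n) :=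
  diag_mx (\row_a if in_P a then x else y).

Lemma embed_mulV : embed_mx *m embed_mx^T = 1%:M.
Proof.
rewrite /embed_mx -rowsubE; apply/matrixP => a b; rewrite !mxE.
rewrite -!val_eqE /= place_inj // eq_sym //.
Qed.

Lemma embed_mulVT : embed_mx^T *m embed_mx = 1%:M.
Proof.
have gen N N' (A : 'M[R]_(N, N')) B : N = N' -> A *m B = 1%:M -> B *m A = 1%:M.
  by move=> e; case: _ / e in A B * => /mulmx1C.
exact: gen odim_sum embed_mulV.
Qed.

Lemma embed_pairing :
  embed_mx *m pairing *m embed_mx^T = gram_block R (odim i) (odim (n - i)).
Proof.
have -> : embed_mx *m pairing *m embed_mx^T = mxsub place_ord place_ord pairing.
  rewrite /embed_mx -rowsubE; apply/matrixP => a b; rewrite !mxE.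
  rewrite (bigD1 (place_ord b)) //= !mxE eqxx mulr1 big1 ?addr0 // => c.
  by rewrite eq_sym => /negPf cb; rewrite !mxE cb mulr0.
apply/matrixP => a b; rewrite !mxE pair_place //.
case: splitP => a' ea; rewrite !mxE; case: splitP => b' eb; rewrite !mxE;
  have := ltn_ord a'; have := ltn_ord b' => hb ha;
  have := odimE i; have := odimE (n - i) => en ei;
  try (rewrite -[0]/((false : nat)%:R)); apply: natr_bool; rewrite ea eb -?val_eqE /=; lia.
Qed.

Lemma embed_scale x y :
  embed_mx *m scale_V x y = scale_block (odim i) (odim (n - i)) x y *m embed_mx.
Proof.
have -> : scale_block (odim i) (odim (n - i)) x y =
    diag_mx (\row_k if (k < odim i)%N then x else y).
  apply/matrixP => a b; rewrite !mxE.
  case: splitP => a' ea; rewrite !mxE; case: splitP => b' eb; rewrite !mxE ?ea -?val_eqE /= ?ea ?eb.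
  - by [].
  - by have := ltn_ord a'; case: eqP => // ->; lia.
  - by have := ltn_ord b'; case: eqP => // <-; lia.
  - by rewrite eqn_add2l.
rewrite mul_mx_diag mul_diag_mx; apply/matrixP => a b; rewrite !mxE.
case: eqP => [<-|_]; last by rewrite mulr0 mul0r.
by rewrite /= in_P_place // mulr1 mul1r.
Qed.

(* [A] and [A'] span the members [F_(Lambda_i)] and [F_(Lambda_-i)] of a point
   of the naive local model; [c] is the image of [pi0]. *)
Definition naive_pair k (c : R) (A A' : 'M[R]_(k, dimV n)) : Prop :=
  [/\ exists W, A *m W = 1%:M, exists W, A' *m W = 1%:M,
      A *m pairing *m A'^T = 0,
      exists H, A *m scale_V 1 c = H *m A' &
      exists H, A' *m scale_V c 1 = H *m A].

Lemma naive_pair_embed k c (E E' : 'M_(k, _)) :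
  block_pair c E E' -> naive_pair c (E *m embed_mx) (E' *m embed_mx).
Proof.
move=> [[W hW] [W' hW'] EE [H hH] [H' hH']]; split.
- by exists (embed_mx^T *m W); rewrite mulmxA -(mulmxA E) embed_mulV mulmx1.
- by exists (embed_mx^T *m W'); rewrite mulmxA -(mulmxA E') embed_mulV mulmx1.
- by rewrite trmx_mul !mulmxA -(mulmxA E) -(mulmxA E) embed_pairing.
- by exists H; rewrite -mulmxA embed_scale mulmxA hH mulmxA.
- by exists H'; rewrite -mulmxA embed_scale mulmxA hH' mulmxA.
Qed.

End Embed.

(** * Points of the naive model spanned by matrices *)

Local Open Scope classical_set_scope.

Section RowSpace.
Variables (R : comPzRingType) (m : nat).

Definition row_space k (A : 'M[R]_(k, m)) : set 'rV[R]_m :=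
  [set x | exists u, x = u *m A].

Lemma row_space_submodule k (A : 'M_(k, m)) : is_submodule (row_space A).
Proof.
split=> [|a _ _ [u ->] [w ->]]; first by exists 0; rewrite mul0mx.
by exists (a *: u + w); rewrite mulmxDl scalemxAl.
Qed.

Lemma lin_span_submodule (G : set 'rV[R]_m) : is_submodule (lin_span G).
Proof.
split=> [|a _ _ [k [g [x [gG ->]]]] [l [h [y [hG ->]]]]].
  by exists 0, 0, 0; split; [case | rewrite mul0mx].
exists (k + l)%N, (col_mx g h), (row_mx (a *: x) y); split; last first.
  by rewrite mul_row_col scalemxAl.
move=> j; rewrite -(splitK j); case: (split j) => j' /=.
  by rewrite rowKu.
by rewrite rowKd.
Qed.

Lemma sub_lin_span (G : set 'rV[R]_m) x : G x -> lin_span G x.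
Proof.
by move=> Gx; exists 1, x, 1; split; [move=> j; rewrite row_id | rewrite mul1mx].
Qed.

Lemma lin_span_sub (G H : set 'rV[R]_m) :
  is_submodule H -> (forall x, G x -> H x) -> forall x, lin_span G x -> H x.
Proof.
move=> [H0 HL] GH _ [k [g [a [gG ->]]]]; rewrite mulmx_sum_row.
elim/big_ind: _ => // [x y Hx Hy|j _].
  by rewrite -[x]scale1r; apply: HL.
by rewrite -[_ *: _]addr0; apply: HL => //; apply: GH.
Qed.

Lemma free_summand_row_space k (A : 'M_(k, m)) W :
  A *m W = 1%:M -> free_summand k (row_space A).
Proof.
move=> AW; split.
  (* The kernel of the projector [W *m A] is the complement. *)
  exists [set x | x *m W = 0]; split.
  - split=> [|a x y]; first by rewrite /= mul0mx.
    by rewrite /= mulmxDl -scalemxAl => -> ->; rewrite scaler0 addr0.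
  - move=> x; exists (x *m W *m A), (x - x *m W *m A); split.
    + by exists (x *m W).
    + by rewrite /= mulmxBl -!mulmxA AW mulmx1 subrr.
    + by rewrite addrC subrK.
  - by move=> _ [u ->]; rewrite /= -mulmxA AW mulmx1 => ->; rewrite mul0mx.
exists A; split=> // u uA; have := congr1 (mulmx^~ W) uA.
by rewrite -mulmxA AW mulmx1 mul0mx.
Qed.

End RowSpace.

Lemma base_change_row_space (R R' : comPzRingType) (f : {rmorphism R -> R'}) m k
    (A : 'M_(k, m)) : base_change f (row_space A) = row_space (map_mx f A).
Proof.
apply/seteqP; split=> x.
  apply: lin_span_sub; first exact: row_space_submodule.
  by move=> _ [_ [u ->] <-]; exists (map_mx f u); rewrite map_mxM.
case=> u ->; exists k, (map_mx f A), u; split=> // j.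
exists (row j A); last by rewrite map_row.
by exists (delta_mx 0 j); rewrite rowE.
Qed.

Lemma zariski_locally_id (R : comPzRingType)
    (P : forall R' : comPzRingType, {rmorphism R -> R'} -> Prop) :
  P R (@idfun R) -> zariski_locally P.
Proof.
move=> PR; exists 1, (fun=> 1); split.
  by exists (fun=> 1); rewrite big_ord1 mulr1.
move=> _; exists R, (@idfun R); split=> //; split.
- by exists 1; rewrite mulr1.
- by move=> y; exists y, 0%N; rewrite mulr1.
- by move=> a /= ->; exists 0%N; rewrite mulr0.
Qed.

Section Uniformizer.
Variables (F0 : fieldType) (v : dval F0) (pi0 : F0).
Hypothesis pi0P : uniformizer v pi0.

Let pi0_neq0 : pi0 != 0. Proof. by case: pi0P. Qed.

Lemma uniformizerX k : v (pi0 ^+ k) = k%:Z.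
Proof.
elim: k => [|k IH]; first by rewrite expr0 dval1.
by rewrite exprS dvalM ?expf_neq0 // IH; case: pi0P => _ ->; lia.
Qed.

Lemma uniformizer_exp (e : int) : v (pi0 ^ e) = e.
Proof.
case: e => k; first exact: uniformizerX.
have k0 : pi0 ^+ k.+1 != 0 by rewrite expf_neq0.
have := dvalM v k0 (invr_neq0 k0); rewrite mulfV // dval1 uniformizerX.
by rewrite NegzE -[pi0 ^- _]/(pi0 ^ (Negz k)) NegzE => h; lia.
Qed.

Fact pi0_valring : pi0 \in in_valring v.
Proof. by case: pi0P => _ h; rewrite unfold_in /val_ge h orbT. Qed.

Definition pi0_int : valring v := ValRing pi0_valring.

End Uniformizer.

Section NaivePoint.
Variables (F0 : fieldType) (v : dval F0) (pi0 : F0).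
Hypothesis pi0P : uniformizer v pi0.
Variables (n i : nat).
Hypothesis i_le_n : (i <= n)%N.

Let pi0_neq0 : pi0 != 0. Proof. by case: pi0P. Qed.

Local Notation pi0_int := (pi0_int pi0P).

(** The integer index of the chain is irrelevant in coordinates, since multiplication by pi0 has the
    identity matrix in the chosen bases. *)
Definition family_of (R : comPzRingType) (A A' : 'M[R]_(n.+1, dimV n)) :
  Defs.family n R := fun L => row_space (if L.2 then A else A').

(** Integrality of the diagonal entries makes all exponents nonnegative, so absolute values lose
    nothing and the matrix can be pushed forward along any ring morphism. *)
Lemma mult_matrix_diag k L L' (A : 'M[valring v]_(dimV n)) :
  mult_matrix pi0 i (pi0 ^ k) L L' A ->
  (forall a : 'I_(dimV n), 0 <= k + lat_exp n i L a - lat_exp n i L' a) /\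
  A = diag_mx (\row_a pi0_int ^+ `|(k + lat_exp n i L a - lat_exp n i L' a)%R|%N).
Proof.
move=> hA.
have e a b : val (A a b) = (pi0 ^ (k + lat_exp n i L a - lat_exp n i L' a)) *+ (a == b).
  move/matrixP/(_ a b): hA; rewrite /lat_basis mul_mx_diag !mxE => h.
  have b0 : pi0 ^ lat_exp n i L' b != 0 by rewrite expfz_neq0.
  apply: (mulIf b0); rewrite h; case: eqVneq => [->|_]; last by rewrite mulr0 mul0r.
  by rewrite !mulr1n -!expfzDr // subrK.
have pos (a : 'I_(dimV n)) : 0 <= k + lat_exp n i L a - lat_exp n i L' a.
  have := valP (A a a); rewrite e eqxx mulr1n unfold_in /val_ge (uniformizer_exp pi0P).
  by rewrite (negPf (expfz_neq0 _ _)).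
split=> //; apply/matrixP => a b; apply: val_inj; rewrite e !mxE.
case: eqP => _; rewrite ?mulr1n ?mulr0n ?rmorph0 // rmorphXn /=.
by rewrite -[pi0 ^+ _]/(pi0 ^ Posz _) gez0_abs.
Qed.

Lemma naive_point_family (R : comPzRingType) (s : {rmorphism valring v -> R})
    (A A' : 'M[R]_(n.+1, dimV n)) :
  naive_pair i (s pi0_int) A A' -> naive_point pi0 i s (family_of A A').
Proof.
move=> [[W AW] [W' AW'] AA [H AH] [H' AH']]; split.
- move=> L; split; first exact: row_space_submodule.
  apply: zariski_locally_id; rewrite base_change_row_space map_mx_id //.
  by case: (L.2); [exact: free_summand_row_space AW | exact: free_summand_row_space AW'].
- move=> L P; rewrite /pairing_matrix perfect_pairing // => hP x y.
  have -> : map_mx s P = pairing n R.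
    have -> : P = pairing n _.
      apply/matrixP => a b; apply: val_inj; move/matrixP/(_ a b): hP.
      by rewrite !mxE rmorph_nat.
    by apply/matrixP => a b; rewrite !mxE rmorph_nat.
  have pT : (pairing n R)^T = pairing n R.
    apply/matrixP => a b; rewrite !mxE; congr (nat_of_bool _)%:R.
    by rewrite /pair_idx; lia.
  have AA' : A' *m pairing n R *m A^T = 0.
    by have := congr1 trmx AA; rewrite !trmx_mul trmxK pT trmx0 mulmxA.
  have gen (B C : 'M_(n.+1, dimV n)) (u u' : 'rV_n.+1) :
      B *m pairing n R *m C^T = 0 -> u *m B *m pairing n R *m (u' *m C)^T = 0.
    move=> BC; have -> : u *m B *m pairing n R *m (u' *m C)^T =
        u *m (B *m pairing n R *m C^T) *m u'^T by rewrite trmx_mul !mulmxA.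
    by rewrite BC mulmx0 mul0mx.
  by rewrite /family_of /=; case: L.2 => -[u ->] [u' ->]; apply: gen.
- move=> [d b] [d' b'] B; rewrite -(expr0z pi0) => /mult_matrix_diag[pos ->] x.
  pose c := s pi0_int.
  have f1 : (2 * n < dimV n)%N by lia.
  have f2 : ((2 * n).+1 < dimV n)%N by lia.
  have scE m x0 y0 : (forall a : 'I_(dimV n),
      `|(0 + lat_exp n i (d, b) a - lat_exp n i (d', b') a)%R|%N =
      (m + (if in_P n i a then x0 else y0))%N) ->
    map_mx s (diag_mx (\row_a pi0_int ^+
      `|(0 + lat_exp n i (d, b) a - lat_exp n i (d', b') a)%R|%N)) =
      c ^+ m *: scale_V n i (c ^+ x0) (c ^+ y0).
    move=> h; apply/matrixP => j l; rewrite !mxE rmorphMn mulrnAr; congr (_ *+ _).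
    by rewrite rmorphXn (h j) exprD /=; case: ifP.
  have sc1 m : (forall a : 'I_(dimV n),
      `|(0 + lat_exp n i (d, b) a - lat_exp n i (d', b') a)%R|%N = m) ->
    map_mx s (diag_mx (\row_a pi0_int ^+
      `|(0 + lat_exp n i (d, b) a - lat_exp n i (d', b') a)%R|%N)) = (c ^+ m)%:M :> 'M_(dimV n).
    move=> h; apply/matrixP => j l; rewrite !mxE rmorphMn; congr (_ *+ _).
    by rewrite rmorphXn (h j).
  case: b b' pos scE sc1 => -[] pos scE sc1 /= [u ->].
  + rewrite (sc1 `|(d' - d)%R|%N) => [|a]; last by rewrite /lat_exp /=; lia.
    by exists (c ^+ `|(d' - d)%R|%N *: u); rewrite mul_mx_scalar scalemxAl.
  (* The exponent is smallest on P, in particular at f_1, where integrality gives d + 1 <= d'. *)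
  + have := pos (Ordinal f1); rewrite /lat_exp /= => pos1.
    rewrite (scE `|(d' - d - 1)%R|%N 0%N 1%N) => [|a]; last first.
      by rewrite /lat_exp /in_P /=; have := ltn_ord a; case: ifP; lia.
    exists (c ^+ `|(d' - d - 1)%R|%N *: (u *m H)).
    by rewrite expr0 expr1 -scalemxAr -scalemxAl -!mulmxA AH.
  (* Now the exponent is smallest on Q, in particular at f_2, where integrality gives d <= d'. *)
  + have := pos (Ordinal f2); rewrite /lat_exp /= => pos2.
    rewrite (scE `|(d' - d)%R|%N 1%N 0%N) => [|a]; last first.
      by rewrite /lat_exp /in_P /=; have := ltn_ord a; case: ifP; lia.
    exists (c ^+ `|(d' - d)%R|%N *: (u *m H')).
    by rewrite expr0 expr1 -scalemxAr -scalemxAl -!mulmxA AH'.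
  + rewrite (sc1 `|(d' - d)%R|%N) => [|a]; last by rewrite /lat_exp /=; lia.
    by exists (c ^+ `|(d' - d)%R|%N *: u); rewrite mul_mx_scalar scalemxAl.
- move=> [d b] B; rewrite -[in X in mult_matrix _ _ X](expr1z pi0).
  move=> /mult_matrix_diag[_ ->].
  have -> : map_mx s (diag_mx (\row_a pi0_int ^+ `|(1 + lat_exp n i (d, b) a -
      lat_exp n i (chain_pi (d, b)) a)%R|%N)) = 1%:M :> 'M_(dimV n).
    apply/matrixP => j l; rewrite !mxE rmorphMn; congr (_ *+ _).
    by rewrite (_ : `|_|%N = 0%N) ?rmorph1 // /lat_exp /=; lia.
  apply/seteqP; split=> [_ [x Fx <-]|x Fx]; first by rewrite mulmx1.
  by exists x; rewrite ?mulmx1.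
Qed.

End NaivePoint.

(** * The ring carrying the lifts *)

(** Flatness in equational form: solutions over R of a linear system with coefficients in O are
    combinations of solutions over O. *)
Definition kernel_generated (O R : comPzRingType) (s : {rmorphism O -> R}) : Prop :=
  forall k l (M : 'M[O]_(k, l)) (x : 'rV[R]_k), x *m map_mx s M = 0 ->
    base_change s [set c | c *m M = 0] x.

Lemma base_change_base_change (O R R' : comPzRingType) (s : {rmorphism O -> R})
    (f : {rmorphism R -> R'}) m (G : set 'rV[O]_m) x :
  base_change s G x -> base_change (f \o s) G (map_mx f x).
Proof.
case=> k [g [a [gG ->]]]; exists k, (map_mx f g), (map_mx f a).
split; last by rewrite map_mxM.
move=> i; have [c Gc cg] := gG i; exists c => //.
by rewrite -map_row -cg -map_mx_comp.
Qed.

(** The system has constant coefficients, so each coefficient vector of a polynomial solution is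
    itself a solution. *)
Lemma kernel_generated_poly (O : comPzRingType) (R : comNzRingType)
    (s : {rmorphism O -> R}) :
  kernel_generated s -> kernel_generated (polyC \o s).
Proof.
move=> hs k l M x xM.
pose N := (\max_j size (x 0%R j))%N.
have -> : x = \sum_(a < N) 'X^a *: map_mx polyC (map_mx (coefp a) x).
  apply/rowP => j; rewrite summxE; transitivity (\poly_(a < N) (x 0 j)`_a).
    apply/polyP => a; rewrite coef_poly; case: ltnP => // Na.
    by rewrite nth_default // (leq_trans _ Na) // (leq_bigmax j).
  by rewrite poly_def; apply: eq_bigr => a _; rewrite !mxE -mul_polyC mulrC.
have [S0 SL] := lin_span_submodule
  [set map_mx (polyC \o s) c | c in [set c : 'rV[O]_k | c *m M = 0]].
elim/big_ind: _ => // [y z hy hz|a _].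
  by rewrite -[y]scale1r; apply: SL.
rewrite -[_ *: _]addr0; apply: (SL) => //.
apply: base_change_base_change; apply: hs.
apply/rowP => j; move/rowP/(_ j): xM; rewrite !mxE => /(congr1 (coefp a)).
rewrite raddf_sum /= coef0 => e; rewrite -[RHS]e.
apply: eq_bigr => b _.
by rewrite !mxE /= coefMC.
Qed.

(** One variable is adjoined for each element of [cs] and evaluated there under [f], while L grows
    to the field of rational functions. *)
Lemma lift_ring (F : fieldType) (w : dval F) (K : fieldType)
    (s : {rmorphism valring w -> K}) (cs : seq K) :
  exists (R : comNzRingType) (L : fieldType) (s' : {rmorphism valring w -> R})
    (f : {rmorphism R -> K}) (g : {rmorphism R -> L}) (gF : {rmorphism F -> L}),
    [/\ injective g, forall a, f (s' a) = s a, hits f cs,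
        forall a, g (s' a) = gF (val a) & kernel_generated s'].
Proof.
elim: cs => [|c cs [R [L [s' [f [g [gF [gi fs hc gs kg]]]]]]]].
  exists (valring w), F, (@idfun _), s, val, (@idfun _); split=> //.
  - exact: val_inj.
  - move=> k l M x; rewrite map_mx_id // => xM; apply: sub_lin_span.
    by exists x; rewrite // map_mx_id.
exists {poly R}, {fraction {poly L}}, (polyC \o s').
exists (horner_eval c \o map_poly f), (@tofrac _ \o map_poly g).
exists (@tofrac _ \o polyC \o gF); split.
- move=> x y /= /eqP; rewrite tofrac_eq => /eqP; exact: (map_inj_poly gi (rmorph0 _)).
- by move=> a /=; rewrite map_polyC horner_evalE hornerC; exact: fs.
- move=> d; rewrite inE => /orP[/eqP->|/hc[x <-]].
    by exists 'X; rewrite /= map_polyX horner_evalE hornerX.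
  by exists x%:P; rewrite /= map_polyC horner_evalE hornerC.
- by move=> a /=; rewrite map_polyC; congr (tofrac (polyC _)); exact: gs.
- exact: kernel_generated_poly.
Qed.

(** * Valuations *)

Section Valuation.
Variables (F0 : fieldType) (v : dval F0).

Lemma val_ge1D x y : val_ge v 1 x -> val_ge v 1 y -> val_ge v 1 (x + y).
Proof.
rewrite /val_ge; case: (eqVneq x 0) => [->|x0] /=; first by rewrite add0r.
case: (eqVneq y 0) => [->|y0] /=; first by rewrite addr0 (negPf x0).
move=> vx vy; case: (eqVneq (x + y) 0) => //= xy.
by apply: le_trans (dvalD v x0 y0 xy); rewrite le_min vx.
Qed.

Lemma val_geM m k x y : val_ge v m x -> val_ge v k y -> val_ge v (m + k) (x * y).
Proof.
rewrite /val_ge; case: (eqVneq x 0) => [->|x0] /=; first by rewrite mul0r eqxx.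
case: (eqVneq y 0) => [->|y0] /=; first by rewrite mulr0 eqxx.
by move=> vx vy; rewrite dvalM // lerD ?orbT.
Qed.

Lemma val_ge0 (a : valring v) : val_ge v 0 (val a).
Proof. exact: (valP a). Qed.

Lemma val_geN m x : val_ge v m (- x) = val_ge v m x.
Proof.
rewrite /val_ge oppr_eq0; case: (eqVneq x 0) => //= x0; by rewrite dvalN.
Qed.

Lemma val_ge_sum m x y : x != 0 -> y != 0 -> v x != v y ->
  val_ge v m (x + y) -> m <= v x /\ m <= v y.
Proof.
move=> x0 y0 xy h.
have sum0 : x + y != 0.
  by apply: contra xy; rewrite addr_eq0 => /eqP->; rewrite dvalN.
move: h; rewrite /val_ge (negPf sum0) /= => h.
have yN : - y != 0 by rewrite oppr_eq0.
have xN : - x != 0 by rewrite oppr_eq0.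
have hx : Num.min (v (x + y)) (v y) <= v x.
  have := @dvalD _ v (x + y) (- y) sum0 yN; rewrite addrK dvalN //; exact.
have hy : Num.min (v (x + y)) (v x) <= v y.
  have := @dvalD _ v (x + y) (- x) sum0 xN; rewrite addrC addKr dvalN //; exact.
by move: hx hy; rewrite !ge_min => /orP[] ? /orP[] ?; split; lia.
Qed.

Variable pi0 : F0.
Hypothesis pi0P : uniformizer v pi0.
Let pi0_neq0 : pi0 != 0. Proof. by case: pi0P. Qed.
Local Notation pi0i := (pi0_int pi0P).

Variables (K : fieldType) (s : {rmorphism valring v -> K}).

Lemma kills_val_ge1 (a : valring v) : s pi0i = 0 -> val_ge v 1 (val a) -> s a = 0.
Proof.
move=> s0 a1; have h : val a / pi0 \in in_valring v.
  move: (val a) a1 => x; rewrite unfold_in /val_ge; case: eqVneq => [->|a0] /= va.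
    by rewrite mul0r eqxx.
  have y0 : x / pi0 != 0 by rewrite mulf_neq0 ?invr_eq0.
  have := dvalM v y0 pi0_neq0; rewrite mulfVK // (negPf y0) /=.
  case: pi0P => _ ->; move: (x / pi0) => y e; lia.
have -> : a = pi0i * ValRing h by apply: val_inj; rewrite /= mulrCA mulfV // mulr1.
by rewrite rmorphM s0 mul0r.
Qed.

(** Every nonzero element of the valuation ring divides a power of the uniformizer, so a nonzero
    kernel contains such a power, and K is reduced. *)
Lemma noninjective_kills : ~ injective s -> s pi0i = 0.
Proof.
move=> ninj.
have [a a0 sa] : exists2 a, a != 0 & s a = 0.
  apply: contrapT => h; apply: ninj => x y sxy; apply/eqP; rewrite -subr_eq0.
  apply/negPn/negP => xy; apply: h; exists (x - y) => //.
  by rewrite rmorphB sxy subrr.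
have va0 : val a != 0 by apply: contra a0 => /eqP e; apply/eqP/val_inj.
have va : 0 <= v (val a) by have := val_ge0 a; rewrite /val_ge (negPf va0).
pose k := `|v (val a)|%N.
have h : pi0 ^+ k / val a \in in_valring v.
  have p0 : pi0 ^+ k != 0 by rewrite expf_neq0.
  rewrite /k; move: (val a) va0 va => x x0 vx.
  have y0 : pi0 ^+ `|v x|%N / x != 0 by rewrite mulf_neq0 ?invr_eq0 // expf_neq0.
  have := dvalM v y0 x0; rewrite mulfVK // (uniformizerX pi0P) unfold_in /val_ge.
  rewrite (negPf y0) /=; move: (_ / x) => y e; lia.
have e : pi0i ^+ k = a * ValRing h.
  by apply: val_inj; rewrite rmorphXn /= mulrCA mulfV // mulr1.
have /eqP : s pi0i ^+ k = 0 by rewrite -rmorphXn e rmorphM sa mul0r.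
by rewrite expf_eq0 => /andP[_ /eqP].
Qed.

(** As p is odd, 1 = p - 2 (p./2); if 2 were in the maximal ideal, so would be 1. *)
Lemma two_unit p : residue_pchar v p -> (2 < p)%N -> exists h : valring v, h + h = 1.
Proof.
case=> pp vp p2; have podd : odd p by case: (even_prime pp) => // p2'; move: p2; rewrite p2'.
have n2 : ~~ val_ge v 1 2%:R.
  apply/negP => v2; suff : val_ge v 1 1 by rewrite /val_ge oner_eq0 dval1.
  have -> : 1 = p%:R - 2%:R * (p./2)%:R :> F0.
    by rewrite -{1}(odd_double_half p) podd natrD -mul2n natrM addrK.
  apply: val_ge1D => //; rewrite val_geN.
  have vn : val_ge v 0 (p./2)%:R by have := val_ge0 (p./2)%:R; rewrite rmorph_nat.
  by have := val_geM v2 vn; rewrite addr0.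
have t0 : (2%:R : F0) != 0 by apply: contra n2 => /eqP->; rewrite /val_ge eqxx.
have v2 : v 2%:R = 0.
  have := val_ge0 2%:R; rewrite rmorph_nat.
  by move: n2; rewrite /val_ge !(negPf t0) /=; case: (v 2%:R) => [[|k]|k].
have h : 2%:R^-1 \in in_valring v.
  rewrite unfold_in /val_ge invr_eq0 (negPf t0) /=.
  by have := dvalM v t0 (invr_neq0 t0); rewrite mulfV // dval1 v2 add0r => <-.
exists (ValRing h); apply: val_inj => /=.
by rewrite -mulr2n -(mulr_natr (2%:R^-1)) mulVf.
Qed.

End Valuation.

Section Ramified.
Variables (F0 : fieldType) (v : dval F0) (pi0 : F0).
Hypothesis pi0P : uniformizer v pi0.
Variables (F : fieldExtType F0) (w : dval F) (pi : F).
Hypothesis pi_sqr : pi ^+ 2 = - pi0%:A.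
Hypothesis F_gen : <<1; pi>>%VS = fullv.
Hypothesis ext : dval_extends2 v w.

Lemma scalar_neq0 (a : F0) : a != 0 -> (a%:A : F) != 0.
Proof. by move=> a0; rewrite scaler_eq0 negb_or a0 oner_neq0. Qed.

Lemma pi_uniformizer : uniformizer w pi.
Proof.
have [p0 vp] := pi0P.
have A0 : - (pi0%:A : F) != 0 by rewrite oppr_eq0 scalar_neq0.
have pi_neq0 : pi != 0.
  by apply: contra A0 => /eqP e; rewrite -pi_sqr e expr0n.
split=> //; have := dvalM w pi_neq0 pi_neq0.
rewrite -expr2 pi_sqr dvalN ?scalar_neq0 // ext // vp.
by case: (w pi) => k; lia.
Qed.

Let pi_neq0 : pi != 0. Proof. by case: pi_uniformizer. Qed.

Lemma ramified_decomp (x : F) : exists a b : F0, x = a%:A + b *: pi.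
Proof.
have : x \in <<1; pi>>%VS by rewrite F_gen memvf.
case/Fadjoin_polyP => p pO ->; elim/poly_ind: p pO => [|p c IH] pO.
  by exists 0, 0; rewrite horner0 !scale0r addr0.
have cO : c \in 1%VS.
  by have /polyOverP/(_ 0%N) := pO; rewrite coefD coefMX coefC eqxx add0r.
have pO' : p \is a polyOver 1%VS.
  apply/polyOverP => j; have /polyOverP/(_ j.+1) := pO.
  by rewrite coefD coefMX coefC /= addr0.
have [a [b e]] := IH pO'; have /vlineP[k kE] := cO.
exists (k - b * pi0), a; rewrite hornerD hornerMX hornerC e kE.
rewrite mulrDl -!scalerAl mul1r -expr2 pi_sqr scalerN scalerA.
by rewrite scalerBl addrAC [RHS]addrC addrA.
Qed.

(** The two rings have the same residue field. In a + b pi the first term has even and the second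
    odd valuation, so they cannot cancel: both are integral, and b pi lies in the maximal ideal. *)
Lemma ramified_residue (x : valring w) :
  exists a : valring v, val_ge w 1 (val x - (val a)%:A).
Proof.
have [a [b xE]] := ramified_decomp (val x).
have [p0 wp] := pi_uniformizer.
have bpE : b != 0 -> b *: pi != 0 /\ w (b *: pi) = v b *+ 2 + 1.
  move=> b0; rewrite -mulr_algl; split; first by rewrite mulf_neq0 ?scalar_neq0.
  by rewrite dvalM ?scalar_neq0 // ext // wp.
have [va vb] : val_ge v 0 a /\ val_ge w 1 (b *: pi).
  have := val_ge0 x; rewrite xE /val_ge.
  case: (eqVneq a 0) => [->|a0] /=.
    rewrite scale0r add0r; case: (eqVneq b 0) => [->|b0] /=.
      by rewrite scale0r eqxx.
    have [bp0 ->] := bpE b0; rewrite (negPf bp0) /= => h; split=> //.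
    by move: h; case: (v b) => k; lia.
  case: (eqVneq b 0) => [->|b0] /=.
    rewrite scale0r addr0 (negPf (scalar_neq0 a0)) eqxx /= ext // => h; split=> //.
    by move: h; case: (v a) => k; lia.
  have [bp0 wb] := bpE b0; move=> h.
  have ne : w a%:A != w (b *: pi).
    by rewrite wb ext //; case: (v a) => k; case: (v b) => l; apply/eqP; lia.
  have := val_ge_sum (scalar_neq0 a0) bp0 ne h.
  rewrite (negPf bp0) wb ext //= => -[h1 h2]; split.
    by move: h1; case: (v a) => k; lia.
  by move: h2; case: (v b) => k; lia.
by exists (ValRing va); rewrite xE addrAC subrr add0r.
Qed.

Local Notation incl := (valring_incl ext).

Lemma incl_val_ge1 (a : valring v) : val_ge w 1 ((val a)%:A) -> val_ge v 1 (val a).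
Proof.
move: (val a) => x; rewrite /val_ge; case: (eqVneq x 0) => [->|x0] //=.
by rewrite (negPf (scalar_neq0 x0)) /= ext //; case: (v x) => k; lia.
Qed.

(** A morphism killing the maximal ideal factors through the residue field, which does not change
    from F0 to F. *)
Lemma extend_special (K : fieldType) (s : {rmorphism valring v -> K}) :
  s (pi0_int pi0P) = 0 ->
  exists s' : {rmorphism valring w -> K}, forall a, s' (incl a) = s a.
Proof.
move=> s0; have [r hr] := boolp.choice ramified_residue.
(* The value of [s] does not depend on the representative; additivity and multiplicativity follow by
   comparing representatives. *)
have rs x a : val_ge w 1 (val x - (val a)%:A) -> s (r x) = s a.
  move=> h; apply/eqP; rewrite -subr_eq0 -rmorphB; apply/eqP.
  apply: (kills_val_ge1 s0); apply: incl_val_ge1.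
  rewrite rmorphB /= scalerBl.
  have -> : (val (r x))%:A - (val a)%:A = (val x - (val a)%:A) - (val x - (val (r x))%:A).
    by rewrite opprB [RHS]addrC addrA subrK.
  by apply: val_ge1D => //; rewrite val_geN.
have zm : zmod_morphism (s \o r).
  move=> x y /=; rewrite -rmorphB; apply: rs.
  rewrite !rmorphB /= scalerBl.
  have -> : val x - val y - ((val (r x))%:A - (val (r y))%:A) =
     (val x - (val (r x))%:A) - (val y - (val (r y))%:A).
    by rewrite !opprB [LHS]addrACA [RHS]addrACA [X in _ + X = _]addrC.
  by apply: val_ge1D => //; rewrite val_geN.
have mm : monoid_morphism (s \o r).
  split=> [|x y] /=.
    rewrite -(rmorph1 s); apply: rs.
    by rewrite !rmorph1 scale1r subrr /val_ge eqxx.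
  rewrite -rmorphM; apply: rs; rewrite !rmorphM /=.
  have -> : val x * val y - (val (r x) * val (r y))%:A =
      (val x - (val (r x))%:A) * val y + (val (r x))%:A * (val y - (val (r y))%:A).
    by rewrite mulrBl mulrBr addrA subrK mulr_algl scalerA.
  apply: val_ge1D; first by rewrite -[1]addr0; apply: val_geM (hr x) (val_ge0 y).
  by rewrite -[1]add0r; apply: val_geM (hr y); exact: (val_ge0 (incl (r x))).
pose sm := GRing.isZmodMorphism.Build (valring w) K (s \o r) zm.
pose smm := GRing.isMonoidMorphism.Build (valring w) K (s \o r) mm.
pose s' : {rmorphism valring w -> K} := HB.pack (s \o r) sm smm.
exists s' => a /=; apply: rs.
by rewrite subrr /val_ge eqxx.
Qed.

End Ramified.

(** * The spin condition on the generic fibre *)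

Section Isotropic.
Variable L : fieldType.
Variable half : L.
Hypothesis halfP : half + half = 1.
Variable n : nat.

Local Notation J := (antidiag L (dimV n)).
Local Notation w := (antidiag L n.+1).

Lemma mul_first_rows (g : 'M[L]_(dimV n)) (h : 'M[L]_(dimV n)) :
  first_rows (g *m h) = first_rows g *m h.
Proof. by rewrite /first_rows mul_rowsub_mx. Qed.

(** A maximal isotropic space is completed by a dual one. [C0] has the right pairing with [A] but
    need not be isotropic; subtracting half of its Gram matrix along [A] repairs this without
    changing the pairing. *)
Lemma extend_isotropic (A : 'M[L]_(n.+1, dimV n)) W :
  A *m W = 1%:M -> A *m J *m A^T = 0 ->
  exists2 g : 'M[L]_(dimV n), orth g & first_rows g = A.
Proof.
move=> AW AA; pose C0 := (J *m W *m w)^T.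
have JT := tr_antidiag L (dimV n); have wT := tr_antidiag L n.+1.
have AC0 : A *m J *m C0^T = w.
  by rewrite /C0 trmxK -(mulmxA J) 2!mulmxA -(mulmxA A) antidiagK mulmx1 AW mul1mx.
have C0A : C0 *m J *m A^T = w.
  by have := congr1 trmx AC0; rewrite !trmx_mul trmxK JT wT mulmxA.
have [q qE] : exists q, q = C0 *m J *m C0^T by eexists.
have qT : q^T = q by rewrite qE !trmx_mul trmxK JT mulmxA.
pose C := C0 - half *: (q *m w *m A).
have CT : C^T = C0^T - half *: (A^T *m w *m q).
  by rewrite /C linearB linearZ /= !trmx_mul wT qT mulmxA.
have AC : A *m J *m C^T = w.
  by rewrite CT mulmxBr AC0 -scalemxAr !mulmxA AA !mul0mx scaler0 subr0.
have CA : C *m J *m A^T = w.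
  by have := congr1 trmx AC; rewrite !trmx_mul trmxK JT wT mulmxA.
have CC : C *m J *m C^T = 0.
  rewrite {2}/C CT mulmxBr -scalemxAr !mulmxA CA antidiagK mul1mx.
  rewrite /C !mulmxBl -!scalemxAl -!mulmxA (mulmxA A) AC0 antidiagK mulmx1 mulmxA -qE.
  by rewrite -addrA -opprD -scalerDl halfP scale1r subrr.
pose th := cast_ord (esym (dimV_split n)).
exists (rowsub th (col_mx A C)); last first.
  apply/matrixP => a b; rewrite /first_rows mxE mxE.
  by rewrite (_ : th _ = lshift _ a) ?col_mxEu //; apply: val_inj.
rewrite /orth.
have -> : rowsub th (col_mx A C) *m J *m (rowsub th (col_mx A C))^T =
    mxsub th th (block_mx 0 w w 0).
  have <- : col_mx A C *m J *m (col_mx A C)^T = block_mx 0 w w 0.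
    by rewrite tr_col_mx mul_col_mx mul_col_row AA AC CA CC.
  apply/matrixP => a b; rewrite !mxE; apply: eq_bigr => c _; rewrite !mxE; congr (_ * _).
  by apply: eq_bigr => d _; rewrite !mxE.
apply/matrixP => a b; rewrite !mxE.
case: splitP => a' /= ea; rewrite !mxE; case: splitP => b' /= eb;
  rewrite !mxE -?val_eqE /=; have := ltn_ord a'; have := ltn_ord b' => hb ha.
- by apply/esym/natr_false; lia.
- by apply: natr_bool; lia.
- by apply: natr_bool; lia.
- by apply/esym/natr_false; lia.
Qed.

Lemma orth_det (g : 'M[L]_(dimV n)) : orth g -> exists b : bool, \det g = (-1) ^+ b.
Proof.
move=> og; have dJ : \det J != 0.
  apply/eqP => d0; have := congr1 determinant (antidiagK L (dimV n)).
  by rewrite det_mulmx d0 mul0r det1 => /eqP; rewrite eq_sym oner_eq0.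
have := congr1 determinant og; rewrite !det_mulmx det_tr mulrAC -expr2.
rewrite -[RHS]mul1r => /(mulIf dJ) /eqP; rewrite sqrf_eq1 => /orP[]/eqP->.
  by exists false; rewrite expr0.
by exists true; rewrite expr1.
Qed.

(* The component of the orthogonal Grassmannian containing the row space of
   [A] is read off from [b], and [h] exchanges them if its determinant is -1. *)
Lemma isotropic_sign (A : 'M[L]_(n.+1, dimV n)) W :
  A *m W = 1%:M -> A *m J *m A^T = 0 ->
  exists b : bool, forall h : 'M_(dimV n), orth h ->
    wedge (A *m h) *m spin_mx L n = ((-1) ^+ b * \det h) *: wedge (A *m h).
Proof.
move=> AW AA; have [g og gA] := extend_isotropic AW AA.
have [b db] := orth_det og; exists b => h oh.
by rewrite -gA -mul_first_rows (wedge_spin_mx (orthM og oh)) det_mulmx db.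
Qed.

End Isotropic.

(** * The split basis and the eigenspaces W_+ and W_- *)

Section SplitBasis.
Variables (F0 : fieldType) (pi0 : F0) (F : fieldExtType F0) (pi : F) (n : nat).
Hypothesis pi_sqr : pi ^+ 2 = - pi0%:A.
Hypothesis pi0_neq0 : pi0 != 0.
Hypothesis two_neq0 : (2%:R : F) != 0.

(** From pi^2 = - pi0, the vectors f_1 + pi f_2 and f_1 - pi f_2 are isotropic and pair to 2 pi0,
    which explains the denominator in the basis. *)
Lemma split_basis_gram :
  split_basis pi0 pi n *m map_mx (in_alg F) (gram pi0 n) *m (split_basis pi0 pi n)^T =
  antidiag F _.
Proof.
have A0 : (pi0%:A : F) != 0 by rewrite scaler_eq0 negb_or pi0_neq0 oner_neq0.
pose G := map_mx (in_alg F) (gram pi0 n).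
pose e := e_vec F n.
pose B (x y : 'rV[F]_(dimV n)) := (x *m G *m y^T) 0 0.
have BDl x y z : B (x + y) z = B x z + B y z by rewrite /B !mulmxDl mxE.
have BDr x y z : B x (y + z) = B x y + B x z by rewrite /B linearD mulmxDr mxE.
have BZl c x y : B (c *: x) y = c * B x y by rewrite /B -!scalemxAl mxE.
have BZr c x y : B x (c *: y) = c * B x y by rewrite /B linearZ -scalemxAr mxE.
have BNl x y : B (- x) y = - B x y by rewrite /B !mulNmx mxE.
have BNr x y : B x (- y) = - B x y by rewrite /B linearN mulmxN mxE.
pose gv (a b : nat) : F := (if (a < 2 * n)%N && (b < 2 * n)%N then
    (a + b == 2 * n - 1)%N%:R
    else if a == b then (if a == (2 * n)%N then pi0 else 1) else 0)%:A.
have Be a b : (a < dimV n)%N -> (b < dimV n)%N -> B (e a) (e b) = gv a b.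
  move=> an bn.
  have ed c (lt : (c < dimV n)%N) : e c = delta_mx 0 (Ordinal lt).
    by apply/rowP => k; rewrite !mxE.
  by rewrite /B (ed _ an) (ed _ bn) -rowE trmx_delta -colE !mxE.
have gv0 a b : (a < 2 * n <= b)%N -> gv a b = 0.
  move=> h; rewrite /gv (_ : _ && _ = false); last by lia.
  by rewrite (_ : (a == b) = false) ?scale0r //; lia.
have gv0' a b : (b < 2 * n <= a)%N -> gv a b = 0.
  move=> h; rewrite /gv (_ : _ && _ = false); last by lia.
  by rewrite (_ : (a == b) = false) ?scale0r //; lia.
have gv1 a b : (a < 2 * n)%N -> (b < 2 * n)%N -> gv a b = (a + b == 2 * n - 1)%N%:R.
  by move=> h1 h2; rewrite /gv h1 h2 scaler_nat.
have g11 : gv (2 * n)%N (2 * n)%N = pi0%:A by rewrite /gv ltnn !eqxx.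
have g22 : gv (2 * n).+1 (2 * n).+1 = 1.
  by rewrite /gv ltnNge leqnSn /= eqxx (_ : (_ == _) = false) ?scale1r //; lia.
have g12 : gv (2 * n)%N (2 * n).+1 = 0.
  by rewrite /gv ltnn /= (_ : (_ == _) = false) ?scale0r //; lia.
have g21 : gv (2 * n).+1 (2 * n)%N = 0.
  by rewrite /gv ltnn andbF /= (_ : (_ == _) = false) ?scale0r //; lia.
have ge1 a : (a < 2 * n)%N -> gv a (2 * n)%N = 0 by move=> h; apply: gv0; lia.
have ge2 a : (a < 2 * n)%N -> gv a (2 * n).+1 = 0 by move=> h; apply: gv0; lia.
have g1e a : (a < 2 * n)%N -> gv (2 * n)%N a = 0 by move=> h; apply: gv0'; lia.
have g2e a : (a < 2 * n)%N -> gv (2 * n).+1 a = 0 by move=> h; apply: gv0'; lia.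
have lt1 : (2 * n < dimV n)%N by lia.
have lt2 : ((2 * n).+1 < dimV n)%N by lia.
have d0 : (pi0%:A : F) *+ 2 != 0 by rewrite -mulr_natr mulf_neq0.
apply/matrixP => k l.
have -> : (split_basis pi0 pi n *m G *m (split_basis pi0 pi n)^T) k l =
    B (row k (split_basis pi0 pi n)) (row l (split_basis pi0 pi n)).
  rewrite /B -row_mul tr_row -[RHS]/((_ *m _) 0 0) -row_mul !mxE.
  by apply: eq_bigr => b _; rewrite !mxE.
rewrite !rowK !mxE -/e /f1_vec /f2_vec -/e -val_eqE /=.
have := ltn_ord k; have := ltn_ord l; move: (val k) (val l) => {}k {}l hl hk.
have fal (b : bool) : ~~ b -> 0 = b%:R :> F by case: b.
have tru (b : bool) : b -> 1 = b%:R :> F by case: b.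
have eqb (b c : bool) : b = c -> b%:R = c%:R :> F by move=> ->.
case: (ltnP k n) => k1; last case: (eqVneq k n) => k2;
  last case: (eqVneq k n.+1) => k3; (case: (ltnP l n) => l1;
  last case: (eqVneq l n) => l2; last case: (eqVneq l n.+1) => l3);
  rewrite ?(BDl, BNl, BZl, BDr, BNr, BZr) ?Be ?g11 ?g12 ?g21 ?g22; try lia;
  rewrite ?ge1 ?ge2 ?g1e ?g2e ?gv1; try lia;
  rewrite ?(mulr0, oppr0, addr0, mulr1, mulrN, mulNr, add0r);
  try (by apply: fal; lia); try (by apply: eqb; lia).
- by rewrite -expr2 pi_sqr subrr; apply: fal; lia.
- rewrite mulrCA -expr2 pi_sqr mulrN opprK -mulrDr -mulr2n mulVf //.
  by apply: tru; lia.
- rewrite mulrCA -expr2 pi_sqr mulrN opprK -mulrDr -mulr2n mulVf //.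
  by apply: tru; lia.
- rewrite mulrCA -expr2 pi_sqr mulrN !opprK subrr mulr0.
  by apply: fal; lia.
Qed.

Lemma split_basis_unit : split_basis pi0 pi n \in unitmx.
Proof.
have := congr1 (mulmx^~ (antidiag F _)) split_basis_gram.
by rewrite /= antidiagK -!mulmxA => /mulmx1_unit[].
Qed.

Lemma W_spin_eigen eps c :
  c *m spin_mx F n = sgn_bool F eps *: c ->
  W_spin pi0 pi eps (c *m ext_mx n.+1 (split_basis pi0 pi n)).
Proof.
move=> hc; pose T := ext_mx n.+1 (split_basis pi0 pi n).
have sumE (d : 'rV_(extdim (dimV n) n.+1)) (f : rsub (dimV n) n.+1 -> rsub (dimV n) n.+1) :
    \sum_S d 0 (enum_rank S) *: split_wedge pi0 pi (f S) =
    \sum_k d 0 k *: row (enum_rank (f (enum_val k))) T.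
  rewrite (reindex (enum_val : 'I_(extdim (dimV n) n.+1) -> rsub _ _)) /=; last first.
    exact/onW_bij/enum_val_bij.
  by apply: eq_bigr => k _; rewrite enum_valK rowK enum_rankK.
exists (fun S => c 0 (enum_rank S)); split.
  rewrite (sumE c id) mulmx_sum_row; apply: eq_bigr => k _.
  by rewrite enum_valK.
rewrite -/T scalemxAl -hc -mulmxA mulmx_sum_row.
rewrite (reindex (enum_val : 'I_(extdim (dimV n) n.+1) -> rsub _ _)) /=; last first.
  exact/onW_bij/enum_val_bij.
apply: eq_bigr => k _; rewrite enum_valK; congr (_ *: _).
rewrite row_mul mulmx_sum_row (bigD1 (enum_rank (perp (enum_val k)))) //= big1 ?addr0.
  by rewrite !mxE enum_rankK eqxx mulr1 rowK enum_rankK.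
move=> l; rewrite !mxE => lk; case: eqP => [e1|_]; last by rewrite mulr0 scale0r.
by case/eqP: lk; rewrite e1 enum_valK.
Qed.

End SplitBasis.

Lemma clear_denominators (F : fieldType) (w : dval F) (pi : F) k l (M : 'M[F]_(k, l)) :
  uniformizer w pi ->
  exists2 d : F, d != 0 & exists M' : 'M[valring w]_(k, l), map_mx val M' = d *: M.
Proof.
move=> piP; have [p0 _] := piP.
(* A crude bound: the sum dominates the absolute valuation of every entry. *)
pose m := (\sum_(p : 'I_k * 'I_l) `|w (M p.1 p.2)|)%N.
exists (pi ^+ m); first by rewrite expf_neq0.
have h a b : pi ^+ m * M a b \in in_valring w.
  rewrite unfold_in /val_ge; case: (eqVneq (M a b) 0) => [->|x0].
    by rewrite mulr0 eqxx.
  rewrite dvalM ?expf_neq0 // (uniformizerX piP).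
  have le : (`|w (M a b)| <= m)%N by rewrite /m (bigD1 (a, b)) //= leq_addr.
  by apply/orP; right; move: le; case: (w (M a b)) => j; lia.
exists (\matrix_(a, b) ValRing (h a b)); apply/matrixP => a b.
by rewrite [LHS]mxE [X in val X]mxE mxE.
Qed.

Lemma map_spin_mx (R R' : pzRingType) (f : {rmorphism R -> R'}) n :
  map_mx f (spin_mx R n) = spin_mx R' n.
Proof. by apply/matrixP => x y; rewrite !mxE rmorphM rmorph_nat rmorphXn rmorphN1. Qed.

Section SpinMember.
Variables (F0 : fieldType) (v : dval F0) (pi0 : F0).
Variables (F : fieldExtType F0) (w : dval F) (pi : F) (n i : nat).
Hypothesis piP : uniformizer w pi.
Hypothesis split_unit : split_basis pi0 pi n \in unitmx.

Variables (R : comPzRingType) (L : fieldType).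
Variables (s : {rmorphism valring w -> R}) (g : {rmorphism R -> L}).
Variable gF : {rmorphism F -> L}.
Hypothesis g_inj : injective g.
Hypothesis gs : forall a, g (s a) = gF (val a).
Hypothesis s_ker : kernel_generated s.

Definition lat_ext (Lc : chain) : 'M[F]_(dimV n) :=
  map_mx (in_alg F) (lat_basis pi0 n i Lc).

(* Coordinates of a frame of [Lc] (x) [L] on the split basis [e'] of [V]. *)
Definition split_coord (Lc : chain) : 'M[L]_(dimV n) :=
  map_mx gF (lat_ext Lc *m invmx (split_basis pi0 pi n)).

Definition spin_eigen (eps : bool) (B : 'M[L]_(n.+1, dimV n)) : Prop :=
  wedge B *m spin_mx L n = gF (sgn_bool F eps) *: wedge B.

Lemma spin_eigen_mull eps u B : spin_eigen eps B -> spin_eigen eps (u *m B).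
Proof.
by rewrite /spin_eigen => hB; rewrite !wedge_mull -scalemxAl hB scalerA mulrC -scalerA.
Qed.

Lemma spin_eigen_cancel eps u B W : u *m B *m W = 1%:M ->
  spin_eigen eps (u *m B) -> spin_eigen eps B.
Proof.
rewrite -mulmxA => /mulmx1_unit[uu _] h.
by rewrite -[B](mulKmx uu); apply: spin_eigen_mull.
Qed.

(** The lattice intersected with W is the kernel of a matrix over F, and of [M] over the valuation
    ring once denominators are cleared. The eigenvector equation over L says that [M] kills the
    wedge there, hence over R by injectivity of [g], and [s_ker] writes the wedge through elements
    of the lattice. *)
Lemma spin_member eps Lc (A : 'M[R]_(n.+1, dimV n)) :
  spin_eigen eps (map_mx g A *m split_coord Lc) ->
  base_change s (lattice_W (w := w) pi0 pi i eps Lc) (wedge A).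
Proof.
pose T := split_basis pi0 pi n.
pose Ex := ext_mx n.+1 (lat_ext Lc).
pose Ti := ext_mx n.+1 (invmx T).
pose K := Ex *m Ti *m (spin_mx F n - (sgn_bool F eps)%:M).
have [d d0 [M ME]] := clear_denominators K piP.
move=> eig.
have [k [h [a [hG ->]]]] : base_change s [set c | c *m M = 0] (wedge A).
  apply: s_ker; suff e : map_mx g (wedge A *m map_mx s M) = 0.
    apply/rowP => j; apply: g_inj; move/rowP/(_ j): e.
    by rewrite [in LHS]mxE => ->; rewrite !mxE rmorph0.
  rewrite map_mxM map_wedge -map_mx_comp.
  have -> : map_mx (g \o s) M = gF d *: map_mx gF K.
    rewrite -map_mxZ -ME -map_mx_comp; apply/matrixP => x y; rewrite !mxE /=.
    exact: gs.
  rewrite -scalemxAr /K map_mxM mulmxA.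
  have -> : wedge (map_mx g A) *m map_mx gF (Ex *m Ti) =
      wedge (map_mx g A *m split_coord Lc).
    by rewrite -ext_mx_mul map_ext_mx -wedge_mul.
  have -> : map_mx gF (spin_mx F n - (sgn_bool F eps)%:M) =
      spin_mx L n - (gF (sgn_bool F eps))%:M.
    by rewrite map_mxB map_scalar_mx (map_spin_mx gF).
  by rewrite mulmxBr eig mul_mx_scalar subrr scaler0.
exists k, h, a; split=> // j; have [c /= cM <-] := hG j; exists c => //.
rewrite /lattice_W /=.
have -> : map_mx val c *m Ex =
    (map_mx val c *m Ex *m Ti) *m ext_mx n.+1 T.
  by rewrite -[RHS]mulmxA -ext_mx_mul mulVmx // ext_mx1 mulmx1.
apply: W_spin_eigen; have := congr1 (map_mx val) cM.
rewrite map_mxM ME map_mx0 -scalemxAr => /eqP; rewrite scaler_eq0 (negPf d0) /=.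
by rewrite /K !mulmxA mulmxBr mul_mx_scalar subr_eq0 => /eqP.
Qed.

End SpinMember.

Section MapPairs.
Variables (R R' : comPzRingType) (f : {rmorphism R -> R'}).

Lemma map_gram_block p q : map_mx f (gram_block R p q) = gram_block R' p q.
Proof. by rewrite map_block_mx !map_mx0 !map_antidiag. Qed.

Lemma map_scale_block p q x y :
  map_mx f (scale_block p q x y) = scale_block p q (f x) (f y).
Proof. by rewrite map_block_mx !map_mx0 !map_scalar_mx. Qed.

Lemma map_pairing n : map_mx f (pairing n R) = pairing n R'.
Proof. by apply/matrixP => a b; rewrite !mxE rmorph_nat. Qed.

Lemma map_scale_V n i x y : map_mx f (scale_V n i x y) = scale_V n i (f x) (f y).
Proof. by apply/matrixP => a b; rewrite !mxE rmorphMn /=; case: ifP. Qed.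

Lemma map_embed_mx n i (le : (i <= n)%N) :
  map_mx f (embed_mx le R) = embed_mx le R'.
Proof. by apply/matrixP => a b; rewrite !mxE rmorph_nat. Qed.

Lemma map_block_pair p q k c (E E' : 'M_(k, p + q)) :
  block_pair c E E' -> block_pair (f c) (map_mx f E) (map_mx f E').
Proof.
move=> [[W hW] [W' hW'] EE [H hH] [H' hH']]; split.
- by exists (map_mx f W); rewrite -map_mxM hW map_mx1.
- by exists (map_mx f W'); rewrite -map_mxM hW' map_mx1.
- by rewrite -map_gram_block map_trmx -!map_mxM EE map_mx0.
- by exists (map_mx f H); rewrite -(rmorph1 f) -map_scale_block -!map_mxM hH.
- by exists (map_mx f H'); rewrite -(rmorph1 f) -map_scale_block -!map_mxM hH'.
Qed.

Lemma map_naive_pair n i k c (A A' : 'M_(k, dimV n)) :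
  naive_pair i c A A' -> naive_pair i (f c) (map_mx f A) (map_mx f A').
Proof.
move=> [[W hW] [W' hW'] EE [H hH] [H' hH']]; split.
- by exists (map_mx f W); rewrite -map_mxM hW map_mx1.
- by exists (map_mx f W'); rewrite -map_mxM hW' map_mx1.
- by rewrite -map_pairing map_trmx -!map_mxM EE map_mx0.
- by exists (map_mx f H); rewrite -(rmorph1 f) -map_scale_V -!map_mxM hH.
- by exists (map_mx f H'); rewrite -(rmorph1 f) -map_scale_V -!map_mxM hH'.
Qed.

Lemma map_orth_pair p q (M : 'M_(p + q)) : orth_pair M -> orth_pair (map_mx f M).
Proof.
move=> oM; have Mi := orth_pair_inv oM; case: oM => gM sM; split.
  by rewrite -map_gram_block map_trmx -!map_mxM gM.
(* The scalars of R' need not come from R, but all scalings are combinations of the identity and the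
   projector onto the first block. *)
have b0 : map_mx f M *m scale_block p q 1 0 = scale_block p q 1 0 *m map_mx f M.
  by rewrite -(rmorph1 f) -(rmorph0 f) -map_scale_block -!map_mxM sM.
have sE x y : scale_block p q x y =
    y%:M + (x - y) *: scale_block p q 1 (0 : R').
  rewrite (scalar_mx_block p q y) scale_block_mx !scaler0 add_block_mx !addr0.
  rewrite !scale_scalar_mx mulr1 mulr0 -!raddfD /= addr0.
  by rewrite (addrC y) subrK.
move=> x y; rewrite sE mulmxDr mulmxDl mul_mx_scalar mul_scalar_mx.
by rewrite -scalemxAr b0 scalemxAl.
Qed.

End MapPairs.

Section Reflection.
Variables (R : comPzRingType) (m : nat).

Definition reflection_mx : 'M[R]_(odim m) :=
  diag_mx (\row_k if k == m :> nat then -1 else 1).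

Lemma orth_reflection : orth reflection_mx.
Proof.
rewrite /orth tr_diag_mx mul_mx_diag mul_diag_mx; apply/matrixP => a b.
rewrite !mxE; case: (eqVneq b (rev_ord a)) => [->|_]; last by rewrite mulr0 mul0r.
have := odimE m; have := ltn_ord a; rewrite /= => ha e.
rewrite (_ : (odim m - a.+1 == m)%N = (a == m :> nat)); last by lia.
by case: ifP => _; rewrite mulr1 ?mulrNN mulr1.
Qed.

Lemma det_reflection : \det reflection_mx = -1.
Proof.
have lt : (m < odim m)%N by rewrite odimE; lia.
rewrite det_diag (bigD1 (Ordinal lt)) //= mxE eqxx big1 ?mulr1 // => k.
by rewrite -val_eqE /= mxE => /negPf->.
Qed.

Lemma pid_reflection r : (r <= m)%N ->
  (pid_mx r : 'M[R]_(r, _)) *m reflection_mx = pid_mx r.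
Proof.
move=> rm; rewrite mul_mx_diag; apply/matrixP => a b; rewrite !mxE.
case: (eqVneq (a : nat) b) => [ab|_]; last by rewrite mul0r.
by rewrite -ab; have := ltn_ord a; case: eqP => [->|_ _]; [lia | rewrite mulr1].
Qed.

End Reflection.

Lemma det_conj_rect (R : comPzRingType) N N' (B : 'M[R]_(N, N')) Bi (M : 'M[R]_N) :
  N = N' -> B *m Bi = 1%:M -> \det (Bi *m M *m B) = \det M.
Proof.
move=> e; case: _ / e in B Bi * => BBi.
by rewrite !det_mulmx mulrAC -det_mulmx (mulmx1C BBi) det1 mul1r.
Qed.

(** * The sign of a frame on the generic fibre *)

Section GenericSpin.
Variables (F0 : fieldType) (pi0 : F0) (F : fieldExtType F0) (pi : F) (n i : nat).
Hypothesis i_le_n : (i <= n)%N.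
Hypothesis pi_sqr : pi ^+ 2 = - pi0%:A.
Hypothesis pi0_neq0 : pi0 != 0.
Hypothesis two_neq0 : (2%:R : F) != 0.
Variables (L : fieldType) (gF : {rmorphism F -> L}) (half : L).
Hypothesis halfP : half + half = 1.

Local Notation T := (split_basis pi0 pi n).
Local Notation lat := (lat_ext pi0 F n i).
Local Notation S := (split_coord pi0 pi n i gF).
Local Notation c := (gF pi0%:A).
Local Notation eigen := (@spin_eigen F0 F n L gF).

Let pi0A : (pi0%:A : F) != 0.
Proof. by rewrite scaler_eq0 negb_or pi0_neq0 oner_neq0. Qed.

Let Tunit : T \in unitmx. Proof. exact: split_basis_unit. Qed.

Let c_neq0 : c != 0. Proof. by rewrite fmorph_eq0. Qed.

Lemma lat_ext_shift d b : lat (d, b) = (pi0 ^ - d)%:A *: lat (0, b).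
Proof.
rewrite /lat_ext; apply/matrixP => x y; rewrite !mxE.
case: (x == y); last by rewrite !mulr0n !rmorph0 mulr0.
by rewrite !mulr1n !in_algE mulr_algl scalerA -expfzDr // /lat_exp /= oppr0 add0r.
Qed.

Lemma split_coord_shift d b : S (d, b) = gF (pi0 ^ - d)%:A *: S (0, b).
Proof. by rewrite /split_coord lat_ext_shift -scalemxAl map_mxZ. Qed.

Lemma lat_ext_dual :
  lat (0, true) = (pi0^-1)%:A *: (scale_V n i 1 pi0%:A *m lat (0, false)).
Proof.
rewrite /lat_ext mul_diag_mx; apply/matrixP => x y; rewrite !mxE.
case: (eqVneq x y) => [->|_]; last by rewrite !mulr0n !rmorph0 !mulr0.
rewrite !mulr1n.
have e : pi0 ^ lat_exp n i (0, true) y =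
    pi0^-1 * ((if in_P n i y then 1 else pi0) * pi0 ^ lat_exp n i (0, false) y).
  have -> : (if in_P n i y then 1 else pi0) = pi0 ^ (if in_P n i y then 0 else 1).
    by case: ifP; rewrite ?expr0z ?expr1z.
  rewrite -(exprN1 pi0) -!expfzDr //; congr (_ ^ _).
  by rewrite /lat_exp /in_P /=; have := ltn_ord y; case: ifP; lia.
rewrite !in_algE e mulr_algl -scalerA; congr (_ *: _); case: ifP => _; first by rewrite !mul1r.
by rewrite mulr_algl scalerA.
Qed.

Lemma split_coord_dual : S (0, true) = c^-1 *: (scale_V n i 1 c *m S (0, false)).
Proof.
rewrite /split_coord lat_ext_dual -scalemxAl map_mxZ -mulmxA map_mxM map_scale_V.
rewrite rmorph1; congr (_ *: _).
have : c * gF (pi0^-1)%:A = 1.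
  by rewrite -rmorphM mulr_algl scalerA mulfV // scale1r rmorph1.
by move=> e; rewrite -[LHS]mul1r -(mulVf c_neq0) -mulrA e mulr1.
Qed.

Lemma split_coord_unit Lc : S Lc \in unitmx.
Proof.
rewrite /split_coord map_unitmx unitmx_mul unitmx_inv Tunit andbT.
rewrite /lat_ext map_unitmx unitmxE det_diag unitfE prodf_seq_neq0.
by apply/allP => a _ /=; rewrite mxE expfz_neq0.
Qed.

(** The Gram matrix of the basis of Lambda_i, obtained from the perfect pairing with Lambda_-i by
    rescaling one of the two bases. *)
Lemma split_coord_form :
  S (0, true) *m antidiag L _ *m (S (0, true))^T =
  c^-1 *: (pairing n L *m scale_V n i 1 c).
Proof.
have -> : antidiag L (dimV n) = map_mx gF (antidiag F _) by rewrite map_antidiag.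
rewrite -(split_basis_gram n pi_sqr pi0_neq0 two_neq0).
have -> : S (0, true) *m map_mx gF (T *m map_mx (in_alg F) (gram pi0 n) *m T^T) *m
    (S (0, true))^T =
    map_mx gF (lat (0, true) *m map_mx (in_alg F) (gram pi0 n) *m (lat (0, true))^T).
  rewrite /split_coord; move: (map_mx (in_alg F) (gram pi0 n)) (lat _) => G X.
  rewrite map_trmx -!map_mxM; congr (map_mx gF _).
  rewrite trmx_mul !mulmxA mulmxKV //.
  by rewrite -!mulmxA (mulmxA T^T) -trmx_mul mulVmx // trmx1 mul1mx.
have -> : lat (0, true) *m map_mx (in_alg F) (gram pi0 n) *m (lat (0, true))^T =
    (pi0^-1)%:A *: (pairing n F *m scale_V n i 1 pi0%:A).
  rewrite {2}lat_ext_dual linearZ /= -scalemxAr trmx_mul mulmxA; congr (_ *: _).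
  rewrite /scale_V tr_diag_mx; congr (_ *m _).
  have e : chain_dual (0, true) = (0, false) :> chain by rewrite /chain_dual oppr0.
  have := perfect_pairing pi0_neq0 i_le_n (0, true); rewrite e => pp.
  rewrite /lat_ext map_trmx -!map_mxM pp; apply/matrixP => a b.
  by rewrite !mxE rmorph_nat.
rewrite map_mxZ map_mxM map_pairing map_scale_V rmorph1; congr (_ *: _).
have e : c * gF (pi0^-1)%:A = 1.
  by rewrite -rmorphM mulr_algl scalerA mulfV // scale1r rmorph1.
by rewrite -[LHS]mul1r -(mulVf c_neq0) -mulrA e mulr1.
Qed.

(** With pi0 invertible all members of the chain give the same subspace of V, and the eigenvector
    condition depends only on this subspace, so one lattice suffices. *)
Lemma spin_eigen_chain eps (A A' : 'M[L]_(n.+1, dimV n)) :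
  naive_pair i c A A' -> eigen eps (A *m S (0, true)) ->
  forall Lc : chain, eigen eps ((if Lc.2 then A else A') *m S Lc).
Proof.
move=> [[W AW] _ _ [H AH] _] eA.
have eA' : eigen eps (A' *m S (0, false)).
  apply: (@spin_eigen_cancel _ _ _ _ _ _ (c^-1 *: H) _ (invmx (S (0, true)) *m W)).
    have -> : c^-1 *: H *m (A' *m S (0, false)) = A *m S (0, true).
      by rewrite split_coord_dual -scalemxAr !mulmxA AH -!scalemxAl.
    by rewrite mulmxA mulmxK // split_coord_unit.
  have -> : c^-1 *: H *m (A' *m S (0, false)) = A *m S (0, true).
    by rewrite split_coord_dual -scalemxAr !mulmxA AH -!scalemxAl.
  exact: eA.
move=> [d b]; rewrite split_coord_shift -scalemxAr -mul_scalar_mx.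
by apply: spin_eigen_mull; case: b.
Qed.

Local Notation B := (embed_mx i_le_n L *m S (0, true)).
Local Notation p := (odim i).
Local Notation q := (odim (n - i)).

Let Bi := invmx (S (0, true)) *m (embed_mx i_le_n L)^T.

Let BBi : B *m Bi = 1%:M.
Proof. by rewrite mulmxA mulmxK ?split_coord_unit // embed_mulV. Qed.

Let B_form : B *m antidiag L _ *m B^T =
  c^-1 *: (gram_block L p q *m scale_block p q 1 c).
Proof.
rewrite trmx_mul !mulmxA -(mulmxA _ (S _)) -(mulmxA (embed_mx _ _)) -(mulmxA (embed_mx _ _)).
rewrite mulmxA split_coord_form -scalemxAr -scalemxAl; congr (_ *: _).
have e : scale_V n i 1 c *m (embed_mx i_le_n L)^T =
    (embed_mx i_le_n L)^T *m scale_block p q 1 c.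
  have := congr1 trmx (embed_scale i_le_n 1 c).
  by rewrite !trmx_mul tr_diag_mx tr_block_mx !tr_scalar_mx !trmx0.
by rewrite -!mulmxA e !mulmxA embed_pairing.
Qed.

(** [E] spans an isotropic space in split coordinates, because its image under the scaling lies in
    the span of [E'], which is orthogonal to [E]. The sign [b] belongs to [E] alone, and a block
    isometry changes it by its determinant. The cast is there because [k] equals n+1 only
    propositionally. *)
Lemma frame_sign k (E E' : 'M[L]_(k, p + q)) (ek : k = n.+1) :
  block_pair c E E' ->
  exists b : bool, forall M : 'M_(p + q), orth_pair M ->
    (exists b' : bool, \det M = (-1) ^+ b') /\
    forall eps, \det M * (-1) ^+ b = gF (sgn_bool F eps) ->
    eigen eps (castmx (ek, erefl) (E *m M *m embed_mx i_le_n L) *m S (0, true)).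
Proof.
subst k; move=> [[W EW] _ EE [H EH] _].
have AW : E *m B *m (Bi *m W) = 1%:M by rewrite mulmxA -(mulmxA E) BBi mulmx1.
have AA : E *m B *m antidiag L _ *m (E *m B)^T = 0.
  rewrite (trmx_mul E) !mulmxA.
  have -> : E *m embed_mx i_le_n L *m S (0, true) *m antidiag L _ *m B^T *m E^T =
    E *m (B *m antidiag L _ *m B^T) *m E^T by rewrite !mulmxA.
  rewrite B_form -scalemxAr -scalemxAl.
  have -> : E *m (gram_block L p q *m scale_block p q 1 c) *m E^T =
     E *m gram_block L p q *m (E *m scale_block p q 1 c)^T.
    by rewrite trmx_mul tr_block_mx !tr_scalar_mx !trmx0 !mulmxA.
  by rewrite EH trmx_mul mulmxA EE mul0mx scaler0.
have [b hb] := isotropic_sign halfP AW AA; exists b => M [gM sM].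
(* The isometry [M] in split coordinates. It is orthogonal because the form there is the block form
   rescaled, and [M] commutes with the rescaling. *)
pose h := Bi *m M *m B.
have dh : \det h = \det M by apply: det_conj_rect BBi; exact: odim_sum.
have oh : orth h.
  rewrite /orth.
  have -> : h *m antidiag L _ *m h^T =
      Bi *m (M *m (B *m antidiag L _ *m B^T) *m M^T) *m Bi^T.
    by rewrite /h !trmx_mul !mulmxA.
  have -> : M *m (B *m antidiag L _ *m B^T) *m M^T = B *m antidiag L _ *m B^T.
    rewrite B_form -scalemxAr -scalemxAl; congr (_ *: _).
    have e : scale_block p q 1 c *m M^T = M^T *m scale_block p q 1 c.
      by have := congr1 trmx (sM 1 c); rewrite !trmx_mul tr_block_mx !tr_scalar_mx !trmx0.
    by rewrite -!mulmxA e !mulmxA gM.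
  have BiB : Bi *m B = 1%:M.
    have gen N N' (X : 'M[L]_(N, N')) Y : N = N' -> X *m Y = 1%:M -> Y *m X = 1%:M.
      by move=> e; case: _ / e in X Y * => /mulmx1C.
    exact: gen (odim_sum i_le_n) BBi.
  have -> : Bi *m (B *m antidiag L _ *m B^T) *m Bi^T =
      (Bi *m B) *m antidiag L _ *m (Bi *m B)^T by rewrite !trmx_mul !mulmxA.
  by rewrite BiB trmx1 mulmx1 mul1mx.
split; first by have [b' e] := orth_det oh; exists b'; rewrite -dh.
move=> eps deps; rewrite castmx_id.
have -> : E *m M *m embed_mx i_le_n L *m S (0, true) = E *m B *m h.
  by rewrite /h -[in RHS]mulmxA (mulmxA B) (mulmxA B) BBi mul1mx !mulmxA.
by rewrite /spin_eigen hb // dh mulrC deps.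
Qed.

End GenericSpin.

(** * Points over fields *)

Section Classification.
Variables (K : fieldType) (half : K).
Hypothesis halfP : half + half = 1.
Variables (n i : nat).
Hypothesis i_le_n : (i <= n)%N.

Local Notation p := (odim i).
Local Notation q := (odim (n - i)).
Local Notation G := (gram_block K p q).

Lemma gram_block_unit : G \in unitmx.
Proof. by case: (mulmx1_unit (gram_blockK K p q)). Qed.

Lemma tr_gram_block : G^T = G.
Proof. by rewrite tr_block_mx !tr_antidiag !trmx0. Qed.

(** By dimensions, [E] is the whole orthogonal complement of [E']. *)
Lemma sub_perp N k m (J : 'M[K]_N) (E E' : 'M[K]_(k, N)) W W' (X : 'M[K]_(m, N)) :
  J \in unitmx -> (k + k = N)%N -> E *m W = 1%:M -> E' *m W' = 1%:M ->
  E *m J *m E'^T = 0 -> X *m J *m E'^T = 0 -> (X <= E)%MS.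
Proof.
move=> uJ kk EW EW' EE XE.
have rE : \rank E = k by apply/eqP/row_freeP; exists W.
have rE' : \rank E' = k by apply/eqP/row_freeP; exists W'.
have sE : (E <= kermx (J *m E'^T))%MS by apply/sub_kermxP; rewrite mulmxA.
have rk : \rank (kermx (J *m E'^T)) = k.
  rewrite mxrank_ker (eqmxMfull E'^T) ?row_full_unit //.
  by rewrite mxrank_tr rE' -kk addnK.
have : (E == kermx (J *m E'^T))%MS.
  by rewrite -(geq_leqif (mxrank_leqif_eq sE)) rE rk.
by move/eqmxP => ->; apply/sub_kermxP; rewrite mulmxA.
Qed.

(** At c = 0 the P-part of [E] lies in [E'] and the Q-part of [E'] lies in [E], whence both parts
    are isotropic. The kernel of the projection from [E] to P is the orthogonal of the Q-part of
    [E'], so n + 1 - r = 2(n - i) + 1 - s, that is i - r = n - i - s. *)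
Lemma classify (E E' : 'M[K]_(n.+1, p + q)) : block_pair 0 E E' ->
  exists r s t (phi : 'M[K]_(r, s)) (UP : 'M[K]_p) (UQ : 'M[K]_q),
    [/\ (r + t = i)%N, (s + t = n - i)%N, liftable UP, liftable UQ &
        (E :=: frame_mx t p q 0 phi *m block_mx UP 0 0 UQ)%MS].
Proof.
move=> [[W EW] [W' EW'] EE [H EH] [H' EH']].
have kk : (n.+1 + n.+1 = p + q)%N by rewrite !odimE; lia.
pose EP := lsubmx E; pose EQ := rsubmx E.
pose E'P := lsubmx E'; pose E'Q := rsubmx E'.
have EPQ : E = row_mx EP EQ by rewrite hsubmxK.
have E'PQ : E' = row_mx E'P E'Q by rewrite hsubmxK.
have EP0 : row_mx EP 0 = H *m E'.
  rewrite -EH EPQ /scale_block mul_row_block !mulmx0 addr0 add0r mulmx1.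
  by rewrite mul_mx_scalar scale0r.
have EQ0 : row_mx 0 E'Q = H' *m E.
  rewrite -EH' E'PQ /scale_block mul_row_block !mulmx0 addr0 add0r mulmx1.
  by rewrite mul_mx_scalar scale0r.
have E'E : E' *m G *m E^T = 0.
  by have := congr1 trmx EE; rewrite !trmx_mul trmxK tr_gram_block trmx0 mulmxA.
have isoP : EP *m antidiag K _ *m EP^T = 0.
  have : E *m G *m (row_mx EP 0)^T = 0 by rewrite EP0 trmx_mul mulmxA EE mul0mx.
  by rewrite EPQ tr_row_mx mul_row_block mul_row_col !mulmx0 !addr0 trmx0 mulmx0 addr0.
have isoQ : E'Q *m antidiag K _ *m E'Q^T = 0.
  have : E' *m G *m (row_mx 0 E'Q)^T = 0 by rewrite EQ0 trmx_mul mulmxA E'E mul0mx.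
  by rewrite E'PQ tr_row_mx mul_row_block mul_row_col !mulmx0 !add0r trmx0 mulmx0 add0r.
have base m N (X : 'M[K]_(m, N)) : X *m antidiag K _ *m X^T = 0 ->
    row_base X *m antidiag K _ *m (row_base X)^T = 0.
  move=> iX; have /submxP[D ->] : (row_base X <= X)%MS by rewrite eq_row_base.
  by rewrite trmx_mul !mulmxA -(mulmxA D) -(mulmxA D) iX mulmx0 mul0mx.
pose r : nat := \rank EP; pose s : nat := \rank E'Q.
have [rle [TP [UP [uTP lUP EPE]]]] :=
  witt_liftable halfP (row_base_free EP) (base _ _ _ isoP).
have [sle [TQ [UQ [uTQ lUQ EQE]]]] :=
  witt_liftable halfP (row_base_free E'Q) (base _ _ _ isoQ).
have oUP := liftable_orth halfP lUP; have oUQ := liftable_orth halfP lUQ.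
have eP : (EP :=: (pid_mx r : 'M_(r, _)) *m UP)%MS.
  apply: eqmx_trans (eqmx_sym (eq_row_base EP)) _; rewrite EPE -mulmxA.
  by apply: eqmxMfull; rewrite row_full_unit.
have eQ : (E'Q :=: (pid_mx s : 'M_(s, _)) *m UQ)%MS.
  apply: eqmx_trans (eqmx_sym (eq_row_base E'Q)) _; rewrite EQE -mulmxA.
  by apply: eqmxMfull; rewrite row_full_unit.
have subQ m (X : 'M[K]_(m, q)) : X *m antidiag K _ *m ((pid_mx s : 'M_(s, _)) *m UQ)^T = 0 ->
    (row_mx 0 X <= E)%MS.
  move=> X0; have XQ : X *m antidiag K _ *m E'Q^T = 0.
    have /submxP[D ->] : (E'Q <= (pid_mx s : 'M_(s, _)) *m UQ)%MS by rewrite eQ.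
    by rewrite trmx_mul mulmxA X0 mul0mx.
  apply: (sub_perp gram_block_unit kk EW EW' EE).
  by rewrite E'PQ tr_row_mx !(mul_row_block, mul_row_col, mul0mx, mulmx0, addr0, add0r) XQ.
have ranks : (n.+1 - r = q - s)%N.
  pose B : 'M[K]_(p + q, p) := col_mx 1%:M 0.
  have EB : E *m B = EP by rewrite EPQ mul_row_col mulmx1 mulmx0 addr0.
  have := mxrank_mul_ker E B; rewrite EB.
  have rE : \rank E = n.+1 by apply/eqP/row_freeP; exists W.
  rewrite rE => <-; rewrite -/r addKn.
  have e : (E :&: kermx B :=: kermx (antidiag K _ *m E'Q^T) *m row_mx 0 1%:M)%MS.
    apply/eqmxP/andP; split; last first.
      rewrite mul_mx_row mulmx0 mulmx1 sub_capmx; apply/andP; split.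
        apply: (sub_perp gram_block_unit kk EW EW' EE).
        rewrite E'PQ tr_row_mx.
        rewrite !(mul_row_block, mul_row_col, mul0mx, mulmx0, addr0, add0r).
        by rewrite -mulmxA mulmx_ker.
      by apply/sub_kermxP; rewrite mul_row_col mul0mx mulmx0 addr0.
    apply/rV_subP => x; rewrite sub_capmx => /andP[/submxP[u xE] /sub_kermxP xB].
    have xE0 : x = row_mx 0 (rsubmx x).
      rewrite -{1}[x]hsubmxK; congr row_mx.
      by move: xB; rewrite -{1}[x]hsubmxK mul_row_col mulmx1 mulmx0 addr0.
    have : (rsubmx x <= kermx (antidiag K _ *m E'Q^T))%MS.
      apply/sub_kermxP; rewrite mulmxA.
      have : x *m G *m E'^T = 0 by rewrite xE -!mulmxA (mulmxA E) EE mulmx0.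
      by rewrite {1}xE0 E'PQ tr_row_mx !(mul_row_block, mul_row_col, mul0mx, mulmx0, addr0, add0r).
    case/submxP => D e; rewrite xE0 e; apply/submxP; exists D.
    by rewrite mulmxA mul_mx_row mulmx0 mulmx1.
  rewrite e mxrankMfree; last first.
    by apply/row_freeP; exists (col_mx 0 1%:M); rewrite mul_row_col mul0mx add0r mulmx1.
  rewrite mxrank_ker (eqmxMfull E'Q^T) ?mxrank_tr // row_full_unit.
  by case: (mulmx1_unit (antidiagK K q)).
pose t := (i - r)%N.
have rt : (r + t = i)%N by rewrite /t; lia.
have st : (s + t = n - i)%N by move: ranks; rewrite /t odimE; lia.
have pE : p = (r + odim t + r)%N by rewrite !odimE; lia.
have qE : q = (s + odim t + s)%N by rewrite !odimE; lia.
have /submxP[u uE] : ((pid_mx r : 'M_(r, _)) *m UP <= EP)%MS by rewrite eP.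
pose Z := u *m EQ.
(* The standard vectors of P are lifted to [E], and their Q-parts [Z] are paired with the Q-part of
   [E']. What [phi] leaves out of [Z] is orthogonal to the latter and therefore lies in [E]. *)
pose phi : 'M[K]_(r, s) := Z *m antidiag K _ *m ((pid_mx s : 'M_(s, _)) *m UQ)^T.
exists r, s, t, phi, UP, UQ; split=> //.
have [q1 q2 q3 q4 q5] := frame_relations K qE.
have UQJ m m' (X : 'M_(m, q)) (Y : 'M_(m', q)) :
    X *m UQ *m antidiag K _ *m (Y *m UQ)^T = X *m antidiag K _ *m Y^T.
  by rewrite trmx_mul !mulmxA -(mulmxA X) -(mulmxA X) oUQ.
pose M := block_mx UP 0 0 UQ.
have oM : orth_pair M by apply: orth_pair_block.
have [[FW hFW] _ _ _ _] := block_pairM oM (frame_pair pE qE 0 phi).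
(* Both sides have dimension n+1, so one inclusion is enough. *)
have sub : (frame_mx t p q 0 phi *m M <= E)%MS.
  rewrite /frame_mx /M !mul_col_mx !mul_row_block !mulmx0 !addr0 !add0r.
  rewrite expr2 mul0r !scale0r !mul0mx.
  rewrite !col_mx_sub; apply/and3P; split.
  - have -> : row_mx (pid_mx r *m UP) (phi *m (pid_mx s *m antidiag K q) *m UQ) =
        u *m E - row_mx 0 (Z - phi *m (pid_mx s *m antidiag K q) *m UQ).
      rewrite EPQ mul_mx_row -uE opp_row_mx oppr0 add_row_mx addr0.
      by rewrite /Z opprB addrC subrK.
    rewrite addmx_sub ?submxMl // eqmx_opp; apply: subQ.
    rewrite !mulmxBl UQJ (mulmxA phi) -(mulmxA _ _ (antidiag K q)) antidiagK mulmx1.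
    by rewrite -(mulmxA phi) q1 mulmx1 subrr.
  - by apply: subQ; rewrite UQJ.
  - by apply: subQ; rewrite UQJ.
apply/eqmx_sym/eqmxP; rewrite -(geq_leqif (mxrank_leqif_eq sub)).
have -> : \rank E = n.+1 by apply/eqP/row_freeP; exists W.
have -> : \rank (frame_mx t p q 0 phi *m M) = (r + (s + odim t))%N.
  by apply/eqP/row_freeP; exists FW.
by rewrite odimE; lia.
Qed.

Local Notation emb := (embed_mx i_le_n K).

Lemma pairing_embed : pairing n K = emb^T *m G *m emb.
Proof.
rewrite -(embed_pairing i_le_n) !mulmxA embed_mulVT mul1mx.
by rewrite -mulmxA embed_mulVT mulmx1.
Qed.

Lemma pairing_unit : pairing n K \in unitmx.
Proof.
have : pairing n K *m pairing n K = 1%:M.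
  rewrite pairing_embed !mulmxA -(mulmxA _ emb) embed_mulV mulmx1.
  by rewrite -(mulmxA _ G G) gram_blockK mulmx1 embed_mulVT.
by case/mulmx1_unit.
Qed.

Lemma naive_pair_block k c (A A' : 'M[K]_(k, dimV n)) :
  naive_pair i c A A' -> block_pair c (A *m emb^T) (A' *m emb^T).
Proof.
have sc x y : emb^T *m scale_block p q x y = scale_V n i x y *m emb^T.
  have := congr1 trmx (embed_scale i_le_n x y).
  by rewrite !trmx_mul tr_diag_mx tr_block_mx !tr_scalar_mx !trmx0 => ->.
move=> [[W hW] [W' hW'] EE [H hH] [H' hH']]; split.
- by exists (emb *m W); rewrite mulmxA -(mulmxA A) embed_mulVT mulmx1.
- by exists (emb *m W'); rewrite mulmxA -(mulmxA A') embed_mulVT mulmx1.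
- rewrite trmx_mul trmxK !mulmxA -(mulmxA A) -(mulmxA A) -pairing_embed.
  exact: EE.
- by exists H; rewrite -mulmxA sc mulmxA hH mulmxA.
- by exists H'; rewrite -mulmxA sc mulmxA hH' mulmxA.
Qed.

(** The second member of a pair is the orthogonal complement of the first. *)
Lemma naive_pair_dual c (A A' B B' : 'M[K]_(n.+1, dimV n)) :
  naive_pair i c A A' -> naive_pair i c B B' -> (A :=: B)%MS -> (A' :=: B')%MS.
Proof.
have pT : (pairing n K)^T = pairing n K.
  apply/matrixP => a b; rewrite !mxE; congr (nat_of_bool _)%:R.
  by rewrite /pair_idx; lia.
have kk : (n.+1 + n.+1 = dimV n)%N by lia.
have dual (C C' : 'M[K]_(n.+1, dimV n)) : C *m pairing n K *m C'^T = 0 ->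
    C' *m pairing n K *m C^T = 0.
  by move=> e; have := congr1 trmx e; rewrite !trmx_mul trmxK pT trmx0 mulmxA.
have sub (C C' D D' : 'M[K]_(n.+1, dimV n)) :
    naive_pair i c C C' -> naive_pair i c D D' -> (D <= C)%MS -> (C' <= D')%MS.
  move=> [_ _ CC _ _] [[W DW] [W' DW'] DD _ _] /submxP[u uD].
  apply: (sub_perp pairing_unit kk DW' DW (dual _ _ DD)).
  by rewrite uD trmx_mul mulmxA (dual _ _ CC) mul0mx.
by move=> hA hB e; apply/eqmxP/andP; split; [apply: sub hA hB _ | apply: sub hB hA _]; rewrite e.
Qed.

End Classification.

(** Over a field some member of the cover is nonzero, and localizing at a nonzero element is an
    isomorphism, so the local basis descends. *)
Lemma summand_over_field (K : fieldType) m k (F : set 'rV[K]_m) :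
  is_submodule F ->
  zariski_locally (fun R' (f : {rmorphism K -> R'}) =>
    free_summand k (base_change f F)) ->
  exists (A : 'M[K]_(k, m)) W, A *m W = 1%:M /\ F = row_space A.
Proof.
move=> [F0 FL] [l [f [[c cf] loc]]].
have [j fj] : exists j, f j != 0.
  apply: contrapT => h; have /eqP := oner_neq0 K; case.
  rewrite -cf big1 // => j _; have [->|fj] := eqVneq (f j) 0; first by rewrite mulr0.
  by case: h; exists j.
have [R' [phi [[[g phig] surj inj] [_ [A' [A'free A'span]]]]]] := loc j.
have phi_inj : injective phi.
  move=> x y xy; apply/eqP; rewrite -subr_eq0; have : phi (x - y) = 0.
    by rewrite rmorphB xy subrr.
  case/inj => e /eqP; rewrite mulf_eq0 expf_eq0 (negPf fj) andbF //.
have phi_surj y : exists x, phi x = y.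
  have [a [e ya]] := surj y; exists (a / f j ^+ e).
  have fe : f j ^+ e != 0 by rewrite expf_neq0.
  have ye : phi (a / f j ^+ e) * phi (f j) ^+ e = phi a.
    by rewrite -rmorphXn -rmorphM divfK.
  have ge : phi (f j) ^+ e * g ^+ e = 1 by rewrite -exprMn phig expr1n.
  by rewrite -[LHS]mulr1 -[RHS]mulr1 -ge !mulrA ye ya.
have lift m1 m2 (Y : 'M[R']_(m1, m2)) : exists X, map_mx phi X = Y.
  have [X XE] := boolp.choice (fun p : 'I_m1 * 'I_m2 => phi_surj (Y p.1 p.2)).
  by exists (\matrix_(a, b) X (a, b)); apply/matrixP => a b; rewrite !mxE XE.
have phiM_inj m1 m2 : injective (map_mx phi : 'M_(m1, m2) -> 'M_(m1, m2)).
  by move=> X Y /matrixP XY; apply/matrixP => a b; apply: phi_inj; have := XY a b; rewrite !mxE.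
have [A AA'] := lift _ _ A'.
have FE x : F x <-> base_change phi F (map_mx phi x).
  split=> [Fx|]; first by apply: sub_lin_span; exists x.
  pose H : set 'rV[R']_m := (fun y => exists2 x, F x & y = map_mx phi x).
  have Hsub : is_submodule H.
    split; first by exists 0; rewrite ?map_mx0.
    move=> a _ _ [y Fy ->] [z Fz ->]; have [b <-] := phi_surj a.
    by exists (b *: y + z); [exact: FL | rewrite map_mxD map_mxZ].
  move/(lin_span_sub Hsub) => h; have [_ [y Fy <-]|y Fy] := h.
    by exists y.
  by move/phiM_inj => ->.
have span : F = row_space A.
  apply/seteqP; split=> x.
    move/FE/A'span => [u' xu]; have [u uE] := lift _ _ u'; exists u.
    by apply: phiM_inj; rewrite map_mxM AA' uE.
  case=> u ->; apply/FE/A'span; exists (map_mx phi u).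
  by rewrite map_mxM AA'.
have free : row_free A.
  rewrite -kermx_eq0; apply/eqP/row_matrixP => a; rewrite row0.
  apply: phiM_inj; rewrite map_mx0; apply: A'free.
  by rewrite -AA' -map_mxM -row_mul mulmx_ker row0 map_mx0.
by have [W AW] := row_freeP free; exists A, W.
Qed.

Section FieldPoint.
Variables (F0 : fieldType) (v : dval F0) (pi0 : F0).
Hypothesis pi0P : uniformizer v pi0.
Variables (n i : nat).
Hypothesis i_le_n : (i <= n)%N.
Local Notation pi0_int := (pi0_int pi0P).

Let pi0_neq0 : pi0 != 0. Proof. by case: pi0P. Qed.

Lemma row_space_sub (K : fieldType) k m l (A : 'M[K]_(k, m)) (B : 'M[K]_(l, m)) :
  (forall a, row_space B (row a A)) -> exists H, A = H *m B.
Proof.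
move=> h; have /submxP[H ->] : (A <= B)%MS; last by exists H.
by apply/row_subP => a; have [u ->] := h a; rewrite submxMl.
Qed.

Lemma row_in_row_space (K : comPzRingType) k m (A : 'M[K]_(k, m)) a :
  row_space A (row a A).
Proof. by exists (delta_mx 0 a); rewrite rowE. Qed.

Lemma field_point (K : fieldType) (s : {rmorphism valring v -> K})
    (Fm : Defs.family n K) :
  naive_point pi0 i s Fm ->
  exists A A', naive_pair i (s pi0_int) A A' /\ Fm = family_of A A'.
Proof.
move=> [sub pair trans mulpi].
have scaleE (x y : valring v) : map_mx s (scale_V n i x y) = scale_V n i (s x) (s y).
  exact: map_scale_V.
(* In the chosen bases multiplication by pi0 is the identity matrix, so only the two members of
   index 0 matter. *)
have step L : Fm (chain_pi L) = Fm L.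
  rewrite -(mulpi L 1%:M) ?map_mx1.
    by apply/seteqP; split=> [_ [x Fx <-]|x Fx]; [rewrite mulmx1 | exists x; rewrite ?mulmx1].
  rewrite /mult_matrix map_mx1 mul1mx -linearZ; congr diag_mx.
  apply/rowP=> a; rewrite !mxE -{2}(expr1z pi0) -expfzDr //; congr (_ ^ _).
  by rewrite /lat_exp /= opprB addrA.
have Fm0 d b : Fm (d, b) = Fm (0, b).
  have pos (k : nat) d' : Fm (d', b) = Fm (d' - k%:Z, b).
    elim: k d' => [|k IH] d'; first by rewrite subr0.
    by rewrite IH -(step (d' - k%:Z, b)); congr (Fm (_, _)) => /=; lia.
  case: d => k; first by rewrite (pos k (Posz k)) subrr.
  by rewrite [RHS](pos k.+1 0) sub0r NegzE.
have [subT locT] := sub (0, true); have [subF locF] := sub (0, false).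
have [A [W [AW FA]]] := summand_over_field subT locT.
have [A' [W' [AW' FA']]] := summand_over_field subF locF.
exists A, A'; split; last first.
  by apply/funext => -[d b]; rewrite Fm0 /family_of /=; case: b.
split; [by exists W | by exists W' | | |].
- have pm : pairing_matrix pi0 i (0, true) (pairing n (valring v)).
    rewrite /pairing_matrix perfect_pairing //.
    by apply/matrixP => a b; rewrite !mxE rmorph_nat.
  apply/matrixP => a b; have := pair (0, true) _ pm (row a A) (row b A').
  rewrite FA (_ : chain_dual (0, true) = (0, false)); last by rewrite /chain_dual oppr0.
  rewrite FA' map_pairing => /(_ (row_in_row_space _ _) (row_in_row_space _ _)).
  move/matrixP/(_ 0 0); rewrite [RHS]mxE => e; rewrite [RHS]mxE -[RHS]e.
  by rewrite -row_mul !mxE; apply: eq_bigr => j _; rewrite !mxE.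
- have mm : mult_matrix pi0 i 1 (0, true) (1, false) (scale_V n i 1 pi0_int).
    rewrite /mult_matrix scale1r map_scale_V mul_diag_mx; apply/matrixP => x y.
    rewrite !mxE; case: (eqVneq x y) => [->|_]; last by rewrite !mulr0n mulr0.
    rewrite !mulr1n rmorph1 /=.
    have -> : (if in_P n i y then 1 else pi0) = pi0 ^ (if in_P n i y then 0 else 1).
      by case: ifP; rewrite ?expr0z ?expr1z.
    rewrite -expfzDr //; congr (_ ^ _).
    by rewrite /lat_exp /in_P /=; have := ltn_ord y; case: ifP; lia.
  apply: row_space_sub => a; rewrite row_mul -FA' -(Fm0 1) -(rmorph1 s) -scaleE.
  by apply: trans mm _ _; rewrite FA; apply: row_in_row_space.
- have mm : mult_matrix pi0 i 1 (0, false) (0, true) (scale_V n i pi0_int 1).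
    rewrite /mult_matrix scale1r map_scale_V mul_diag_mx; apply/matrixP => x y.
    rewrite !mxE; case: (eqVneq x y) => [->|_]; last by rewrite !mulr0n mulr0.
    rewrite !mulr1n rmorph1 /=.
    have -> : (if in_P n i y then pi0 else 1) = pi0 ^ (if in_P n i y then 1 else 0).
      by case: ifP; rewrite ?expr0z ?expr1z.
    rewrite -expfzDr //; congr (_ ^ _).
    by rewrite /lat_exp /in_P /=; have := ltn_ord y; case: ifP; lia.
  apply: row_space_sub => a; rewrite row_mul -FA -(rmorph1 s) -scaleE.
  by apply: trans mm _ _; rewrite FA'; apply: row_in_row_space.
Qed.

End FieldPoint.

(** * Lifting special points *)

(** Equality of bundled morphisms is needed because a point is a predicate on the structure morphism
    itself. *)
Lemma rmorphism_ext (R S : pzSemiRingType) (f g : {rmorphism R -> S}) : f =1 g -> f = g.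
Proof.
case: f => f [[fD] [fM]]; case: g => g [[gD] [gM]] /= /funext fg.
move: fD fM gD gM; rewrite fg => fD fM gD gM.
by rewrite (Prop_irrelevance fD gD) (Prop_irrelevance fM gM).
Qed.

Lemma eqmx_row_space (K : fieldType) k l m (A : 'M[K]_(k, m)) (B : 'M[K]_(l, m)) :
  (A :=: B)%MS -> row_space A = row_space B.
Proof.
move=> AB; apply/seteqP; split=> x [u ->].
  by have /submxP[w ->] : (u *m A <= B)%MS; [rewrite -AB submxMl | exists w].
by have /submxP[w ->] : (u *m B <= A)%MS; [rewrite AB submxMl | exists w].
Qed.

Section Lifting.
Variables (F0 : fieldType) (v : dval F0) (pi0 : F0).
Hypothesis pi0P : uniformizer v pi0.
Variable half0 : valring v.
Hypothesis half0P : half0 + half0 = 1.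
Variables (F : fieldExtType F0) (w : dval F) (pi : F).
Hypothesis pi_sqr : pi ^+ 2 = - pi0%:A.
Hypothesis ext : dval_extends2 v w.
Variables (n i : nat).
Hypothesis i_le_n : (i <= n)%N.

Local Notation incl := (valring_incl ext).
Local Notation piP := (pi_uniformizer pi0P pi_sqr ext).
Local Notation pi_int := (pi0_int piP).
Local Notation pi0_int := (pi0_int pi0P).
Local Notation p := (odim i).
Local Notation q := (odim (n - i)).

Lemma family_pull_family (R R' : comPzRingType) (f : {rmorphism R -> R'})
    (A A' : 'M[R]_(n.+1, dimV n)) :
  family_pull f (family_of A A') = family_of (map_mx f A) (map_mx f A').
Proof.
apply/funext => L; rewrite /family_pull /family_of base_change_row_space.
by case: L.2.
Qed.

(** Rows taken from the span of a frame multiply its wedge by a determinant, so the condition need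
    only hold for the frame. *)
Lemma spin_point_family eps (R : comPzRingType) (s : {rmorphism valring w -> R})
    (A A' : 'M[R]_(n.+1, dimV n)) :
  naive_pair i (s (incl pi0_int)) A A' ->
  (forall Lc : chain, base_change s (lattice_W (w := w) pi0 pi i eps Lc)
     (wedge (if Lc.2 then A else A'))) ->
  spin_point pi0 pi ext i eps s (family_of A A').
Proof.
move=> AA hW; split; first exact: (naive_point_family (pi0P := pi0P)).
move=> Lc; apply: zariski_locally_id => B hB.
have [u ->] : exists u, B = u *m (if Lc.2 then A else A').
  have /boolp.choice[u uE] : forall j, exists u : 'rV_n.+1,
      row j B = u *m (if Lc.2 then A else A').
    by move=> j; have := hB j; rewrite base_change_row_space map_mx_id.
  exists (\matrix_j u j); apply/row_matrixP => j.
  by rewrite uE row_mul rowK.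
rewrite wedge_mull -[_ *: _]addr0.
have [S0 SL] : is_submodule (base_change s (lattice_W (w := w) pi0 pi (n := n) i eps Lc)).
  exact: lin_span_submodule.
exact: SL (hW Lc) S0.
Qed.

Lemma lift_special eps (K : fieldType) (s : {rmorphism valring w -> K})
    (Fm : Defs.family n K) :
  s pi_int = 0 -> naive_point pi0 i (s \o incl) Fm ->
  exists (R : comNzRingType) (L : fieldType) (s' : {rmorphism valring w -> R})
    (f : {rmorphism R -> K}) (g : {rmorphism R -> L})
    (A A' : 'M[R]_(n.+1, dimV n)),
    [/\ injective g, injective s', forall a, f (s' a) = s a,
        Fm = family_pull f (family_of A A') &
        naive_pair i (s' (incl pi0_int)) A A' /\
        forall Lc : chain, base_change s' (lattice_W (w := w) pi0 pi i eps Lc)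
          (wedge (if Lc.2 then A else A'))].
Proof.
move=> s0 /(field_point pi0P i_le_n)[A0 [A0' [AA0 FmE]]].
have pi0E : incl pi0_int = - pi_int ^+ 2.
  apply: val_inj; rewrite rmorphN rmorphXn /= -[LHS]/(pi0%:A).
  by rewrite [pi ^+ 2]pi_sqr opprK.
have c0 : s (incl pi0_int) = 0 by rewrite pi0E rmorphN rmorphXn s0 expr0n oppr0.
have halfK : s (incl half0) + s (incl half0) = 1.
  by rewrite -!rmorphD half0P !rmorph1.
have AA0' : naive_pair i 0 A0 A0' by rewrite -c0.
have [r [u [t [phi [UP [UQ [rt ut lUP lUQ A0E]]]]]]] :=
  classify halfK i_le_n (naive_pair_block i_le_n AA0').
have [csP hP] := lUP; have [csQ hQ] := lUQ.
have [R [L [s' [f [g [gF [gi fs hc gs kg]]]]]]] :=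
  lift_ring s (csP ++ csQ ++ mx_entries phi).
have [hcP /hits_cat[hcQ /hits_mx[phi' phiE]]] := hits_cat hc.
have halfR : s' (incl half0) + s' (incl half0) = 1.
  by rewrite -!rmorphD half0P !rmorph1.
have [VP oVP VPE] := hP R f _ halfR hcP.
have [VQ oVQ VQE] := hQ R f _ halfR hcQ.
have pE : p = (r + odim t + r)%N by rewrite !odimE; lia.
have qE : q = (u + odim t + u)%N by rewrite !odimE; lia.
have ek : (r + (u + odim t))%N = n.+1 by rewrite odimE; lia.
pose wR := s' pi_int.
have cR : s' (incl pi0_int) = - wR ^+ 2 by rewrite pi0E rmorphN rmorphXn.
have EE := frame_pair pE qE wR phi'.
rewrite -cR in EE.
set E := frame_mx t p q wR phi' in EE; set E' := dual_frame_mx t p q wR phi' in EE.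
have cL : g (s' (incl pi0_int)) = gF pi0%:A by rewrite gs.
have halfL : g (s' (incl half0)) + g (s' (incl half0)) = 1.
  by rewrite -rmorphD halfR rmorph1.
have pi0_neq0 : pi0 != 0 by case: pi0P.
have two_neq0 : (2%:R : F) != 0.
  apply/eqP => e; have := congr1 val half0P.
  have : (2%:R : F0) = 0.
    apply/eqP; have := congr1 (fun x : F => x == 0) e; rewrite eqxx.
    by rewrite -(scaler_nat 2 (1 : F)) scaler_eq0 oner_eq0 orbF.
  rewrite rmorphD rmorph1 -mulr2n -(mulr_natr (val half0)) => -> /eqP.
  by rewrite mulr0 eq_sym oner_eq0.
have gEE := map_block_pair g EE; rewrite cL in gEE.
have [b hb] := frame_sign i_le_n pi_sqr pi0_neq0 two_neq0 halfL ek gEE.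
pose MU := block_mx VP 0 0 VQ; pose De := block_mx (reflection_mx R i) 0 0 (1%:M : 'M_q).
have oMU : orth_pair MU by apply: orth_pair_block.
have oDe : orth_pair De by apply: orth_pair_block; [exact: orth_reflection | exact: orth1].
have fw : f wR = 0 by rewrite /wR fs.
have fE : map_mx f E = frame_mx t p q 0 phi.
  rewrite /E /frame_mx !(map_col_mx, map_row_mx, map_mxZ, map_mxM) rmorphXn /= fw phiE.
  rewrite expr2 mul0r !scale0r !map_pid_mx !map_antidiag.
  by congr (col_mx _ (col_mx _ (row_mx _ _))); apply/matrixP => x y; rewrite !mxE rmorph_nat.
(* At w = 0 the P-part of the frame is spanned by the first r <= i coordinates, which the reflection
   in the middle coordinate i fixes. *)
have fDe : map_mx f E *m map_mx f De = map_mx f E.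
  rewrite fE /De map_block_mx !map_mx0 map_mx1.
  rewrite /frame_mx expr2 mul0r !scale0r !mul_col_mx !mul_row_block.
  rewrite !(mulmx0, mul0mx, addr0, add0r, mulmx1).
  have -> : map_mx f (reflection_mx R i) = reflection_mx K i.
    apply/matrixP => x y; rewrite !mxE rmorphMn.
    by case: (_ == i); rewrite ?rmorphN1 ?rmorph1.
  by rewrite pid_reflection //; lia.
(* If the lifted isometry has the wrong sign for [eps], the reflection is inserted; it changes the
   determinant but not the reduction to K. *)
have [M [oM dM fM]] : exists M, [/\ orth_pair M,
    \det (map_mx g M) * (-1) ^+ b = gF (sgn_bool F eps) &
    map_mx f E *m map_mx f M = map_mx f E *m map_mx f MU].
  have [[b' db'] _] := hb _ (map_orth_pair g oMU).
  have dDe : \det (map_mx g De) = -1.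
    by rewrite det_map_mx det_lblock det1 mulr1 det_reflection rmorphN1.
  case: (eqVneq (b (+) b') (~~ eps)) => bb.
    exists MU; split=> //; rewrite db' -signr_addb addbC bb /sgn_bool.
    by case: eps {hb bb}; rewrite ?rmorph1 ?rmorphN1 ?expr0 ?expr1.
  exists (De *m MU); split; first exact: orth_pairM.
    rewrite map_mxM det_mulmx dDe db' -mulrA -signr_addb addbC mulN1r.
    have -> : b (+) b' = eps by move: bb; case: (b (+) b'); case: eps {hb}.
    by rewrite /sgn_bool; case: eps {hb bb}; rewrite ?rmorph1 ?rmorphN1 ?expr0 ?expr1 ?opprK.
  by rewrite map_mxM mulmxA fDe.
pose A : 'M[R]_(n.+1, dimV n) := castmx (ek, erefl) (E *m M *m embed_mx i_le_n R).
pose A' : 'M[R]_(n.+1, dimV n) := castmx (ek, erefl) (E' *m M *m embed_mx i_le_n R).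
have AA : naive_pair i (s' (incl pi0_int)) A A'.
  have := naive_pair_embed i_le_n (block_pairM oM EE).
  rewrite /A /A'; move: (_ *m _ *m _) (_ *m _ *m _).
  by case: _ / ek {hb A A'} => X X'; rewrite !castmx_id.
have gAA := map_naive_pair g AA; rewrite cL in gAA.
have [_ eig] := hb _ (map_orth_pair g oM).
have gA : map_mx g A = castmx (ek, erefl)
    (map_mx g E *m map_mx g M *m embed_mx i_le_n L).
  by rewrite /A map_castmx !map_mxM map_embed_mx.
have hW (Lc : chain) : base_change s' (lattice_W (w := w) pi0 pi i eps Lc)
    (wedge (if Lc.2 then A else A')).
  apply: (spin_member piP (split_basis_unit n pi_sqr pi0_neq0 two_neq0) gi gs kg).
  have -> : map_mx g (if Lc.2 then A else A') = (if Lc.2 then map_mx g A else map_mx g A').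
    by case: Lc.2.
  by apply: spin_eigen_chain => //; rewrite gA; apply: eig.
exists R, L, s', f, g, A, A'; split=> //.
  by move=> x y xy; apply: val_inj; apply: (fmorph_inj gF); rewrite -!gs xy.
have fAA := map_naive_pair f AA; rewrite fs c0 in fAA.
have A0f : (A0 :=: map_mx f A)%MS.
  have -> : A0 = A0 *m (embed_mx i_le_n K)^T *m embed_mx i_le_n K.
    by rewrite -mulmxA embed_mulVT mulmx1.
  have -> : map_mx f A = castmx (ek, erefl)
      (frame_mx t p q 0 phi *m block_mx UP 0 0 UQ *m embed_mx i_le_n K).
    rewrite /A map_castmx !map_mxM map_embed_mx fM fE.
    by rewrite map_block_mx !map_mx0 VPE VQE.
  apply: eqmx_trans (eqmx_sym (eqmx_cast _ _)).
  exact: eqmxMr.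
rewrite family_pull_family FmE; apply/funext => Lc; rewrite /family_of.
by case: Lc.2; apply: eqmx_row_space; [exact: A0f | exact: (naive_pair_dual i_le_n AA0' fAA A0f)].
Qed.

End Lifting.

(** An open neighbourhood of the special point contains the points of Spec R where some [e] with
    nonzero image in K does not vanish. Such an [e] is nonzero, so by injectivity of [g] the point
    over L is among them. *)
Lemma topologically_flat_lift (O : comPzRingType) (X : moduli O) :
  (forall (K : fieldType) (s : {rmorphism O -> K}) (x : datum X K),
    Defs.point s x -> ~ injective s ->
    exists (R : comPzRingType) (L : fieldType) (s' : {rmorphism O -> R})
      (f : {rmorphism R -> K}) (g : {rmorphism R -> L}) (y : datum X R),
      [/\ injective g, injective s', forall a, f (s' a) = s a, x = pull f y &
          Defs.point s' y /\ Defs.point (g \o s') (pull g y)]) ->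
  topologically_flat X.
Proof.
move=> lift U Usub Uopen [K [s [x [px Ux]]]].
have [sinj|sninj] := pselect (injective s); first by exists K, s, x.
have [R [L [s' [f [g [y [gi si fs xE [py pgy]]]]]]]] := lift K s x px sninj.
have sE : s = f \o s' by apply: rmorphism_ext => a /=; rewrite fs.
rewrite xE sE in Ux; have [e [fe Ue]] := Uopen R s' y py K f Ux.
exists L, (g \o s'), (pull g y); split=> //; last by move=> a b /gi/si.
apply: Ue; apply: contra fe => /eqP ge.
by rewrite (gi e 0) ?rmorph0 // ge rmorph0.
Qed.

Theorem theorem4p16
    (F0 : fieldType) (v : dval F0) (pi0 : F0) (p : nat)
    (F0_complete : dval_complete v)
    (pi0_unif : uniformizer v pi0)
    (p_char : residue_pchar v p) (p_gt2 : (2 < p)%N)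
    (F : fieldExtType F0) (w : dval F) (pi : F)
    (pi_sqr : pi ^+ 2 = - pi0%:A)
    (F_gen : <<1; pi>>%VS = fullv)
    (w_ext : dval_extends2 v w)
    (n i : nat) (n_ge1 : (1 <= n)%N) (i_le_n : (i <= n)%N) :
  topologically_flat (naive_local_model v pi0 n i) /\
  forall eps : bool,
    topologically_flat (spin_local_model pi0 pi w_ext n i eps).
Proof.
have [half0 half0P] := two_unit p_char p_gt2.
split=> [|eps]; apply: topologically_flat_lift => K s x px /noninjective_kills ninj.
(* The lift needs a square root of - pi0, so it is made over the ring of integers of F and its
   structure map is then restricted. *)
- have [sw swE] := extend_special pi_sqr F_gen w_ext (ninj _ pi0_unif).
  have sw0 : sw (pi0_int (pi_uniformizer pi0_unif pi_sqr w_ext)) = 0.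
    apply/eqP; rewrite -sqrf_eq0 -rmorphXn -[_ ^+ 2]opprK rmorphN oppr_eq0.
    have -> : - pi0_int (pi_uniformizer pi0_unif pi_sqr w_ext) ^+ 2 =
        valring_incl w_ext (pi0_int pi0_unif).
      by apply: val_inj; rewrite rmorphN rmorphXn /= pi_sqr opprK.
    by rewrite swE ninj.
  have sE : s = sw \o valring_incl w_ext by apply: rmorphism_ext => a /=; rewrite swE.
  rewrite sE /= in px.
  have [R [L [s' [f [g [A [A' [gi si fs xE [AA _]]]]]]]]] :=
    lift_special half0P i_le_n true sw0 px.
  exists R, L, (s' \o valring_incl w_ext), f, g, (family_of A A'); split=> //.
  + move=> a b /si /(congr1 val)/eqP; rewrite -subr_eq0 /= -scalerBl.
    by rewrite scaler_eq0 oner_eq0 orbF subr_eq0 => /eqP/val_inj.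
  + by move=> a /=; rewrite fs swE.
  + rewrite /= family_pull_family; split.
      exact: (@naive_point_family _ _ _ pi0_unif _ _ i_le_n _
        (s' \o valring_incl w_ext) _ _ AA).
    exact: (@naive_point_family _ _ _ pi0_unif _ _ i_le_n _
      (g \o (s' \o valring_incl w_ext)) _ _ (map_naive_pair g AA)).
- have [px' _] := px.
  have [R [L [s' [f [g [A [A' [gi si fs xE [AA hW]]]]]]]]] :=
    lift_special half0P i_le_n eps (ninj _ (pi_uniformizer pi0_unif pi_sqr w_ext)) px'.
  exists R, L, s', f, g, (family_of A A'); split=> //; split.
    exact: (spin_point_family (pi0P := pi0_unif)).
  rewrite /= family_pull_family; apply: (spin_point_family (pi0P := pi0_unif)).
  + exact: i_le_n.
  + exact (map_naive_pair g AA).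
  + move=> Lc; have -> : (if Lc.2 then map_mx g A else map_mx g A') =
        map_mx g (if Lc.2 then A else A') by case: Lc.2.
    by rewrite -map_wedge; apply: base_change_base_change.
Qed.
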